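(* Let $\lambda(t):[0,\infty)\to[0,\infty)$ be a nonnegative, strictly increasing and continuous function, and let $\{N(t),t\ge0\}\in MPPS(\alpha,\beta,c,\lambda(t))$, with Stacy mixing variable $\xi$. Then: (a) For all $t>0$, $N(t)\in MPStacy\left(\alpha,\frac{\beta}{\lambda(t)},c\right)$. (b) The mean and the variance of this process are $$\mathbb{E}N(t)=\frac{\Gamma\left(\alpha+\frac1c\right)}{\beta\Gamma(\alpha)}\lambda(t),\quad \alpha>-\frac1c,$$ $$\mathbb{D}N(t)=\lambda(t)\frac{\Gamma\left(\alpha+\frac1c\right)}{\beta\Gamma(\alpha)}\left(1+\frac{\Gamma\left(\alpha+\frac2c\right)}{\Gamma\left(\alpha+\frac1c\right)}-\frac{\Gamma\left(\alpha+\frac1c\right)}{\beta\Gamma(\alpha)}\right),\quad \alpha>-\min\left(\frac1c,\frac2c\right).$$ (c) The probability generating function of the time intersections is $$\mathbb{E}(z^{N(t)})=\frac{|c|}{\Gamma(\alpha)}Z_{-c}^{-c\alpha}\left(\frac{\lambda(t)}{\beta}(1-z)\right),\quad z<1.$$ (d) For $t>0$ and $n=0,1,\ldots$, the conditional density of $\xi$ given $N(t)=n$ is $$P_\xi(x\,|\,N(t)=n)=\frac{\beta^{c\alpha+n}x^{c\alpha+n-1}}{Z_{-c}^{-c\alpha-n}\left(\frac{\lambda(t)}{\beta}\right)}e^{-\lambda(t)x-(\beta x)^c},\quad x>0.$$ (e) For $t>0$ and $n=0,1,\ldots$, the mean square regression is $$\mathbb{E}(\xi\,|\,N(t)=n)=\frac{Z_{-c}^{-c\alpha-n-1}\left(\frac{\lambda(t)}{\beta}\right)}{\beta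 Z_{-c}^{-c\alpha-n}\left(\frac{\lambda(t)}{\beta}\right)}.$$ (f) For all $k=0,1,\ldots$ with $\frac kc>-\alpha$, $$\mathbb{E}[N(t)(N(t)-1)\cdots(N(t)-k+1)]=[\lambda(t)]^k\,\mathbb{E}(\xi^k)=\frac{[\lambda(t)]^k\,\Gamma\left(\alpha+\frac kc\right)}{\beta^k\Gamma(\alpha)}.$$ (g) For all $n\in\mathbb{N}$ and $0\le t_1\le t_2\le\ldots\le t_n$, the finite-dimensional distributions of the random process $\{N(t),t\ge0\}$ are $$(N(t_1),N(t_2),\ldots,N(t_n))\in O_{PS}(\alpha,\beta,c;\lambda(t_1),\lambda(t_2),\ldots,\lambda(t_n)).$$ (h) For all $n\in\mathbb{N}$ and $0\le t_1\le t_2\le\ldots\le t_n$, the joint distribution of the additive increments of the random process $\{N(t),t\ge0\}$ is $$(N(t_1),N(t_2)-N(t_1),\ldots,N(t_n)-N(t_{n-1}))\in M_{PS}(\alpha,\beta,c;\lambda(t_1),\lambda(t_2),\ldots,\lambda(t_n)).$$ (i) The inter-occurrence times $\tau_1,\tau_2,\ldots$ of the counting process $N$ are dependent and $Exp\text{-}St(\alpha,\beta;c)$ distributed. (j) For $n\in\mathbb{N}$, the moment $T_n$ of occurrence of the $n$-th event satisfies $T_n\in Erlang\text{-}St(n;\alpha,\beta;c)$.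
   Context: Throughout, $\alpha>0$, $\beta>0$, $c\in\mathbb{R}\setminus\{0\}$; $\Gamma(\alpha)=\int_0^\infty y^{\alpha-1}e^{-y}\,dy$; $\mathbb{D}$ denotes variance; $\mathbb{N}=\{1,2,\ldots\}$. $\xi\in Stacy(\alpha,\beta;c)$ means that $\xi$ is a random variable with density $$P_\xi(x)=|c|\frac{\beta^{c\alpha}}{\Gamma(\alpha)}x^{c\alpha-1}e^{-(\beta x)^c},\quad x\ge0.$$ The Krätzel function is $$Z_\rho^\nu(x)=\int_0^\infty y^{\nu-1}e^{-(y^\rho+\frac{x}{y})}\,dy=\int_0^\infty t^{-\nu-1}e^{-(t^{-\rho}+tx)}\,dt,\quad x>0,$$ for $\rho\in(0,\infty)$, $\nu\in\mathbb{C}$, and, when $\rho\le0$, for $\mathrm{Re}(\nu)<0$; moreover $Z_\rho^\nu(0)=\frac{1}{|\rho|}\Gamma\left(\frac{\nu}{\rho}\right)$ when $\rho\nu>0$. MPPS-process: let $\lambda(t):[0,\infty)\to[0,\infty)$ be nonnegative, strictly increasing and continuous with $\lambda(0)=0$, let $\xi\in Stacy(\alpha,\beta;c)$, and let $N_1$ be a homogeneous Poisson process with intensity $1$, independent of $\xi$. The random process $N=\{N_1(\xi\lambda(t)),\,t\ge0\}$ is called a mixed Poisson process with Stacy mixing variable, written $N\in MPPS(\alpha,\beta,c,\lambda(t))$. $\theta\in MPStacy(\alpha,\beta,c)$ (mixed Poisson-Stacy distribution) means $$\mathbb{P}(\theta=n)=\frac{|c|}{n!\,\beta^n\,\Gamma(\alpha)}Z_{-c}^{-c\alpha-n}\left(\frac1\beta\right),\quad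 n=0,1,\ldots.$$ For $n\in\mathbb{N}$ and $0<\lambda_1<\lambda_2<\ldots<\lambda_n$, $(N_1,\ldots,N_n)\in O_{PS}(\alpha,\beta,c;\lambda_1,\ldots,\lambda_n)$ (ordered Poisson-Stacy distribution) means that for all integers $0\le k_1\le k_2\le\ldots\le k_n$, $$\mathbb{P}(N_1=k_1,\ldots,N_n=k_n)=\frac{|c|\lambda_1^{k_1}(\lambda_2-\lambda_1)^{k_2-k_1}\cdots(\lambda_n-\lambda_{n-1})^{k_n-k_{n-1}}}{\beta^{k_n}k_1!(k_2-k_1)!\cdots(k_n-k_{n-1})!\,\Gamma(\alpha)}Z_{-c}^{-c\alpha-k_n}\left(\frac{\lambda_n}{\beta}\right),$$ and the probability is $0$ otherwise. For $n\in\mathbb{N}$ and $0<\lambda_1<\lambda_2<\ldots<\lambda_n$, $(N_1,\ldots,N_n)\in M_{PS}(\alpha,\beta,c;\lambda_1,\ldots,\lambda_n)$ (mixed Poisson-Stacy distributed random vector) means that for all $m_1,\ldots,m_n\in\{0,1,\ldots\}$, $$\mathbb{P}(N_1=m_1,\ldots,N_n=m_n)=\frac{|c|\lambda_1^{m_1}(\lambda_2-\lambda_1)^{m_2}\cdots(\lambda_n-\lambda_{n-1})^{m_n}}{\beta^{m_1+\ldots+m_n}m_1!m_2!\cdots m_n!\,\Gamma(\alpha)}Z_{-c}^{-c\alpha-m_1-\ldots-m_n}\left(\frac{\lambda_n}{\beta}\right),$$ and the probability is $0$ otherwise. Viewing the MPPS-process $N$ as a counting process, $\tau_1,\tau_2,\ldots$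 are its inter-occurrence (inter-arrival) times and, for $n\in\mathbb{N}$, $T_n=\tau_1+\tau_2+\ldots+\tau_n$ is the moment of occurrence (arrival) of the $n$-th event, so that $N(t)=\sup\{i\ge0:T_i\le t\}$, $t\ge0$, with $T_0=0$. $\tau\in Exp\text{-}St(\alpha,\beta;c)$ means that $\tau$ has density $\frac{|c|}{\beta\Gamma(\alpha)}Z_{-c}^{-c\alpha-1}\left(\frac t\beta\right)$ for $t>0$ and $0$ for $t\le0$. For $n\in\mathbb{N}$, $T\in Erlang\text{-}St(n;\alpha,\beta;c)$ means that $T$ has density $\frac{t^{n-1}|c|}{(n-1)!\,\beta^n\Gamma(\alpha)}Z_{-c}^{-c\alpha-n}\left(\frac t\beta\right)$ for $t>0$ and $0$ for $t\le0$.
   Formalization: Variance bracket in (b) corrected to 1+λ(t)(Γ(α+2/c)/(βΓ(α+1/c))−Γ(α+1/c)/(βΓ(α))); (c) for z<−1 only when z^N(t) is integrable; (i),(j) for λ(t)=t, and for unbounded λ about λ(T_n) and its increments in place of T_n, τ_n. *)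

(* Defs.v *)
From HB Require Import structures.
From mathcomp Require Import all_boot all_order all_algebra.
From mathcomp Require Import all_classical all_reals all_analysis.
From mathcomp Require Import measurable_realfun.

Set Implicit Arguments.
Unset Strict Implicit.
Unset Printing Implicit Defensive.
Import Order.TTheory GRing.Theory Num.Theory.
Import numFieldNormedType.Exports.
Local Open Scope classical_set_scope.
Local Open Scope ring_scope.

(* Only real orders nu of the Kratzel function are needed.  These integrals are
   real-valued: they are 0 when a nonnegative integrand has infinite integral. *)

Section special_functions.
Context {R : realType}.
Implicit Types a x rho nu : R.

Definition Gamma a : R :=
  \int[@lebesgue_measure R]_(y in `]0, +oo[) (y `^ (a - 1) * expR (- y)).

(* At x = 0 and rho * nu > 0 the integral equals Gamma (nu / rho) / |rho|. *)
Definition kratzel rho nu x : R :=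
  \int[@lebesgue_measure R]_(y in `]0, +oo[)
    (y `^ (nu - 1) * expR (- (y `^ rho + x / y))).

Definition stacy_pdf (alpha beta c x : R) : R :=
  if 0 <= x then
    `|c| * (beta `^ (c * alpha) / Gamma alpha) * x `^ (c * alpha - 1)
      * expR (- (beta * x) `^ c)
  else 0.

Definition exp_st_pdf (alpha beta c t : R) : R :=
  if 0 < t then
    `|c| / (beta * Gamma alpha) * kratzel (- c) (- c * alpha - 1) (t / beta)
  else 0.

Definition erlang_st_pdf (n : nat) (alpha beta c t : R) : R :=
  if 0 < t then
    t ^+ n.-1 * `|c| / (n.-1`!%:R * beta ^+ n * Gamma alpha)
      * kratzel (- c) (- c * alpha - n%:R) (t / beta)
  else 0.

Definition mpstacy_pmf (alpha beta c : R) (n : nat) : R :=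
  `|c| / (n`!%:R * beta ^+ n * Gamma alpha)
    * kratzel (- c) (- c * alpha - n%:R) beta^-1.

End special_functions.

Section distributions.
Context d {T : measurableType d} {R : realType} (P : probability T R).

(* Extended values are allowed because arrival times may be +oo on a null set;
   when f integrates to 1, X is almost surely finite. *)
Definition has_density (X : T -> \bar R) (f : R -> R) : Prop :=
  measurable_fun setT X /\
  forall A : set R, measurable A ->
    P (X @^-1` (EFin @` A))
      = (\int[@lebesgue_measure R]_(x in A) (f x)%:E)%E.

Definition Stacy (alpha beta c : R) (xi : T -> R) : Prop :=
  has_density (EFin \o xi) (stacy_pdf alpha beta c).

Definition Exp_St (alpha beta c : R) (tau : T -> \bar R) : Prop :=
  has_density tau (exp_st_pdf alpha beta c).

Definition Erlang_St (n : nat) (alpha beta c : R) (X : T -> \bar R) : Prop :=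
  has_density X (erlang_st_pdf n alpha beta c).

Definition MPStacy (alpha beta c : R) (theta : T -> nat) : Prop :=
  measurable_fun setT theta /\
  forall n, P [set w | theta w = n] = (mpstacy_pmf alpha beta c n)%:E.

(* Vectors of length n are sequences of which only the entries 0, ..., n - 1
   matter; [before x0 u i] is u_(i-1), with u_(-1) := x0, so that
   u_i - u_(i-1) is u_0 for i = 0. *)
Definition before (A : Type) (x0 : A) (u : nat -> A) (i : nat) : A :=
  if i is j.+1 then u j else x0.

(* The two laws below are meant for 0 < lam_0 < ... < lam_(n-1).  Ties and
   lam_0 = 0 are allowed, with 0 ^+ 0 = 1, which yields the limiting law. *)
Definition O_PS (n : nat) (alpha beta c : R) (lam : nat -> R)
    (X : nat -> T -> R) : Prop :=
  [/\ forall i, (i < n)%N -> measurable_fun setT (X i),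
      forall k : nat -> nat,
        (forall i, (i.+1 < n)%N -> (k i <= k i.+1)%N) ->
        P [set w | forall i, (i < n)%N -> X i w = (k i)%:R]
          = (`|c| * (\prod_(i < n) (lam i - before 0 lam i) ^+ (k i - before 0 k i))
             / (beta ^+ k n.-1 * (\prod_(i < n) (k i - before 0 k i)`!%:R)
                * Gamma alpha)
             * kratzel (- c) (- c * alpha - (k n.-1)%:R) (lam n.-1 / beta))%:E
    & forall v : nat -> R,
        ~ (exists k : nat -> nat,
             (forall i, (i.+1 < n)%N -> (k i <= k i.+1)%N) /\
             (forall i, (i < n)%N -> v i = (k i)%:R)) ->
        P [set w | forall i, (i < n)%N -> X i w = v i] = 0%E].

Definition M_PS (n : nat) (alpha beta c : R) (lam : nat -> R)
    (X : nat -> T -> R) : Prop :=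
  [/\ forall i, (i < n)%N -> measurable_fun setT (X i),
      forall m : nat -> nat,
        let s := (\sum_(i < n) m i)%N in
        P [set w | forall i, (i < n)%N -> X i w = (m i)%:R]
          = (`|c| * (\prod_(i < n) (lam i - before 0 lam i) ^+ m i)
             / (beta ^+ s * (\prod_(i < n) (m i)`!%:R) * Gamma alpha)
             * kratzel (- c) (- c * alpha - s%:R) (lam n.-1 / beta))%:E
    & forall v : nat -> R,
        ~ (exists m : nat -> nat, forall i, (i < n)%N -> v i = (m i)%:R) ->
        P [set w | forall i, (i < n)%N -> X i w = v i] = 0%E].

Definition independent (F G : set (set T)) : Prop :=
  forall A B, F A -> G B -> P (A `&` B) = (P A * P B)%E.

Definition sigma_rv d' (U : measurableType d') (X : T -> U) : set (set T) :=
  [set X @^-1` B | B in measurable].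

Definition sigma_process (N : R -> T -> nat) : set (set T) :=
  <<s [set A | exists (s : R) (B : set nat), 0 <= s /\ A = N s @^-1` B] >>.

(* Elementary conditioning on an event E; only meaningful for P E > 0. *)
Definition cond_prob (A E : set T) : R := fine (P (A `&` E)) / fine (P E).

Definition cond_mean (X : T -> R) (E : set T) : \bar R :=
  ((\int[P]_(w in E) (X w)%:E) * ((fine (P E))^-1)%:E)%E.

Definition has_cond_density (X : T -> R) (E : set T) (f : R -> R) : Prop :=
  (0 < P E)%E /\
  forall A : set R, measurable A ->
    (cond_prob (X @^-1` A) E)%:E
      = (\int[@lebesgue_measure R]_(x in A) (f x)%:E)%E.

(* Processes indexed by [0, +oo[ are functions on R whose values at negative
   times are irrelevant.  Increments are given for s < u only, since
   [poisson_pmf 0] is not the point mass at 0; the natural subtraction is exact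
   because paths are nondecreasing. *)
Definition poisson_process (rate : R) (N : R -> T -> nat) : Prop :=
  [/\ forall s : R, 0 <= s -> measurable_fun setT (N s),
      forall w, N 0 w = 0%N,
      forall w (s u : R), 0 <= s -> s <= u -> (N s w <= N u w)%N,
      forall w (s : R), 0 <= s -> \forall u \near s^'+, N u w = N s w
    & (forall (n : nat) (s : nat -> R) (k : nat -> nat),
         0 <= s 0%N -> (forall i, (i < n)%N -> s i <= s i.+1) ->
         P [set w | forall i, (i < n)%N -> (N (s i.+1) w - N (s i) w)%N = k i]
           = (\prod_(i < n)
               P [set w | (N (s i.+1) w - N (s i) w)%N = k i])%E)
      /\
      (forall (s u : R) k, 0 <= s -> s < u ->
         P [set w | (N u w - N s w)%N = k]
           = (poisson_pmf (rate * (u - s)) k)%:E)].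

Definition time_scale (lambda : R -> R) : Prop :=
  [/\ forall t : R, 0 <= t -> 0 <= lambda t,
      forall s t : R, 0 <= s -> s < t -> lambda s < lambda t,
      {within `[0, +oo[, continuous lambda}
    & lambda 0 = 0].

(* xi >= 0 is asked everywhere, not only almost surely, because N1 is evaluated
   at time xi * lambda t, which must lie in [0, +oo[. *)
Definition MPPS (alpha beta c : R) (lambda : R -> R) (xi : T -> R)
    (N : R -> T -> nat) : Prop :=
  [/\ time_scale lambda,
      Stacy alpha beta c xi,
      forall w, 0 <= xi w
    & exists N1 : R -> T -> nat,
        [/\ poisson_process 1 N1,
            independent (sigma_rv xi) (sigma_process N1)
          & forall (t : R) w, 0 <= t -> N t w = N1 (xi w * lambda t) w]].

(* tau i stands for the (i+1)-st inter-occurrence time, so that T_0 = 0. *)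
Definition arrival (tau : nat -> T -> \bar R) (n : nat) (w : T) : \bar R :=
  (\sum_(i < n) tau i w)%E.

(* N(t) = sup {n >= 0 : T_n <= t} for every t >= 0. *)
Definition interoccurrence_times (N : R -> T -> nat) (tau : nat -> T -> \bar R)
    : Prop :=
  [/\ forall i, measurable_fun setT (tau i),
      forall i w, (0 <= tau i w)%E
    & forall (t : R) w, 0 <= t ->
        (N t w)%:R%:E
          = ereal_sup [set (n%:R : R)%:E | n in [set n | (arrival tau n w <= t%:E)%E]]].

End distributions.

(* Main.v *)
Require Import Defs.
From HB Require Import structures.
From mathcomp Require Import all_boot all_order all_algebra.
From mathcomp Require Import all_classical all_reals all_analysis.
From mathcomp Require Import measurable_realfun.
From mathcomp Require Import ring lra.

Set Implicit Arguments.
Unset Strict Implicit.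
Unset Printing Implicit Defensive.
Import Order.TTheory GRing.Theory Num.Theory.
Import numFieldNormedType.Exports.
Local Open Scope classical_set_scope.
Local Open Scope ring_scope.

(** Put M u w := N1 (xi w * u) w, so that N t = M (lambda t). Everything follows
    from one conditional statement: given xi, the increments of M are those of
    a Poisson process of rate xi ([mixed_increments]). As xi is random and N1
    is evaluated at xi w * u, this is not a direct instance of independence; it
    is obtained by rounding xi up to a grid, conditioning on its value there,
    and letting the mesh vanish, which is allowed because the paths of N1 are
    right-continuous ([cond_probability_freeze], [mixed_increments_mixed]).

    Parts (a)-(h). A Poisson probability with mean xi u is, up to a constant,
    xi^n exp (- u xi), so each of these quantities is a multiple of a
    [laplace_moment], the expectation of xi^n exp (- s xi) ([probability_count],
    [probability_increments]). Integrating against the Stacy density and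
    substituting y = 1 / (beta x) turns such an expectation into a Kratzel
    function ([laplace_moment_kratzel]); for s = 0 the substitution
    y = (beta x)^c turns it into a Gamma function ([stacy_moment]). Factorial
    moments and generating functions come from summing the Poisson series under
    the integral.

    Part (j). In the time of M, the n-th event occurs after u exactly when
    M u < n. The probability of this, given xi, is a Poisson tail, which is the
    tail of the Erlang law of rate xi, and averaging the Erlang densities over
    xi yields the Erlang-Stacy density ([erlang_st_pdf_tail]). A law on the
    half-line is determined by its tail ([has_density_tail]).

    Part (i). Given xi, the wait after the i-th event exceeds v with
    probability exp (- v xi). To see it, look at M on a grid: the first grid
    point at which M has reached i is decided by the past, and after any grid
    point a period of length v without event has conditional probability
    exp (- v xi), whatever the past ([decays_grid]). When the mesh vanishes
    this becomes a statement about the wait itself, restricted to the event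
    that the i-th and the next event are not simultaneous ([decays_wait]);
    simultaneous events have probability 0 since two events in one cell of a
    grid of mesh h have conditional probability O(h^2) ([double_jump_le],
    [wait_almost_surely]). The same argument with the past of a later event
    shows that two waits both exceed 1 with conditional probability
    exp (- 2 xi). Were the waits independent, the square of the mean of
    exp (- xi) would equal the mean of its square, so xi would be almost surely
    constant, which a law with a density excludes ([interarrival_dependent]).

    For a general lambda the event times of N are carried to those of M by
    lambda, which is a bijection of the half-line when it is unbounded. *)

(** * Changes of variable in the Gamma and Kratzel integrals *)

Section substitution.
Context {R : realType}.
Local Notation mu := (@lebesgue_measure R).
Implicit Types (g h : R -> R) (p q b : R).

(** The substitution y = exp s carries the half-line to the whole line, where
    powers become affine maps; all changes of variable below reduce to affine
    ones in this way. The compact intervals [exp (- n), exp n] are substituted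
    first, and the integrals over them converge monotonically. *)
Lemma ge0_integral_expR g : {in `]0, +oo[, continuous g} ->
  (forall y, 0 < y -> 0 <= g y) ->
  (\int[mu]_(y in `]0%R, +oo[) (g y)%:E
    = \int[mu]_s (g (expR s) * expR s)%:E)%E.
Proof.
move=> cg g0.
have cge : continuous (fun s => g (expR s) * expR s).
  move=> s; apply: cvgM; last exact: continuous_expR.
  apply: continuous_comp; first exact: continuous_expR.
  by apply: cg; rewrite in_itv/= expR_gt0.
have step (n : nat) :
  (\int[mu]_(y in `[expR (- n%:R), expR n%:R]) (g y)%:E
    = \int[mu]_(s in `[(- n%:R)%R, n%:R%R]) (g (expR s) * expR s)%:E)%E.
  have e' : (@expR R)^`()%classic = expR.
    by apply/funext => x; rewrite derive1E; exact: derive_val.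
  have := @integration_by_substitution_increasing R expR g (- n%:R) n%:R.
  rewrite e'; apply.
  - by rewrite (@le_trans _ _ 0)// ?oppr_le0 ler0n.
  - by move=> x y _ _ xy; rewrite ltr_expR.
  - by move=> x _; exact: continuous_expR.
  - by apply/cvg_ex; exists (expR (- n%:R)); apply: cvg_at_right_filter; exact: continuous_expR.
  - by apply/cvg_ex; exists (expR n%:R); apply: cvg_at_left_filter; exact: continuous_expR.
  - split=> [x _||]; first exact: derivable_expR.
      by apply: cvg_at_right_filter; exact: continuous_expR.
    by apply: cvg_at_left_filter; exact: continuous_expR.
  - apply: continuous_in_subspaceT => x; rewrite inE/= in_itv/= => /andP[x0 _].
    by apply: cg; rewrite in_itv/= (lt_le_trans (expR_gt0 _) x0).
pose A (n : nat) := `[expR (- n%:R : R), expR (n%:R : R)]%classic.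
pose B (n : nat) := `[(- n%:R : R), n%:R]%classic.
have AE : `]0, +oo[%classic = \bigcup_n A n.
  apply/seteqP; split => x /=; last first.
    by move=> [n _]; rewrite /A /= !in_itv/= andbT => /andP[/(lt_le_trans (expR_gt0 _))].
  rewrite in_itv/= andbT => x0; exists (Num.bound `|ln x|) => //=.
  have := archi_boundP (normr_ge0 (ln x)).
  rewrite ltr_norml => /andP[lx rx].
  rewrite /A /= in_itv/=; apply/andP; split.
    by rewrite -[leRHS](@lnK _ x) ?posrE// ler_expR ltW.
  by rewrite -[leLHS](@lnK _ x) ?posrE// ler_expR ltW.
have BE : setT = \bigcup_n B n.
  apply/seteqP; split => x //= _; exists (Num.bound `|x|) => //=.
  have := archi_boundP (normr_ge0 x).
  by rewrite ltr_norml /B /= in_itv/= => /andP[lx rx]; rewrite !ltW.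
have mA : measurable_fun (`]0%R, +oo[%classic : set R) g.
  apply: open_continuous_measurable_fun; first exact: interval_open.
  by move=> x; rewrite inE; exact: cg.
rewrite AE BE.
have cA : (\int[mu]_(y in A i) (g y)%:E)%E @[i --> \oo]
    --> (\int[mu]_(y in \bigcup_i A i) (g y)%:E)%E.
  apply: ge0_nondecreasing_set_cvg_integral.
  - move=> m n mn; apply/subsetPset => x; rewrite /A /= !in_itv/= => /andP[x1 x2].
    by rewrite (le_trans _ x1) ?(le_trans x2)// ler_expR ?lerN2 ler_nat.
  - by move=> n; exact: measurable_itv.
  - move=> n; apply/measurable_EFinP; apply: measurable_funS mA => //.
    by rewrite AE; exact: bigcup_sup.
  - move=> n x; rewrite /A /= in_itv/= => /andP[x1 _].
    by rewrite lee_fin g0// (lt_le_trans (expR_gt0 _) x1).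
apply: (cvg_unique _ cA) => //.
rewrite /= (eq_cvg _ _ step).
apply: ge0_nondecreasing_set_cvg_integral.
- move=> m n mn; apply/subsetPset => x; rewrite /B /= !in_itv/= => /andP[x1 x2].
  by rewrite (le_trans _ x1) ?(le_trans x2)// ?lerN2 ler_nat.
- by move=> n; exact: measurable_itv.
- move=> n; apply/measurable_EFinP; apply: measurable_funTS.
  exact: continuous_measurable_fun.
- by move=> n x _; rewrite lee_fin mulr_ge0 ?expR_ge0// g0// expR_gt0.
Qed.

Lemma ge0_integral_opp h : continuous h -> (forall s, 0 <= h s) ->
  (\int[mu]_s (h s)%:E = \int[mu]_s (h (- s))%:E)%E.
Proof.
move=> ch h0.
rewrite -(@ge0_integral_pushforward _ _ (measurableTypeR R) (measurableTypeR R) R -%R _ mu setT (EFin \o h)) //.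
- by apply: eq_measure_integral => //= A mA _; exact/esym/lebesgue_measureN.
- by apply/measurable_EFinP; exact: continuous_measurable_fun.
- by move=> y _; rewrite lee_fin.
Qed.

Lemma ge0_integral_affine h p q : continuous h -> (forall s, 0 <= h s) ->
  p != 0 -> (\int[mu]_s (h s)%:E = \int[mu]_s (h (p * s + q) * `|p|)%:E)%E.
Proof.
move=> ch h0.
(* A reflection reduces the case p < 0 to p > 0. *)
wlog p0 : p / 0 < p => [hwlog p0|_].
  have [pn|pp|e] := ltgtP p 0; last by rewrite e eqxx in p0.
    rewrite (hwlog (- p)) ?oppr_gt0 ?oppr_eq0// ge0_integral_opp.
    - by apply: eq_integral => s _; rewrite mulrNN normrN.
    - move=> s; apply: cvgM; last exact: cvg_cst.
      apply: continuous_comp; last exact: ch.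
      by apply: cvgD; [apply: cvgM; [exact: cvg_cst|exact: cvg_id]|exact: cvg_cst].
    - by move=> s; rewrite mulr_ge0.
  exact: hwlog.
have d' : (fun s => p * s + q)^`()%classic = cst p.
  apply/funext => s; rewrite derive1E; apply: derive_val.
  by apply: is_derive_eq; rewrite addr0 /GRing.scale/= mulr1.
rewrite (@increasing_ge0_integration_by_substitutionT R (fun s => p * s + q) h) ?d'//.
- by apply: eq_integral => s _ /=; rewrite gtr0_norm.
- by move=> x y xy; rewrite ltrD2r ltr_pM2l.
- by move=> x; exact: cvg_cst.
- by apply/cvg_ex; exists p; exact: cvg_cst.
- by apply/cvg_ex; exists p; exact: cvg_cst.
- apply/cvgrNyPle => A; near=> x.
  rewrite -lerBrDr -ler_pdivlMl//; near: x; exact: nbhs_ninfty_le.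
- apply/cvgryPge => A; near=> x.
  rewrite -lerBlDr -ler_pdivrMl//; near: x; exact: nbhs_pinfty_ge.
Unshelve. all: by end_near. Qed.

Lemma powRD_gt0 (x r s : R) : 0 < x -> x `^ (r + s) = x `^ r * x `^ s.
Proof. by move=> x0; rewrite powRD// (gt_eqF x0) implybT. Qed.

Lemma continuous_powR r x : 0 < x -> {for x, continuous (fun y : R => y `^ r)}.
Proof.
move=> x0; apply: differentiable_continuous; apply/derivable1_diffP.
by apply: derivable_powR; rewrite in_itv/= x0.
Qed.

(** Substitution y = (b x)^p. Both exponents p > 0 and p < 0 are covered, since
    after y = exp s the map is the affine one s -> p s + p ln b. *)
Lemma ge0_integral_powR g b p : {in `]0, +oo[, continuous g} ->
  (forall y, 0 < y -> 0 <= g y) -> 0 < b -> p != 0 ->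
  (\int[mu]_(y in `]0%R, +oo[) (g y)%:E
    = \int[mu]_(x in `]0%R, +oo[)
        (g ((b * x) `^ p) * (`|p| * b `^ p * x `^ (p - 1)))%:E)%E.
Proof.
move=> cg g0 b0 p0.
rewrite ge0_integral_expR// [RHS]ge0_integral_expR; first last.
- by move=> y y0; rewrite mulr_ge0 ?g0 ?mulr_ge0 ?powR_ge0// powR_gt0 ?mulr_gt0.
- move=> x; rewrite in_itv/= andbT => x0.
  have bx0 : 0 < b * x by rewrite mulr_gt0.
  apply: cvgM.
    apply: (@continuous_comp _ _ _ (fun x => (b * x) `^ p) g); last first.
      by apply: cg; rewrite in_itv/= powR_gt0.
    apply: (@continuous_comp _ _ _ (fun x => b * x) (@powR R ^~ p)).
      by apply: cvgM; [exact: cvg_cst|exact: cvg_id].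
    exact: continuous_powR.
  by apply: cvgM; [exact: cvg_cst|exact: continuous_powR].
rewrite (@ge0_integral_affine (fun s => g (expR s) * expR s) p (p * ln b))//; first last.
- by move=> s; rewrite mulr_ge0 ?g0 ?expR_ge0 ?expR_gt0.
- move=> s; apply: cvgM; last exact: continuous_expR.
  apply: continuous_comp; first exact: continuous_expR.
  by apply: cg; rewrite in_itv/= expR_gt0.
apply: eq_integral => s _; congr EFin.
have -> : (b * expR s) `^ p = expR (p * s + p * ln b).
  by rewrite /powR gt_eqF ?mulr_gt0 ?expR_gt0// lnM ?posrE ?expR_gt0// expRK mulrDr addrC.
have -> : b `^ p = expR (p * ln b) by rewrite /powR gt_eqF.
have -> : expR s `^ (p - 1) = expR ((p - 1) * s) by rewrite /powR gt_eqF ?expR_gt0// expRK.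
rewrite -[LHS]mulrA.
have -> : expR (p * s + p * ln b) * `|p|
    = `|p| * expR (p * ln b) * expR ((p - 1) * s) * expR s.
  by rewrite -!mulrA -!expRD mulrC; congr (_ * expR _); ring.
by rewrite !mulrA.
Qed.

(** The substitution y = 1 / (b x) exhibits the Kratzel integral of order nu as
    a Laplace transform against a Stacy density with shape parameter c. *)
Lemma kratzel_integralE nu c s b : 0 < b ->
  (\int[mu]_(y in `]0%R, +oo[)
      (y `^ (nu - 1) * expR (- (y `^ (- c) + s / b / y)))%:E
    = \int[mu]_(x in `]0%R, +oo[)
        (b `^ (- nu) * (x `^ (- nu - 1) * expR (- s * x - (b * x) `^ c)))%:E)%E.
Proof.
move=> b0; rewrite (@ge0_integral_powR _ b (-1))//; first last.
- by move=> y y0; rewrite mulr_ge0 ?powR_ge0 ?expR_ge0.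
- move=> y; rewrite in_itv/= andbT => y0; apply: cvgM; first exact: continuous_powR.
  apply: continuous_comp; last exact: continuous_expR.
  apply: cvgN; apply: cvgD; first exact: continuous_powR.
  by apply: cvgM; [exact: cvg_cst|apply: cvgV => //; rewrite gt_eqF].
apply: eq_integral => x; rewrite inE/= in_itv/= andbT => x0; congr EFin.
have bx0 : 0 < b * x by rewrite mulr_gt0.
have -> : ((b * x) `^ (-1)) `^ (- c) = (b * x) `^ c by rewrite -powRrM mulN1r opprK.
have -> : s / b / (b * x) `^ (-1) = s * x.
  by rewrite powR_inv1 ?ltW// invrK mulrA mulfVK// gt_eqF.
rewrite -powRrM powRM ?ltW// normrN1 mul1r.
have -> : - s * x - (b * x) `^ c = - ((b * x) `^ c + s * x) by ring.
set E := expR _.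
have -> : b `^ (- nu) = b `^ (-1 * (nu - 1)) * b `^ (-1).
  by rewrite -powRD_gt0//; congr (_ `^ _); ring.
have -> : x `^ (- nu - 1) = x `^ (-1 * (nu - 1)) * x `^ (-1 - 1).
  by rewrite -powRD_gt0//; congr (_ `^ _); ring.
ring.
Qed.

(** The substitution y = (b x)^c: this is why the Stacy density has total mass
    1, and it computes the moments of that law. *)
Lemma Gamma_integralE a c b : 0 < b -> c != 0 ->
  (\int[mu]_(y in `]0%R, +oo[) (y `^ (a - 1) * expR (- y))%:E
    = \int[mu]_(x in `]0%R, +oo[)
        (`|c| * b `^ (c * a) * (x `^ (c * a - 1) * expR (- (b * x) `^ c)))%:E)%E.
Proof.
move=> b0 c0; rewrite (@ge0_integral_powR _ b c)//; first last.
- by move=> y y0; rewrite mulr_ge0 ?powR_ge0 ?expR_ge0.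
- move=> y; rewrite in_itv/= andbT => y0; apply: cvgM; first exact: continuous_powR.
  apply: continuous_comp; last exact: continuous_expR.
  by apply: cvgN; exact: cvg_id.
apply: eq_integral => x; rewrite inE/= in_itv/= andbT => x0; congr EFin.
rewrite -powRrM powRM ?ltW//.
have -> : b `^ (c * a) = b `^ (c * (a - 1)) * b `^ c.
  by rewrite -powRD_gt0//; congr (_ `^ _); ring.
have -> : x `^ (c * a - 1) = x `^ (c * (a - 1)) * x `^ (c - 1).
  by rewrite -powRD_gt0//; congr (_ `^ _); ring.
ring.
Qed.

(** A concrete integrable majorant, used to see that Gamma integrals converge. *)
Lemma integral_invr_sqr1D :
  (\int[mu]_(x in `[0%R, +oo[) (((1 + x) ^- 2)%R)%:E = 1)%E.
Proof.
have x1 (x : R) : 0 <= x -> 1 + x != 0 by move=> x0; rewrite gt_eqF// ltr_wpDr.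
have cV (x : R) : 0 <= x -> {for x, continuous (fun x : R => (1 + x)^-1)}.
  move=> x0; apply: cvgV; first exact: x1.
  by apply: cvgD; [exact: cvg_cst|exact: cvg_id].
have dV (x : R) : 0 <= x -> is_derive x 1 (fun x : R => - (1 + x)^-1) ((1 + x) ^- 2).
  move=> x0; have H : is_derive x (1:R) (fun x : R => 1 + x) 1.
    by have := is_deriveD (is_derive_cst (1:R) x (1:R)) (is_derive_id x (1:R)); rewrite add0r.
  have := is_deriveN (is_deriveV (x1 _ x0) H).
  by rewrite scaleNr opprK /GRing.scale/= mulr1.
rewrite (@ge0_continuous_FTC2y R _ (fun x : R => - (1 + x)^-1) 0 0).
- by rewrite addr0 invr1 sub0e -EFinN opprK.
- by move=> x x0; rewrite invr_ge0 sqr_ge0.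
- apply: continuous_in_subspaceT => x; rewrite inE/= in_itv/= andbT => x0.
  rewrite /continuous_at.
  by under eq_fun do rewrite -exprVn; rewrite -exprVn; apply: cvgM; exact: cV.
- rewrite -oppr0; apply: cvgN; apply/cvgrPdist_lt => e e0; near=> x.
  have x0 : 0 < x by near: x; exact: nbhs_pinfty_gt.
  rewrite sub0r normrN gtr0_norm ?invr_gt0 ?addr_gt0//.
  rewrite invf_plt ?posrE ?addr_gt0//.
  apply: (@lt_trans _ _ x); last by rewrite ltrDr.
  by near: x; apply: nbhs_pinfty_gt; rewrite num_real.
- by move=> x x0; have [] := dV _ (ltW x0).
- by apply: cvg_at_right_filter; apply: cvgN; exact: cV.
- by move=> x; rewrite in_itv/= andbT => x0; rewrite derive1E; apply: (@derive_val _ _ _ _ _ _ _ (dV _ (ltW x0))).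
Unshelve. all: by end_near. Qed.

(** The substitution y = x^(1/a) removes the singularity at 0 and leaves exp
    (- x^(1/a)), which is at most a constant times (1 + x)^-2 because exp z >=
    z^k / k! for an integer k >= 2 a. *)
Lemma Gamma_integral_ltoo a : 0 < a ->
  (\int[mu]_(y in `]0%R, +oo[) (y `^ (a - 1) * expR (- y))%:E < +oo)%E.
Proof.
move=> a0; rewrite (@Gamma_integralE a a^-1 1)// ?invr_eq0 ?gt_eqF//.
pose k := Num.bound (2 * a).
have k0 : (0 < k)%N.
  by rewrite -(@ltr_nat R) (lt_trans _ (archi_boundP _)) ?mulr_gt0 ?mulr_ge0 ?ltW.
pose K : R := (a^-1 * (8 + 4 * k`!%:R)).
have mV : measurable_fun (`]0%R, +oo[%classic : set R) (fun x : R => (1 + x) ^- 2).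
  apply: open_continuous_measurable_fun; first exact: interval_open.
  move=> x; rewrite inE/= in_itv/= andbT => x0.
  apply: cvgV; first by rewrite expf_neq0// gt_eqF// ltr_wpDr// ltW.
  by apply: cvgM; (apply: cvgD; [exact: cvg_cst|exact: cvg_id]).
apply: (@le_lt_trans _ _ (\int[mu]_(x in `[0%R, +oo[) (K%:E * ((1 + x) ^- 2)%:E)))%E; last first.
  rewrite ge0_integralZl//=.
  - by rewrite integral_invr_sqr1D mule1 ltry.
  - by apply/measurable_EFinP/measurable_fun_itv_obnd_cbndP.
  - by move=> x _; rewrite lee_fin invr_ge0 sqr_ge0.
  - by rewrite lee_fin mulr_ge0 ?invr_ge0 ?(ltW a0)// addr_ge0.
rewrite -(@integral_itv_obnd_cbnd _ 0); last exact/measurable_EFinP/measurable_funM.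
apply: ge0_le_integral => //.
- by move=> x _; rewrite lee_fin !mulr_ge0 ?powR_ge0 ?expR_ge0.
- apply/measurable_EFinP; apply: measurable_funM => //; apply: measurable_funM.
    by apply: measurable_funTS; exact: measurable_powR.
  apply: measurableT_comp; first exact: measurable_expR.
  apply: measurable_funN.
  apply: (measurableT_comp (measurable_powR _)).
  by apply: measurable_funTS; exact: measurable_funM.
- exact/measurable_EFinP/measurable_funM.
- move=> x; rewrite /= in_itv/= andbT => x0; rewrite -EFinM lee_fin.
rewrite mulVf ?gt_eqF// subrr powRr0 mul1r powR1 mulr1 gtr0_norm ?invr_gt0// /K mul1r -mulrA.
rewrite ler_wpM2l ?invr_ge0 ?(ltW a0)// expRN.
rewrite ler_pdivlMr ?exprn_gt0 ?addr_gt0// ler_pdivrMl ?expR_gt0//.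
have xa0 : 0 <= x `^ a^-1 by exact: powR_ge0.
have := expR_ge1Dxn k.-1 xa0; rewrite prednK// -powR_mulrn// -powRrM.
set E := expR _; set F : R := k`!%:R => EF.
have F0 : 0 < F by rewrite ltr0n fact_gt0.
have x2 : x ^+ 2 <= 1 + x `^ (a^-1 * k%:R).
  have [x1|x1] := leP x 1.
    by rewrite (@le_trans _ _ 1) ?lerDl ?powR_ge0// expr_le1// ltW.
  have : x `^ 2%:R <= x `^ (a^-1 * k%:R).
    apply: ler_powR (ltW x1) _ _ _.
    by rewrite ler_pdivlMl// mulrC ltW// (archi_boundP _)// mulr_ge0// (ltW a0).
  by rewrite powR_mulrn ?(ltW x0)// => /le_trans; apply; rewrite lerDr.
have EF2 : F + x `^ (a^-1 * k%:R) <= F * E.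
  have -> : F + x `^ (a^-1 * k%:R) = F * (1 + x `^ (a^-1 * k%:R) / F).
    by field; rewrite gt_eqF.
  by rewrite ler_pM2l.
have E1 : 1 <= E by rewrite -expR0 ler_expR.
nra.
Qed.

End substitution.

(** * Densities and limits of events *)

Section transfer.
Local Open Scope ereal_scope.
Context d1 d2 (T1 : measurableType d1) (T2 : measurableType d2) (R : realType).
Variables (m1 : {measure set T1 -> \bar R}) (m2 : {measure set T2 -> \bar R}).
Variables (E1 : set T1) (E2 : set T2) (Y : T1 -> R) (Z : T2 -> R) (g : T2 -> R).
Hypotheses (mE1 : measurable E1) (mE2 : measurable E2).
Hypotheses (mY : measurable_fun E1 Y) (mZ : measurable_fun E2 Z).
Hypotheses (mg : measurable_fun E2 g) (g0 : forall x, E2 x -> (0 <= g x)%R).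
Hypothesis YZ : forall A, measurable A ->
  m1 (E1 `&` Y @^-1` A) = \int[m2]_(x in E2 `&` Z @^-1` A) (g x)%:E.

Import HBNNSimple.

(** The hypothesis says that Y under m1 restricted to E1 and Z under m2 with
    density g on E2 have the same image; it is an integral identity for
    indicators, hence for simple functions, and for nonnegative functions by
    monotone convergence. Laws with a density and conditional probabilities are
    both of this form. *)
Lemma ge0_integral_transfer (h : R -> \bar R) :
  measurable_fun setT h -> (forall x, 0 <= h x) ->
  \int[m1]_(x in E1) h (Y x) = \int[m2]_(x in E2) (h (Z x) * (g x)%:E).
Proof.
move=> mh h0; pose f_ := nnsfun_approx measurableT mh.
have f_h y : (f_ n y)%:E @[n --> \oo] --> h y by exact: cvg_nnsfun_approx.
transitivity (limn (fun n => \int[m1]_(x in E1) (f_ n (Y x))%:E)).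
  rewrite -monotone_convergence//.
  - by apply: eq_integral => x _; apply/esym/cvg_lim => //; exact: f_h.
  - by move=> n; apply/measurable_EFinP; exact: measurableT_comp.
  - by move=> n x _; rewrite lee_fin.
  - by move=> x _ m n mn; rewrite lee_fin; exact/lefP/nd_nnsfun_approx.
transitivity (limn (fun n => \int[m2]_(x in E2) ((f_ n (Z x))%:E * (g x)%:E))); last first.
  rewrite -monotone_convergence//.
  - apply: eq_integral => x _; apply/cvg_lim => //.
    by apply: cvgeZr => //; exact: f_h.
  - move=> n; apply/emeasurable_funM; apply/measurable_EFinP => //.
    exact: measurableT_comp.
  - by move=> n x E2x; rewrite -EFinM lee_fin mulr_ge0// g0.
  - move=> x E2x m n mn; rewrite -!EFinM lee_fin ler_wpM2r ?g0//.
    exact/lefP/nd_nnsfun_approx.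
congr (limn _); apply/funext => n.
have mB r : measurable (f_ n @^-1` [set r]) by exact: measurable_sfunP.
transitivity (\int[m1]_(x in E1)
    \sum_(r \in range (f_ n)) (r * \1_(f_ n @^-1` [set r]) (Y x))%:E).
  by apply: eq_integral => x _; rewrite [in LHS]fimfunE -fsumEFin.
rewrite ge0_integral_fsum//; last 2 first.
- move=> r; apply/measurable_EFinP; apply: measurable_funM => //.
  by apply: measurableT_comp.
- by move=> r x _; exact: nnfun_muleindic_ge0.
transitivity (\int[m2]_(x in E2)
    \sum_(r \in range (f_ n)) (r * \1_(f_ n @^-1` [set r]) (Z x))%:E * (g x)%:E); last first.
  apply: eq_integral => x _; rewrite [in RHS]fimfunE -fsumEFin//.
  rewrite ge0_mule_fsuml// => r; exact: nnfun_muleindic_ge0.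
rewrite ge0_integral_fsum//; last 2 first.
- move=> r; apply/emeasurable_funM; apply/measurable_EFinP => //.
  by apply: measurable_funM => //; apply: measurableT_comp.
- by move=> r x E2x; rewrite mule_ge0 ?lee_fin ?g0//; exact: nnfun_muleindic_ge0.
apply: eq_fsbigr => r /[!inE] -[y _ fr].
have r0 : (0 <= r)%R by rewrite -fr.
under eq_integral do rewrite EFinM.
under [RHS]eq_integral do rewrite EFinM -muleA.
rewrite !ge0_integralZl//; last 3 first.
- by apply/emeasurable_funM; apply/measurable_EFinP => //; exact: measurableT_comp.
- by move=> x E2x; rewrite mule_ge0// lee_fin ?g0.
- by apply/measurable_EFinP; exact: measurableT_comp.
congr (_ * _); set B := f_ n @^-1` [set r].
transitivity (m1 (E1 `&` Y @^-1` B)).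
  have <- : \int[m1]_(x in E1 `&` Y @^-1` B) (cst 1 x) = m1 (E1 `&` Y @^-1` B).
    by rewrite integral_cst ?mul1e//; exact: (mY mE1 (mB r)).
  rewrite integral_mkcondr; apply: eq_integral => x _.
  by rewrite patchE indicE/=; have [xB|xB] := pselect (B (Y x)); [rewrite !mem_set|rewrite !memNset].
rewrite (YZ (mB r)) integral_mkcondr; apply: eq_integral => x _.
rewrite patchE indicE/=; have [xB|xB] := pselect (B (Z x)).
  by rewrite !mem_set// mul1e.
by rewrite !memNset// mul0e.
Qed.

End transfer.

Section eventual_sets.
Context d (T : measurableType d) (R : realType) (P : probability T R).

Lemma bounded_cvg_integral (D : set T) (f_ : nat -> T -> R) (f : T -> R) :
  measurable D -> (forall n, measurable_fun D (f_ n)) ->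
  (forall n x, D x -> 0 <= f_ n x <= 1) ->
  (forall x, D x -> f_ n x @[n --> \oo] --> f x) ->
  (\int[P]_(x in D) (f_ n x)%:E)%E @[n --> \oo]
    --> (\int[P]_(x in D) (f x)%:E)%E.
Proof.
move=> mD mf f01 ff.
have [] // := @dominated_convergence _ _ _ P D mD (fun n => EFin \o f_ n) (EFin \o f) (cst 1%E).
- by move=> n; exact/measurable_EFinP.
- by apply/measurable_EFinP; exact: measurable_fun_cvg ff.
- by apply: aeW => x Dx; apply: cvg_EFin; [exact: nearW|exact: ff].
- exact: finite_measure_integrable_cst.
- apply: aeW => x n Dx; rewrite /= lee_fin.
  by have /andP[f0 f1] := f01 n x Dx; rewrite ger0_norm.
Qed.

Variables (E_ : nat -> set T) (E : set T).
Hypothesis mE_ : forall n, measurable (E_ n).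
Hypothesis EE : forall w, \forall n \near \oo, E_ n w <-> E w.

(** A pointwise limit of events, in the sense that each point is eventually in
    E_n exactly when it is in E, is the inferior limit of the E_n. *)
Lemma eventually_eq_measurable : measurable E.
Proof.
have -> : E = \bigcup_n \bigcap_(k in [set k | (n <= k)%N]) E_ k.
  apply/seteqP; split => [w Ew|w [n _ nE]].
    by have [n _ nE] := EE w; exists n => // k /= nk; exact/(nE k nk).
  have [m _ mE] := EE w; apply/(mE (maxn m n)); first exact: leq_maxl.
  by apply: nE => /=; exact: leq_maxr.
by apply: bigcup_measurable => n _; exact: bigcap_measurableType.
Qed.

Lemma eventually_eq_cvg_measure : P (E_ n) @[n --> \oo] --> P E.
Proof.
have mE := eventually_eq_measurable.
have PE A : measurable A -> P A = (\int[P]_x (\1_A x)%:E)%E.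
  by move=> mA; rewrite integral_indic// setIT.
rewrite PE//; under eq_fun do rewrite PE//.
apply: bounded_cvg_integral => //.
- by move=> n; exact: measurable_indic.
- by move=> n w _; rewrite indicE; case: (_ \in _); rewrite ?ler01 ?lexx.
- move=> w _; apply: cvg_near_cst; near=> n.
  have [h1 h2] : E_ n w <-> E w by near: n; exact: EE.
  rewrite !indicE; have [Ew|Ew] := pselect (E w); first by rewrite !mem_set//; exact: h2.
  by rewrite !memNset// => /h1.
Unshelve. all: by end_near. Qed.

End eventual_sets.

(** * Freezing a random parameter *)

Section right_grid.
Context {R : realType}.

(** The least multiple of 1 / (n + 1) that exceeds x: rounding is upwards and
    strict so that right-continuity applies to the limit. *)
Definition grid_succ (n : nat) (x : R) : R :=
  (Num.truncn (x * n.+1%:R)).+1%:R / n.+1%:R.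

Lemma grid_succ_gt n x : 0 <= x -> x < grid_succ n x.
Proof.
move=> x0; rewrite /grid_succ ltr_pdivlMr//.
by have /andP[] := truncn_itv (mulr_ge0 x0 (ler0n R n.+1)).
Qed.

Lemma grid_succ_le n x : 0 <= x -> grid_succ n x <= x + n.+1%:R^-1.
Proof.
move=> x0; rewrite /grid_succ -natr1 mulrDl mul1r lerD2r ler_pdivrMr//.
by have /andP[] := truncn_itv (mulr_ge0 x0 (ler0n R n.+1)).
Qed.

Lemma grid_succ_cvg x : 0 <= x -> grid_succ n x @[n --> \oo] --> x^'+.
Proof.
move=> x0 A; rewrite /at_right /within/= => nA.
have c : grid_succ n x @[n --> \oo] --> x.
  apply: (@squeeze_cvgr _ _ _ _ (cst x) (fun n => x + n.+1%:R^-1)).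
  - by apply: nearW => n; rewrite ltW ?grid_succ_gt// grid_succ_le.
  - exact: cvg_cst.
  - rewrite -[X in _ --> X]addr0; apply: cvgD; first exact: cvg_cst.
    exact: cvg_harmonic.
have nA' : nbhs x (fun y => x < y -> A y) := nA.
have h : \forall n \near \oo, x < grid_succ n x -> A (grid_succ n x) := c _ nA'.
change (\forall n \near \oo, A (grid_succ n x)).
by apply: filterS h => n; apply; exact: grid_succ_gt.
Qed.

Lemma measurable_grid_succ n : measurable_fun setT (grid_succ n).
Proof.
apply: nondecreasing_measurable => // x y xy.
by rewrite /grid_succ ler_pM2r ?invr_gt0// ler_nat ltnS le_truncn// ler_pM2r.
Qed.

End right_grid.

Section conditioning.
Context d (T : measurableType d) (R : realType) (P : probability T R).
Variable xi : T -> R.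
Hypotheses (mxi : measurable_fun setT xi) (xi0 : forall w, 0 <= xi w).

(** The conditional probability of E given xi is p (xi), stated through its
    defining property so that no Radon-Nikodym derivative has to be chosen. *)
Definition cond_probability (E : set T) (p : R -> R) :=
  measurable E /\ forall A : set R, measurable A ->
    P (E `&` xi @^-1` A) = (\int[P]_(w in xi @^-1` A) (p (xi w))%:E)%E.

Variables (H : R -> set T) (p : R -> R).
Hypothesis mH : forall x, 0 <= x -> measurable (H x).
Hypothesis indH : forall x A, 0 <= x -> measurable A ->
  P (H x `&` xi @^-1` A) = (P (H x) * P (xi @^-1` A))%E.
Hypothesis pH : forall x, 0 <= x -> P (H x) = (p x)%:E.
Hypothesis cp : forall x, 0 <= x -> p y @[y --> x^'+] --> p x.
Hypothesis mp : measurable_fun setT p.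
Hypothesis rH : forall w x, 0 <= x -> \forall y \near x^'+, H y w <-> H x w.

Let mpre A : measurable A -> measurable (xi @^-1` A).
Proof. by move=> mA; rewrite -[_ @^-1` _]setTI; exact: mxi. Qed.

Let p01 x : 0 <= x -> 0 <= p x <= 1.
Proof.
move=> x0; rewrite -!lee_fin -pH// measure_ge0/=; exact: probability_le1 (mH x0).
Qed.

Let grid0 n (x : R) : 0 <= x -> 0 <= grid_succ n x.
Proof. by move=> x0; rewrite (le_trans x0)// ltW// grid_succ_gt. Qed.

Let cell n j : set R := `[j%:R / n.+1%:R, j.+1%:R / n.+1%:R[%classic.

Let measurable_cell n j : measurable (cell n j).
Proof. exact: measurable_itv. Qed.

Let cellP n j x : 0 <= x -> cell n j x <-> Num.truncn (x * n.+1%:R) = j.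
Proof.
move=> x0; rewrite /cell/= in_itv/= ler_pdivrMr// ltr_pdivlMr//.
rewrite -truncn_eq ?mulr_ge0//.
by split => [/eqP|->].
Qed.

Let E_ n := [set w | H (grid_succ n (xi w)) w].

Let E_cell n A : E_ n `&` xi @^-1` A
  = \bigcup_j (H (j.+1%:R / n.+1%:R) `&` xi @^-1` (A `&` cell n j)).
Proof.
apply/seteqP; split => [w [Hw Aw]|w [j _ [Hw [Aw]]]].
  by exists (Num.truncn (xi w * n.+1%:R)) => //; split => //; split => //; exact/cellP.
by move=> /(cellP _ _ (xi0 w)) jw; split=> //; rewrite /E_ /= /grid_succ jw.
Qed.

Let cell_disj n (G : nat -> set T) A :
  trivIset setT (fun j => G j `&` xi @^-1` (A `&` cell n j)).
Proof.
apply/trivIsetP => i j _ _ ij; apply/seteqP; split => // w [[_ [_ /cellP Hi]] [_ [_ /cellP Hj]]].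
by move: ij; rewrite -Hi// -Hj// eqxx.
Qed.

Let mcell n j A : measurable A ->
  measurable (H (j.+1%:R / n.+1%:R) `&` xi @^-1` (A `&` cell n j)).
Proof.
by move=> mA; apply: measurableI; [exact: mH|apply: mpre; exact: measurableI _ (measurable_cell _ _)].
Qed.

Let mE_ n : measurable (E_ n).
Proof.
have -> : E_ n = E_ n `&` xi @^-1` setT by rewrite preimage_setT setIT.
by rewrite E_cell; apply: bigcup_measurable => j _; exact: mcell.
Qed.

Let PE_ n A : measurable A -> P (E_ n `&` xi @^-1` A)
  = (\int[P]_(w in xi @^-1` A) (p (grid_succ n (xi w)))%:E)%E.
Proof.
move=> mA; rewrite E_cell measure_bigcup//=; last by move=> j _; exact: mcell.
have -> : xi @^-1` A = \bigcup_j (setT `&` xi @^-1` (A `&` cell n j)).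
  apply/seteqP; split => [w Aw|w [j _ [_ []]]//].
  by exists (Num.truncn (xi w * n.+1%:R)) => //; split => //; split => //; exact/cellP.
rewrite ge0_integral_bigcup//=; last 3 first.
- by move=> j; apply: measurableI => //; apply: mpre; exact: measurableI _ (measurable_cell _ _).
- apply: measurable_funTS; apply/measurable_EFinP; apply: (measurableT_comp mp).
  by apply: measurableT_comp; [exact: measurable_grid_succ|].
- by move=> w _; rewrite lee_fin; have /andP[] := p01 (grid0 n (xi0 w)).
rewrite (eq_eseriesl (Q := xpredT)); last by move=> j; rewrite in_setT.
apply: eq_eseriesr => j _; rewrite setTI.
have j0 : 0 <= j.+1%:R / n.+1%:R :> R by rewrite divr_ge0.
rewrite indH//; last exact: measurableI _ (measurable_cell _ _).
rewrite pH// -integral_cst; last by apply: mpre; exact: measurableI _ (measurable_cell _ _).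
apply: eq_integral => w; rewrite inE/= => -[_ /(cellP _ _ (xi0 w)) jw].
by rewrite /grid_succ jw.
Qed.

(** The probability of H x is p x for each fixed x >= 0, independently of xi;
    then H (xi) has conditional probability p (xi). If xi takes countably many
    values, decompose along them. In general replace xi by [grid_succ n xi],
    which takes countably many values and decreases to xi, and pass to the limit
    using right-continuity of H and p. *)
Lemma cond_probability_freeze : cond_probability [set w | H (xi w) w] p.
Proof.
have EE w : \forall n \near \oo, E_ n w <-> H (xi w) w.
  exact: (grid_succ_cvg (xi0 w) (rH w (xi0 w))).
have mE := eventually_eq_measurable mE_ EE.
split=> // A mA.
have c1 : P (E_ n `&` xi @^-1` A) @[n --> \oo] --> P ([set w | H (xi w) w] `&` xi @^-1` A).
  apply: eventually_eq_cvg_measure => [n|w].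
    by apply: measurableI => //; exact: mpre.
  by apply: filterS (EE w) => n -[h1 h2]; split=> -[? ?]; split=> //; [exact: h1|exact: h2].
suff c2 : P (E_ n `&` xi @^-1` A) @[n --> \oo]
    --> (\int[P]_(w in xi @^-1` A) (p (xi w))%:E)%E by exact: (cvg_unique _ c1 c2).
rewrite (eq_cvg _ _ (fun n => PE_ n mA)).
apply: bounded_cvg_integral.
- exact: mpre.
- move=> n; apply: measurable_funTS; apply: (measurableT_comp mp).
  by apply: measurableT_comp; [exact: measurable_grid_succ|].
- by move=> n w _; exact: p01 (grid0 n (xi0 w)).
- by move=> w _; apply: cvg_comp (cp (xi0 w)); exact: grid_succ_cvg.
Qed.

End conditioning.

(** * Increments of a mixed Poisson process *)

Section poisson_weight.
Context {R : realType}.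
Implicit Types (m x : R) (k : nat).

(** Unlike [poisson_pmf], this is the point mass at 0 when the rate is 0. *)
Definition poisson_weight m k : R := m ^+ k / k`!%:R * expR (- m).

Lemma poisson_weight_ge0 m k : 0 <= m -> 0 <= poisson_weight m k.
Proof. by move=> m0; rewrite /poisson_weight !mulr_ge0 ?exprn_ge0 ?expR_ge0. Qed.

Lemma poisson_weight0 k : poisson_weight 0 k = (k == 0)%N%:R.
Proof.
by rewrite /poisson_weight expr0n oppr0 expR0 mulr1; case: k => [|k]; rewrite ?divr1 ?mul0r.
Qed.

Lemma poisson_weight_pmf m k : 0 < m -> poisson_pmf m k = poisson_weight m k.
Proof. by move=> m0; rewrite /poisson_pmf m0. Qed.

Lemma continuous_poisson_weight k : continuous (poisson_weight ^~ k).
Proof.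
move=> m; apply: cvgM; last first.
  apply: continuous_comp; last exact: continuous_expR.
  by apply: cvgN; exact: cvg_id.
by apply: cvgM; [exact: exprn_continuous|exact: cvg_cst].
Qed.

(** The probability that the increments of a Poisson process of rate x along the
    times u are k. *)
Definition increment_weight (n : nat) (u : nat -> R) (k : nat -> nat) x : R :=
  \prod_(i < n) poisson_weight (x * (u i.+1 - u i)) (k i).

Lemma continuous_increment_weight n u (k : nat -> nat) : continuous (increment_weight n u k).
Proof.
elim: n => [|n IHn] x.
  rewrite /continuous_at /increment_weight big_ord0.
  by under eq_fun do rewrite big_ord0; exact: cvg_cst.
have -> : increment_weight n.+1 u k
    = (fun y => increment_weight n u k y * poisson_weight (y * (u n.+1 - u n)) (k n)).
  by apply/funext => y; rewrite /increment_weight big_ord_recr.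
apply: cvgM; first exact: IHn.
apply: (@continuous_comp _ _ _ (fun y : R => y * (u n.+1 - u n)) (poisson_weight ^~ (k n))).
  by apply: cvgM; [exact: cvg_id|exact: cvg_cst].
exact: continuous_poisson_weight.
Qed.

(** The product of the Poisson probabilities depends on x only through a power
    and one exponential, since the means add up to x times the length of the
    time span. *)
Lemma increment_weightE n u (k : nat -> nat) x : increment_weight n u k x
  = (\prod_(i < n) (u i.+1 - u i) ^+ k i) / (\prod_(i < n) (k i)`!%:R)
    * (x ^+ (\sum_(i < n) k i)%N * expR (- (x * (u n - u 0%N)))).
Proof.
elim: n => [|n IHn].
  by rewrite /increment_weight !big_ord0 subrr mulr0 oppr0 expR0 expr0 divr1 !mulr1.
rewrite /increment_weight big_ord_recr/= -/(increment_weight n u k x) IHn !big_ord_recr/=.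
rewrite /poisson_weight exprMn exprD invfM.
have -> : - (x * (u n.+1 - u 0%N)) = - (x * (u n - u 0%N)) + - (x * (u n.+1 - u n)) by ring.
by rewrite expRD; ring.
Qed.

End poisson_weight.

Section counting_events.
Context {R : realType}.
Implicit Types (x s u : R).

(** Only countable operations on the events N (u i) in B occur, so this serves
    both for the ambient sigma-algebra and for the one generated by the process. *)
Lemma measurable_increments d (T : measurableType d) (N : R -> T -> nat)
    (n : nat) (u : nat -> R) (k : nat -> nat) :
  (forall i B, measurable (N (u i) @^-1` B)) ->
  measurable [set w | forall i, (i < n)%N -> (N (u i.+1) w - N (u i) w)%N = k i].
Proof.
move=> mN.
apply: (@bigcap_measurableType _ _ (fun i => [set w | (N (u i.+1) w - N (u i) w)%N = k i]) `I_n).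
move=> i _.
have -> : [set w | (N (u i.+1) w - N (u i) w)%N = k i] =
    \bigcup_j (N (u i) @^-1` [set j] `&` N (u i.+1) @^-1` [set l | (l - j)%N = k i]).
  apply/seteqP; split => [w/= <-|w [j _ [/= -> //]]].
  by exists (N (u i) w).
by apply: bigcup_measurable => j _; exact: measurableI.
Qed.

Lemma cvg_mulr_at_right x s : 0 < s -> y * s @[y --> x^'+] --> (x * s)^'+.
Proof.
move=> s0 A; rewrite /at_right /within/= => nA.
have nA' : nbhs (x * s) (fun y => x * s < y -> A y) := nA.
have c : y * s @[y --> x] --> x * s by apply: cvgM; [exact: cvg_id|exact: cvg_cst].
have h : \forall y \near x, x * s < y * s -> A (y * s) := c _ nA'.
change (\forall y \near x, x < y -> A (y * s)).
by apply: filterS h => y h xy; apply: h; rewrite ltr_pM2r.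
Qed.

Lemma near_counting_scale (f : R -> nat) x s : 0 <= x -> 0 <= s ->
  (forall v, 0 <= v -> \forall y \near v^'+, f y = f v) ->
  \forall y \near x^'+, f (y * s) = f (x * s).
Proof.
move=> x0; rewrite le_eqVlt => /predU1P[<- _|s0 rf]; first by apply: nearW => y; rewrite !mulr0.
have xs0 : 0 <= x * s by rewrite mulr_ge0// ltW.
exact: (cvg_mulr_at_right s0 (rf _ xs0)).
Qed.

Lemma near_forall_lt (F : set_system R) (FF : Filter F) n (Q : nat -> R -> Prop) :
  (forall i, (i < n)%N -> \forall y \near F, Q i y) ->
  \forall y \near F, forall i, (i < n)%N -> Q i y.
Proof.
elim: n => [|n IHn] nQ; first by apply: nearW => y i; rewrite ltn0.
near=> y => i; rewrite ltnS leq_eqVlt => /predU1P[->|].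
  by near: y; exact: nQ.
by move: i; near: y; apply: IHn => i ni; apply: nQ; rewrite ltnW.
Unshelve. all: by end_near. Qed.

End counting_events.

(** Given xi, the increments of M are independent Poisson variables with means
    xi times the lengths of the intervals. From here on this is the only
    probabilistic fact used about M. *)
Definition mixed_increments d (T : measurableType d) (R : realType)
    (P : probability T R) (xi : T -> R) (M : R -> T -> nat) : Prop :=
  forall n (u : nat -> R) (k : nat -> nat),
    (forall i, 0 <= u i) -> (forall i, (i < n)%N -> u i <= u i.+1) ->
    cond_probability P xi
      [set w | forall i, (i < n)%N -> (M (u i.+1) w - M (u i) w)%N = k i]
      (increment_weight n u k).

Section mixed_poisson.
Context d (T : measurableType d) (R : realType) (P : probability T R).
Variables (xi : T -> R) (N1 : R -> T -> nat).
Hypotheses (mxi : measurable_fun setT xi) (xi0 : forall w, 0 <= xi w).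
Hypothesis N1poisson : poisson_process P 1 N1.
Hypothesis xiN1 : independent P (sigma_rv xi) (sigma_process N1).

Let incr n (u : nat -> R) (k : nat -> nat) x : set T :=
  [set w | forall i, (i < n)%N -> (N1 (x * u i.+1) w - N1 (x * u i) w)%N = k i].

Let incr_sigma n u k x : (forall i, 0 <= u i) -> 0 <= x ->
  sigma_process N1 (incr n u k x).
Proof.
move=> u0 x0.
have := @measurable_increments R _ (g_sigma_algebraType
  [set A | exists (s : R) (B : set nat), 0 <= s /\ A = N1 s @^-1` B])
  N1 n (fun i => x * u i) k.
apply => i B; apply: sub_sigma_algebra.
by exists (x * u i), B; split => //; rewrite mulr_ge0.
Qed.

Let measurable_incr n u k x : (forall i, 0 <= u i) -> 0 <= x ->
  measurable (incr n u k x).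
Proof.
move=> u0 x0; apply: (@measurable_increments R _ T N1 n (fun i => x * u i) k) => i B.
have [mN _ _ _ _] := N1poisson.
by rewrite -[_ @^-1` _]setTI; apply: mN => //; rewrite mulr_ge0.
Qed.

Let P_incr n u k x : (forall i, 0 <= u i) -> (forall i, (i < n)%N -> u i <= u i.+1) ->
  0 <= x -> P (incr n u k x) = (increment_weight n u k x)%:E.
Proof.
move=> u0 nd x0; have [_ _ _ _ [Hind Hpmf]] := N1poisson.
rewrite (Hind n (fun i => x * u i) k); last 2 first.
- by rewrite mulr_ge0.
- by move=> i ni; rewrite ler_wpM2l// nd.
rewrite /increment_weight -prodEFin; apply: eq_bigr => i _.
have xu0 : 0 <= x * u i by rewrite mulr_ge0.
have := ler_wpM2l x0 (nd i (ltn_ord i)); rewrite le_eqVlt => /predU1P[e|lt].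
  rewrite mulrBr e subrr poisson_weight0.
  rewrite (_ : [set _ | _] = [set w | 0%N = k i]); last first.
    by apply/seteqP; split => w /=; rewrite subnn.
  have [->|k0] := eqVneq (k i) 0%N.
    by rewrite (_ : [set _ | _] = setT) ?probability_setT//; apply/seteqP; split.
  rewrite (_ : [set _ | _] = set0) ?measure0//; apply/seteqP; split => //= w /esym/eqP.
  by rewrite (negbTE k0).
by rewrite Hpmf// mul1r poisson_weight_pmf -?mulrBr ?mulrBr ?subr_gt0.
Qed.

Definition mixed u w := N1 (xi w * u) w.

(** Freezing applies with H x the event that N1 has the increments k along the
    times x u; when two of these times coincide, the increment is almost surely
    0, in accordance with [poisson_weight]. *)
Lemma mixed_increments_mixed : mixed_increments P xi mixed.
Proof.
move=> n u k u0 nd; apply: (@cond_probability_freeze _ _ _ P xi mxi xi0 (incr n u k)) => //.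
- by move=> x x0; exact: measurable_incr.
- move=> x A x0 mA; rewrite setIC muleC; apply: xiN1; last exact: incr_sigma.
  by exists A.
- by move=> x x0; exact: P_incr.
- by move=> x x0; apply: cvg_at_right_filter; exact: continuous_increment_weight.
- by apply: continuous_measurable_fun; exact: continuous_increment_weight.
- move=> w x x0; have [_ _ _ rN _] := N1poisson.
  have h : \forall y \near x^'+, forall i, (i < n.+1)%N -> N1 (y * u i) w = N1 (x * u i) w.
    apply: near_forall_lt => i _.
    exact: (@near_counting_scale _ (N1 ^~ w) x (u i) x0 (u0 i) (rN w)).
  by apply: filterS h => y h; split=> H i ni; move: (H i ni); rewrite !h// ltnS// ltnW.
Qed.

Lemma mixed0 w : mixed 0 w = 0%N.
Proof. by have [_ N10 _ _ _] := N1poisson; rewrite /mixed mulr0 N10. Qed.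

Lemma mixed_nd w s u : 0 <= s -> s <= u -> (mixed s w <= mixed u w)%N.
Proof.
move=> s0 su; have [_ _ nd _ _] := N1poisson.
by apply: nd; rewrite ?mulr_ge0// ler_wpM2l.
Qed.

Lemma measurable_mixed s : 0 <= s -> measurable_fun setT (mixed s).
Proof.
move=> s0 _ B _; rewrite setTI.
have -> : mixed s @^-1` B = \bigcup_(k in B) (mixed s @^-1` [set k]).
  by apply/seteqP; split => [w Bw|w [k Bk /= ->//]]; exists (mixed s w).
apply: bigcup_measurable => k _.
pose u i : R := if i is 0%N then 0 else s.
have u0 i : 0 <= u i by case: i.
have nd i : (i < 1)%N -> u i <= u i.+1 by case: i.
have [+ _] := mixed_increments_mixed (fun=> k) u0 nd.
rewrite (_ : [set _ | _] = mixed s @^-1` [set k])//.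
apply/seteqP; split => w /=.
  by move=> /(_ 0%N isT); rewrite -[mixed (u 0%N) w]/(mixed 0 w) mixed0 subn0.
by move=> <- [|//] _; rewrite -[mixed (u 0%N) w]/(mixed 0 w) mixed0 subn0.
Qed.

End mixed_poisson.

(** * Laplace moments of a Stacy variable *)

Section stacy_moments.
Context d (T : measurableType d) (R : realType) (P : probability T R).
Variables (alpha beta c : R) (xi : T -> R).
Hypotheses (beta0 : 0 < beta) (c0 : c != 0).
Hypotheses (xi0 : forall w, 0 <= xi w) (xiS : Stacy P alpha beta c xi).
Local Notation mu := (@lebesgue_measure R).

Let pdf := stacy_pdf alpha beta c.

Lemma stacy_measurable : measurable_fun setT xi.
Proof. by have [/measurable_EFinP] := xiS. Qed.

Lemma measurable_stacy_pdf : measurable_fun setT pdf.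
Proof.
apply: measurable_fun_ifT => //; first exact: measurable_fun_ler.
apply: measurable_funM.
  by apply: measurable_funM => //; exact: measurable_powR.
apply: measurableT_comp; first exact: measurable_expR.
apply: measurable_funN.
by apply: (measurableT_comp (measurable_powR _)); exact: measurable_funM.
Qed.

Lemma Gamma_ge0 (a : R) : 0 <= Gamma a.
Proof. by apply: Rintegral_ge0 => y _; rewrite mulr_ge0 ?powR_ge0 ?expR_ge0. Qed.

Lemma stacy_pdf_ge0 x : 0 <= pdf x.
Proof.
rewrite /pdf /stacy_pdf; case: ifP => // _.
by rewrite !mulr_ge0 ?invr_ge0 ?powR_ge0 ?Gamma_ge0 ?expR_ge0.
Qed.

(** The Stacy density vanishes on the negative half-line and a point has
    Lebesgue measure 0, so only the open half-line contributes. *)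
Lemma stacy_expectation (h : R -> \bar R) : measurable_fun setT h ->
  (forall x, 0 <= h x)%E ->
  (\int[P]_w h (xi w) = \int[mu]_(x in `]0%R, +oo[) (h x * (pdf x)%:E))%E.
Proof.
move=> mh h0; have [_ xiD] := xiS.
transitivity (\int[mu]_x (h x * (pdf x)%:E))%E.
  have := @ge0_integral_transfer _ _ T (measurableTypeR R) R P mu setT setT xi id pdf.
  apply => //.
  - exact: stacy_measurable.
  - exact: measurable_stacy_pdf.
  - by move=> x _; exact: stacy_pdf_ge0.
  - move=> A mA; rewrite !setTI preimage_id -xiD//; congr (P _).
    apply/seteqP; split => w /=; first by exists (xi w).
    by move=> [x Ax [<-]].
rewrite [RHS](@integral_itv_obnd_cbnd _ 0); last first.
  apply: emeasurable_funM; first exact: measurable_funTS.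
  by apply/measurable_EFinP; apply: measurable_funTS; exact: measurable_stacy_pdf.
rewrite [RHS]integral_mkcond; apply: eq_integral => x _; rewrite patchE.
case: ifPn => //; rewrite notin_setE/= in_itv/= andbT => /negP.
by rewrite /pdf /stacy_pdf => /negbTE ->; rewrite mule0.
Qed.

(** Keeps the value +oo, which [kratzel] replaces by 0, so that finiteness can
    be proved before passing to real numbers. *)
Definition kratzel_integral rho nu x : \bar R :=
  (\int[mu]_(y in `]0%R, +oo[) (y `^ (nu - 1) * expR (- (y `^ rho + x / y)))%:E)%E.

Lemma fine_kratzel_integral rho nu x : fine (kratzel_integral rho nu x) = kratzel rho nu x.
Proof. by []. Qed.

(** The probabilities of counts and of increments are multiples of such
    expectations, with n a number of events and s a length of time. *)
Definition laplace_moment n s : \bar R :=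
  (\int[P]_w (xi w ^+ n * expR (- (s * xi w)))%:E)%E.

Let measurable_laplace n s :
  measurable_fun setT (fun x : R => `|x| ^+ n * expR (- (s * x))).
Proof.
apply: measurable_funM.
  by apply: measurable_funX; apply: continuous_measurable_fun; exact: norm_continuous.
apply: measurableT_comp; first exact: measurable_expR.
by apply: measurable_funN; exact: measurable_funM.
Qed.

Let pdfE n s x : 0 < x -> x ^+ n * expR (- (s * x)) * pdf x
  = `|c| * beta `^ (c * alpha) / Gamma alpha
    * (x `^ (c * alpha + n%:R - 1) * expR (- s * x - (beta * x) `^ c)).
Proof.
move=> x0; rewrite /pdf /stacy_pdf ltW//.
have -> : c * alpha + n%:R - 1 = n%:R + (c * alpha - 1) by ring.
by rewrite (powRD_gt0 n%:R _ x0) powR_mulrn ?(ltW x0)// mulNr expRD; ring.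
Qed.

Lemma laplace_momentE n s : laplace_moment n s
  = ((`|c| * beta `^ (c * alpha) / Gamma alpha)%:E
     * \int[mu]_(x in `]0%R, +oo[)
         (x `^ (c * alpha + n%:R - 1) * expR (- s * x - (beta * x) `^ c))%:E)%E.
Proof.
rewrite /laplace_moment.
transitivity (\int[P]_w (EFin \o (fun x : R => `|x| ^+ n * expR (- (s * x)))%R) (xi w))%E.
  by apply: eq_integral => w _; rewrite /= ger0_norm.
rewrite stacy_expectation; last 2 first.
- exact/measurable_EFinP.
- by move=> x; rewrite lee_fin mulr_ge0 ?exprn_ge0 ?expR_ge0.
rewrite -ge0_integralZl//; last 3 first.
- apply/measurable_EFinP; apply: measurable_funM.
    by apply: measurable_funTS; exact: measurable_powR.
  apply: measurableT_comp; first exact: measurable_expR.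
  apply: measurable_funB; first by apply: measurable_funM.
  apply: (measurableT_comp (measurable_powR _)).
  by apply: measurable_funTS; exact: measurable_funM.
- by move=> x _; rewrite lee_fin mulr_ge0 ?powR_ge0 ?expR_ge0.
- by rewrite lee_fin !mulr_ge0 ?invr_ge0 ?powR_ge0 ?Gamma_ge0.
apply: eq_integral => x; rewrite inE/= in_itv/= andbT => x0.
by rewrite -!EFinM ger0_norm ?ltW// pdfE.
Qed.

Lemma measurable_laplace_moment n s :
  measurable_fun setT (fun w => xi w ^+ n * expR (- (s * xi w))).
Proof.
apply: measurable_funM; first by apply: measurable_funX; exact: stacy_measurable.
apply: measurableT_comp; first exact: measurable_expR.
by apply: measurable_funN; apply: measurable_funM => //; exact: stacy_measurable.
Qed.

Lemma laplace_moment_kratzel_integral n s : laplace_moment n s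
  = ((`|c| / (beta ^+ n * Gamma alpha))%:E
     * kratzel_integral (- c) (- c * alpha - n%:R) (s / beta))%E.
Proof.
rewrite laplace_momentE [in RHS]/kratzel_integral.
rewrite (kratzel_integralE (- c * alpha - n%:R) c s beta0).
have -> : - (- c * alpha - n%:R) = c * alpha + n%:R by ring.
under [in RHS]eq_integral do rewrite EFinM.
rewrite ge0_integralZl//; last 3 first.
- apply/measurable_EFinP; apply: measurable_funM.
    by apply: measurable_funTS; exact: measurable_powR.
  apply: measurableT_comp; first exact: measurable_expR.
  apply: measurable_funB; first by apply: measurable_funM.
  apply: (measurableT_comp (measurable_powR _)).
  by apply: measurable_funTS; exact: measurable_funM.
- by move=> x _; rewrite lee_fin mulr_ge0 ?powR_ge0 ?expR_ge0.
- by rewrite lee_fin powR_ge0.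
rewrite muleA -EFinM; congr (_%:E * _)%E.
rewrite powRD_gt0// powR_mulrn ?(ltW beta0)//.
have bn : beta ^+ n != 0 by rewrite expf_neq0// gt_eqF.
by rewrite invfM; set g := (Gamma alpha)^-1; field.
Qed.

Lemma laplace_moment00 : laplace_moment 0 0 = 1%E.
Proof.
rewrite /laplace_moment.
under eq_integral do rewrite expr0 mul0r oppr0 expR0 mul1r.
by rewrite integral_cst// mul1e; exact: probability_setT.
Qed.

(** The Stacy density integrates to 1, so its normalizing constant cannot
    vanish. *)
Lemma Gamma_gt0 : 0 < Gamma alpha.
Proof.
rewrite lt_neqAle Gamma_ge0 andbT; apply/eqP => G0.
have := laplace_moment00; rewrite laplace_momentE -G0 invr0 mulr0 mul0e => /esym/eqP.
by rewrite onee_eq0.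
Qed.

Lemma stacy_moment n : - alpha < n%:R / c ->
  laplace_moment n 0 = (Gamma (alpha + n%:R / c) / (beta ^+ n * Gamma alpha))%:E.
Proof.
move=> nc; have a0 : 0 < alpha + n%:R / c by rewrite -ltrBlDl sub0r.
have G := Gamma_integralE (alpha + n%:R / c) beta0 c0.
have Gy := Gamma_integral_ltoo a0.
have G0 : (0 <= \int[mu]_(y in `]0%R, +oo[)
    (y `^ (alpha + n%:R / c - 1) * expR (- y))%:E)%E.
  by apply: integral_ge0 => y _; rewrite lee_fin mulr_ge0 ?powR_ge0 ?expR_ge0.
have -> : (Gamma (alpha + n%:R / c) / (beta ^+ n * Gamma alpha))%:E
  = ((beta ^+ n * Gamma alpha)^-1%:E * \int[mu]_(y in `]0%R, +oo[)
      (y `^ (alpha + n%:R / c - 1) * expR (- y))%:E)%E.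
  by rewrite mulrC EFinM /Gamma /Rintegral fineK// ge0_fin_numE.
rewrite G laplace_momentE.
under [in RHS]eq_integral do rewrite EFinM.
rewrite ge0_integralZl//; last 3 first.
- apply/measurable_EFinP; apply: measurable_funM.
    by apply: measurable_funTS; exact: measurable_powR.
  apply: measurableT_comp; first exact: measurable_expR.
  apply: measurable_funN.
  apply: (measurableT_comp (measurable_powR _)).
  by apply: measurable_funTS; exact: measurable_funM.
- by move=> x _; rewrite lee_fin mulr_ge0 ?powR_ge0 ?expR_ge0.
- by rewrite lee_fin mulr_ge0 ?powR_ge0.
have -> : c * (alpha + n%:R / c) = c * alpha + n%:R.
  by rewrite mulrDr mulrCA divff// mulr1.
rewrite muleA -EFinM; congr (_%:E * _)%E.
  rewrite powRD_gt0// powR_mulrn ?(ltW beta0)//.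
  by field; rewrite expf_neq0 ?gt_eqF// Gamma_gt0.
by apply: eq_integral => x _; rewrite oppr0 mul0r sub0r.
Qed.

(** For s > 0 the function x^n exp (- s x) is bounded by n! / s^n. *)
Lemma laplace_moment_ltoo n s : 0 <= s -> (n = 0%N \/ 0 < s) ->
  (laplace_moment n s < +oo)%E.
Proof.
move=> s0 ns.
have [K HK] : exists K : R, forall x, 0 <= x -> x ^+ n * expR (- (s * x)) <= K.
  case: ns => [->|{}s0].
    by exists 1 => x x0; rewrite expr0 mul1r expR_le1 oppr_le0 mulr_ge0.
  exists (n`!%:R / s ^+ n) => x x0.
  rewrite expRN ler_pdivrMr ?expR_gt0// mulrAC ler_pdivlMr ?exprn_gt0//.
  rewrite -exprMn (mulrC x).
  have sx0 : 0 <= s * x by rewrite mulr_ge0// ltW.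
  case: n => [|n]; first by rewrite expr0 fact0 mul1r -expR0 ler_expR.
  have := expR_ge1Dxn n sx0.
  rewrite -ler_pdivrMl ?ltr0n ?fact_gt0//; apply: le_trans.
  by rewrite [leLHS]mulrC lerDr.
apply: (@le_lt_trans _ _ (\int[P]_w (cst (K%:E) w))%E); last first.
  by rewrite integral_cst// [X in (_ * X)%E](_ : _ = 1%E) ?mule1 ?ltry//; exact: probability_setT.
apply: ge0_le_integral => //.
- by move=> w _; rewrite lee_fin mulr_ge0 ?exprn_ge0 ?expR_ge0.
- by apply/measurable_EFinP; exact: measurable_laplace_moment.
- by move=> w _; rewrite lee_fin HK.
Qed.

Lemma stacy_null x : P (xi @^-1` [set x]) = 0%E.
Proof.
have [_ /(_ _ (measurable_set1 x))] := xiS.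
rewrite integral_set1 => <-; congr (P _).
apply/seteqP; split => w /=; first by move=> ->; exists x.
by move=> [_ -> [<-]].
Qed.

Lemma laplace_moment_ge0 n s : (0 <= laplace_moment n s)%E.
Proof.
by apply: integral_ge0 => w _; rewrite lee_fin mulr_ge0 ?exprn_ge0 ?expR_ge0.
Qed.

(** The integrand vanishes at most where xi = 0, a null event. *)
Lemma laplace_moment_gt0 n s : (0 < laplace_moment n s)%E.
Proof.
rewrite lt_neqAle laplace_moment_ge0 andbT; apply/eqP => /esym m0.
have mf := measurable_laplace_moment n s.
have [+ _] := @ae_eq_integral_abs _ _ _ P setT measurableT
  (fun w => (xi w ^+ n * expR (- (s * xi w)))%:E) (iffRL (measurable_EFinP _ _) mf).
have -> : (\int[P]_w `|(xi w ^+ n * expR (- (s * xi w)))%:E| = 0)%E.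
  rewrite -m0; apply: eq_integral => w _.
  by rewrite /= ger0_norm// mulr_ge0 ?exprn_ge0 ?expR_ge0.
move=> /(_ erefl) [A [mA A0 sA]].
have mB : measurable (xi @^-1` [set 0%R]).
  rewrite -[_ @^-1` _]setTI.
  by apply: stacy_measurable => //; exact: measurable_set1.
have h : (P setT <= P (A `|` xi @^-1` [set 0%R]))%E.
  rewrite le_measure ?inE//; first exact: measurableU.
  move=> w _ /=; have [->|x0] := eqVneq (xi w) 0; first by right.
  left; apply: sA => /= /(_ I) /eqP.
  by rewrite eqe mulf_eq0 expf_eq0 (negbTE x0) andbF/= expR_eq0.
have h2 : (P setT <= P A + P (xi @^-1` [set 0%R]))%E.
  exact: le_trans h (measureU2 _ mA mB).
by move: h2; rewrite A0 stacy_null adde0 probability_setT leNgt lte01.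
Qed.

Let kratzel_integral_fin n s : (laplace_moment n s < +oo)%E ->
  kratzel_integral (- c) (- c * alpha - n%:R) (s / beta)
    = (kratzel (- c) (- c * alpha - n%:R) (s / beta))%:E.
Proof.
have C0 : 0 < `|c| / (beta ^+ n * Gamma alpha).
  by rewrite divr_gt0 ?normr_gt0// mulr_gt0 ?exprn_gt0// Gamma_gt0.
rewrite laplace_moment_kratzel_integral -fine_kratzel_integral.
set K := kratzel_integral _ _ _ => Ky.
have K0 : (0 <= K)%E.
  by apply: integral_ge0 => y _; rewrite lee_fin mulr_ge0 ?powR_ge0 ?expR_ge0.
case: K K0 Ky => [r| |]// r0.
by rewrite gt0_muley ?lte_fin// ltxx.
Qed.

Lemma laplace_moment_kratzel n s : (laplace_moment n s < +oo)%E ->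
  laplace_moment n s = (`|c| / (beta ^+ n * Gamma alpha)
    * kratzel (- c) (- c * alpha - n%:R) (s / beta))%:E.
Proof.
by move=> sy; rewrite laplace_moment_kratzel_integral kratzel_integral_fin.
Qed.

Lemma kratzel_gt0 n s : (laplace_moment n s < +oo)%E ->
  0 < kratzel (- c) (- c * alpha - n%:R) (s / beta).
Proof.
move=> sy; have := laplace_moment_gt0 n s.
rewrite laplace_moment_kratzel// lte_fin pmulr_rgt0//.
by rewrite divr_gt0 ?normr_gt0// mulr_gt0 ?exprn_gt0// Gamma_gt0.
Qed.

End stacy_moments.

(** * Poisson series *)

Section poisson_sums.
Context {R : realType}.
Implicit Types (m z : R).
Local Open Scope ereal_scope.

Lemma nneseries_expR m : (0 <= m)%R ->
  \sum_(k <oo) (m ^+ k / k`!%:R)%:E = (expR m)%:E.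
Proof.
move=> m0; apply/cvg_lim => //.
have -> : (fun n => \sum_(0 <= k < n) (m ^+ k / k`!%:R)%:E) = EFin \o series (exp_coeff m).
  by apply/funext => n; rewrite /= /series/= sumEFin.
apply: cvg_EFin; first exact: nearW.
exact: is_cvg_series_exp_coeff.
Qed.

Lemma nneseries_poisson_pow m z : (0 <= m)%R -> (0 <= z)%R ->
  \sum_(k <oo) (z ^+ k * poisson_weight m k)%:E = (expR ((z - 1) * m))%:E.
Proof.
move=> m0 z0.
have -> : (expR ((z - 1) * m))%:E = (expR (- m))%:E * (expR (z * m))%:E.
  by rewrite -EFinM -expRD; congr (expR _)%:E; ring.
rewrite -(@nneseries_expR (z * m)) ?mulr_ge0// -nneseriesZl; last first.
  by move=> k _; rewrite lee_fin divr_ge0 ?exprn_ge0 ?mulr_ge0.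
apply: eq_eseriesr => k _; rewrite -EFinM; congr EFin.
by rewrite /poisson_weight exprMn; ring.
Qed.

Lemma natr_ffact (n k : nat) : (\prod_(i < k) (n%:R - i%:R) = (n ^_ k)%:R :> R)%R.
Proof.
elim: k => [|k IHk]; first by rewrite big_ord0 ffactn0.
rewrite big_ord_recr/= IHk ffactnSr natrM.
have [kn|nk] := leqP k n; first by rewrite natrB.
by rewrite ffact_small// !mul0r.
Qed.

(** The terms with k < j vanish and the others are m^j times the Poisson
    probabilities of k - j. *)
Lemma nneseries_poisson_ffact m j : (0 <= m)%R ->
  \sum_(k <oo) ((k ^_ j)%:R * poisson_weight m k)%:E = (m ^+ j)%:E.
Proof.
move=> m0.
have f0 k : 0 <= ((k ^_ j)%:R * poisson_weight m k)%:E.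
  by rewrite lee_fin mulr_ge0// poisson_weight_ge0.
rewrite (@nneseries_split _ _ 0 j)//= add0n.
rewrite big_nat_cond big1 ?add0e; last first.
  by move=> k /andP[/andP[_ kj] _]; rewrite ffact_small// mul0r.
rewrite -nneseries_addn//.
transitivity (\sum_(k <oo) ((m ^+ j)%:E * (1 ^+ k * poisson_weight m k)%:E)).
  apply: eq_eseriesr => k _; rewrite -EFinM; congr EFin.
  rewrite expr1n mul1r /poisson_weight.
  have F := ffact_fact (leq_addl k j); rewrite addnK in F.
  rewrite -F natrM exprD.
  by field; rewrite !pnatr_eq0 -!lt0n fact_gt0 ffact_gt0 leq_addl.
rewrite nneseriesZl; last by move=> k _; rewrite lee_fin mulr_ge0 ?poisson_weight_ge0// expr1n.
by rewrite nneseries_poisson_pow// subrr mul0r expR0 mule1.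
Qed.

Lemma nneseries_poisson_weight m : (0 <= m)%R ->
  \sum_(k <oo) (poisson_weight m k)%:E = 1.
Proof.
move=> m0; have := @nneseries_poisson_pow m 1%R m0 ler01.
rewrite subrr mul0r expR0 => <-; apply: eq_eseriesr => k _.
by rewrite expr1n mul1r.
Qed.

End poisson_sums.

(** * Laws of a single count *)

Section cond_probability_theory.
Context d (T : measurableType d) (R : realType) (P : probability T R).
Variable xi : T -> R.
Hypotheses (mxi : measurable_fun setT xi) (xi0 : forall w, 0 <= xi w).

Lemma cond_probability_integral (E : set T) (p : R -> R) (h : R -> \bar R) :
  cond_probability P xi E p -> measurable_fun setT p ->
  (forall x, 0 <= x -> 0 <= p x) ->
  measurable_fun setT h -> (forall x, 0 <= h x)%E ->
  (\int[P]_(w in E) h (xi w) = \int[P]_w (h (xi w) * (p (xi w))%:E))%E.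
Proof.
move=> [mE Ep] mp p0 mh h0.
apply: (@ge0_integral_transfer _ _ T T R P P E setT xi xi (p \o xi)) => //.
- exact: measurable_funTS.
- exact: measurableT_comp.
- by move=> w _; exact: p0.
- by move=> A mA; rewrite setTI; exact: Ep.
Qed.

Lemma cond_probability_total (E : set T) (p : R -> R) :
  cond_probability P xi E p -> P E = (\int[P]_w (p (xi w))%:E)%E.
Proof. by move=> [_ /(_ _ measurableT)]; rewrite preimage_setT setIT. Qed.

Lemma eq_cond_probability (E F : set T) (p q : R -> R) :
  E = F -> (forall x, 0 <= x -> p x = q x) ->
  cond_probability P xi E p -> cond_probability P xi F q.
Proof.
move=> <- pq [mE Ep]; split => // A mA; rewrite Ep//.
by apply: eq_integral => w _; rewrite pq.
Qed.

End cond_probability_theory.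

Section mixed_counting.
Context d (T : measurableType d) (R : realType) (P : probability T R).
Variables (xi : T -> R) (M : R -> T -> nat).
Hypotheses (mxi : measurable_fun setT xi) (xi0 : forall w, 0 <= xi w).
Hypothesis M0 : forall w, M 0 w = 0%N.
Hypothesis mM : forall s, 0 <= s -> measurable_fun setT (M s).
Hypothesis Mincr : mixed_increments P xi M.

Lemma cond_probability_count u k : 0 <= u ->
  cond_probability P xi [set w | M u w = k] (fun x => poisson_weight (x * u) k).
Proof.
move=> u0; pose v i : R := if i is 0%N then 0 else u.
have v0 i : 0 <= v i by case: i.
have nd i : (i < 1)%N -> v i <= v i.+1 by case: i.
apply: (eq_cond_probability xi0 _ _ (Mincr (fun=> k) v0 nd)).
  apply/seteqP; split => w /=; first by move=> /(_ 0%N isT); rewrite M0 subn0.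
  by move=> <- [|//] _; rewrite M0 subn0.
by move=> x x0; rewrite /increment_weight big_ord1 subr0.
Qed.

Let measurable_count u k : 0 <= u -> measurable [set w | M u w = k].
Proof. by move=> u0; have [] := cond_probability_count k u0. Qed.

Let measurable_weight u k : measurable_fun setT (fun x : R => poisson_weight (x * u) k).
Proof.
apply: (measurableT_comp (f := poisson_weight ^~ k)).
  by apply: continuous_measurable_fun; exact: continuous_poisson_weight.
exact: measurable_funM.
Qed.

Let count_split u : [set: T] = \bigcup_k [set w | M u w = k].
Proof. by apply/seteqP; split => // w _; exists (M u w). Qed.

Let trivIset_count u : trivIset setT (fun k => [set w | M u w = k]).
Proof.
apply/trivIsetP => i j _ _ /eqP ij; apply/seteqP; split=> // w [/= wi wj].
by case: ij; rewrite -wi -wj.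
Qed.

Let measurable_countf u (a : nat -> R) : 0 <= u ->
  measurable_fun setT (fun w => a (M u w)).
Proof. by move=> u0; apply: measurableT_comp => //; exact: mM. Qed.

(** Split over the values of M u and exchange the sum with the integral; all
    terms are nonnegative. *)
Lemma count_expectation u (a : nat -> R) : 0 <= u -> (forall k, 0 <= a k) ->
  (\int[P]_w (a (M u w))%:E
    = \int[P]_w \sum_(k <oo) (a k * poisson_weight (xi w * u) k)%:E)%E.
Proof.
move=> u0 a0; rewrite (count_split u) ge0_integral_bigcup//=; last 3 first.
- by move=> k; exact: measurable_count.
- by rewrite -count_split; apply/measurable_EFinP; exact: measurable_countf.
- by move=> w _; rewrite lee_fin.
rewrite -count_split integral_nneseries//; last 2 first.
- move=> k; apply/measurable_EFinP; apply: measurable_funM => //.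
  exact: measurableT_comp (measurable_weight u k) mxi.
- by move=> k w _; rewrite lee_fin mulr_ge0// poisson_weight_ge0// mulr_ge0.
apply: eq_eseriesr => k _.
transitivity (\int[P]_(w in [set w | M u w = k]) (cst (a k)%:E (xi w)))%E.
  by apply: eq_integral => w; rewrite inE/= => ->.
rewrite (@cond_probability_integral _ _ _ P xi mxi xi0 _ _ (cst (a k)%:E) (cond_probability_count k u0))//.
  by move=> x x0; rewrite poisson_weight_ge0// mulr_ge0.
by move=> x; rewrite lee_fin.
Qed.

Lemma probability_increments n (u : nat -> R) (k : nat -> nat) :
  u 0%N = 0 -> (forall i, 0 <= u i) -> (forall i, (i < n)%N -> u i <= u i.+1) ->
  P [set w | forall i, (i < n)%N -> (M (u i.+1) w - M (u i) w)%N = k i]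
  = (((\prod_(i < n) (u i.+1 - u i) ^+ k i) / (\prod_(i < n) (k i)`!%:R))%:E
     * laplace_moment P xi (\sum_(i < n) k i) (u n))%E.
Proof.
move=> u00 u0 nd; rewrite (cond_probability_total (Mincr k u0 nd)).
rewrite /laplace_moment -ge0_integralZl//; last 3 first.
- apply/measurable_EFinP; apply: measurable_funM; first exact: measurable_funX.
  apply: measurableT_comp; first exact: measurable_expR.
  by apply: measurable_funN; exact: measurable_funM.
- by move=> w _; rewrite lee_fin mulr_ge0 ?exprn_ge0 ?expR_ge0.
- rewrite lee_fin divr_ge0//; apply: prodr_ge0 => i _ //.
  by rewrite exprn_ge0// subr_ge0 nd.
apply: eq_integral => w _; rewrite -EFinM; congr EFin.
by rewrite increment_weightE u00 subr0 (mulrC (xi w) (u n)).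
Qed.

Lemma probability_count u k : 0 <= u ->
  P [set w | M u w = k] = ((u ^+ k / k`!%:R)%:E * laplace_moment P xi k u)%E.
Proof.
move=> u0; rewrite (cond_probability_total (cond_probability_count k u0)).
rewrite /laplace_moment -ge0_integralZl//; last 3 first.
- apply/measurable_EFinP; apply: measurable_funM; first exact: measurable_funX.
  apply: measurableT_comp; first exact: measurable_expR.
  by apply: measurable_funN; exact: measurable_funM.
- by move=> w _; rewrite lee_fin mulr_ge0 ?exprn_ge0 ?expR_ge0.
- by rewrite lee_fin divr_ge0// exprn_ge0.
apply: eq_integral => w _; rewrite -EFinM; congr EFin.
by rewrite /poisson_weight exprMn (mulrC u (xi w)); ring.
Qed.

Lemma count_ffact_expectation u j : 0 <= u ->
  (\int[P]_w (((M u w) ^_ j)%:R)%:E = (u ^+ j)%:E * laplace_moment P xi j 0)%E.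
Proof.
move=> u0; rewrite (@count_expectation u (fun k => (k ^_ j)%:R))//.
rewrite /laplace_moment -ge0_integralZl//; last 3 first.
- apply/measurable_EFinP; apply: measurable_funM; first exact: measurable_funX.
  apply: measurableT_comp; first exact: measurable_expR.
  by apply: measurable_funN; exact: measurable_funM.
- by move=> w _; rewrite lee_fin mulr_ge0 ?exprn_ge0 ?expR_ge0.
- by rewrite lee_fin exprn_ge0.
apply: eq_integral => w _; rewrite nneseries_poisson_ffact ?mulr_ge0//.
by rewrite mul0r oppr0 expR0 mulr1 exprMn mulrC EFinM.
Qed.

Lemma count_pgf_ge0 u z : 0 <= u -> 0 <= z ->
  (\int[P]_w (z ^+ M u w)%:E = \int[P]_w (expR ((z - 1) * (xi w * u)))%:E)%E.
Proof.
move=> u0 z0; rewrite (@count_expectation u (fun k => z ^+ k))//; last first.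
  by move=> k; exact: exprn_ge0.
by apply: eq_integral => w _; rewrite nneseries_poisson_pow// mulr_ge0.
Qed.

End mixed_counting.

Section mpps_marginals.
Context d (T : measurableType d) (R : realType) (P : probability T R).
Variables (alpha beta c : R) (xi : T -> R) (M : R -> T -> nat).
Hypotheses (beta0 : 0 < beta) (c0 : c != 0).
Hypotheses (xi0 : forall w, 0 <= xi w) (xiS : Stacy P alpha beta c xi).
Hypothesis M0 : forall w, M 0 w = 0%N.
Hypothesis mM : forall s, 0 <= s -> measurable_fun setT (M s).
Hypothesis Mincr : mixed_increments P xi M.

Let mxi : measurable_fun setT xi. Proof. exact: stacy_measurable xiS. Qed.
Let Ga0 : 0 < Gamma alpha. Proof. exact: (Gamma_gt0 xi0 xiS). Qed.
Local Notation lap := (laplace_moment P xi).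
Local Notation K n s := (kratzel (- c) (- c * alpha - n%:R) (s / beta)).

Let lapK n s : 0 < s -> lap n s = (`|c| / (beta ^+ n * Gamma alpha) * K n s)%:E.
Proof.
move=> s0; apply: (laplace_moment_kratzel beta0 c0 xi0 xiS).
by apply: (laplace_moment_ltoo xi0 xiS); [exact: ltW|right].
Qed.

Let K0 n s : 0 < s -> 0 < K n s.
Proof.
move=> s0; apply: (kratzel_gt0 beta0 c0 xi0 xiS).
by apply: (laplace_moment_ltoo xi0 xiS); [exact: ltW|right].
Qed.

Lemma mixed_MPStacy u : 0 < u -> MPStacy P alpha (beta / u) c (M u).
Proof.
move=> u0; split; first exact: mM (ltW u0).
move=> n; rewrite (probability_count mxi xi0 M0 Mincr) ?ltW// lapK//.
rewrite -EFinM /mpstacy_pmf invf_div; congr EFin; rewrite mulrA; congr (_ * _).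
rewrite expr_div_n; field.
by rewrite !gt_eqF ?ltr0n ?fact_gt0 ?exprn_gt0.
Qed.

Lemma mixed_ffact_expectation u j : 0 <= u ->
  (\int[P]_w (((M u w) ^_ j)%:R)%:E = (u ^+ j)%:E * lap j 0)%E.
Proof. exact: (count_ffact_expectation mxi xi0 M0 mM Mincr). Qed.

Let mcount (a : nat -> R) u : 0 <= u -> measurable_fun setT (fun w => a (M u w)).
Proof. by move=> u0; apply: measurableT_comp => //; exact: mM. Qed.

Lemma mixed_mean u : 0 <= u -> - c^-1 < alpha ->
  ('E_P[fun w => ((M u w)%:R)%R])%E
    = (Gamma (alpha + c^-1) / (beta * Gamma alpha) * u)%:E.
Proof.
move=> u0 ca; rewrite unlock.
under eq_integral do rewrite -[M u _]ffactn1.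
rewrite mixed_ffact_expectation// (stacy_moment beta0 c0 xi0 xiS).
  by rewrite -EFinM !expr1 mulrC mul1r.
by rewrite mul1r ltrNl.
Qed.

(** Everything is kept nonnegative, since the variance is not yet known to be
    finite: the identity (M - m)^2 + 2 m M = M (M - 1) + M + m^2 is integrated
    term by term, and its right-hand side is finite by the factorial moments. *)
Lemma mixed_variance u : 0 <= u -> - Num.min c^-1 (2 / c) < alpha ->
  ('V_P[fun w => ((M u w)%:R)%R])%E
    = (u * (Gamma (alpha + c^-1) / (beta * Gamma alpha))
       * (1 + u * (Gamma (alpha + 2 / c) / (beta * Gamma (alpha + c^-1))
                   - Gamma (alpha + c^-1) / (beta * Gamma alpha))))%:E.
Proof.
move=> u0; rewrite ltrNl lt_min => /andP[c1 c2].
have E1 := mixed_mean u0; rewrite ltrNl in E1; have {}E1 := E1 c1.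
have E2 := mixed_ffact_expectation 2 u0.
rewrite (stacy_moment beta0 c0 xi0 xiS)// -EFinM in E2.
rewrite /variance unlock E1 /=; set m := _ * u in E1 *.
set V := ('E_P[_])%E.
have m0 : 0 <= m by rewrite mulr_ge0// divr_ge0 ?Gamma_ge0// mulr_ge0 ?Gamma_ge0// ltW.
have eV : (V + (2 * m * m)%:E = (u ^+ 2 * (Gamma (alpha + 2 / c) / (beta ^+ 2 * Gamma alpha)))%:E
    + m%:E + (m * m)%:E)%E.
  rewrite -E2 -E1 {}/V unlock.
  transitivity (\int[P]_w (((M u w)%:R - m) ^+ 2 + 2 * m * (M u w)%:R)%:E)%E.
    under [RHS]eq_integral do rewrite EFinD.
    rewrite ge0_integralD//; last 4 first.
    - by move=> w _; rewrite lee_fin sqr_ge0.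
    - by apply/measurable_EFinP; apply: (mcount (fun k => (k%:R - m) ^+ 2)).
    - by move=> w _; rewrite lee_fin mulr_ge0 // mulr_ge0.
    - by apply/measurable_EFinP; apply: (mcount (fun k => 2 * m * k%:R)).
    congr (_ + _)%E; under eq_integral do rewrite EFinM.
    rewrite ge0_integralZl//; last 2 first.
    - by apply/measurable_EFinP; apply: (mcount (fun k => k%:R)).
    - by rewrite lee_fin mulr_ge0.
    by rewrite EFinM -E1 unlock.
  transitivity (\int[P]_w (((M u w) ^_ 2)%:R + (M u w)%:R + m * m)%:E)%E.
    apply: eq_integral => w _; congr EFin.
    by rewrite -natr_ffact !big_ord_recr big_ord0/=; ring.
  under eq_integral do rewrite !EFinD.
  rewrite !ge0_integralD//; last 5 first.
  - by apply/measurable_EFinP; apply: (mcount (fun k => (k ^_ 2)%:R)).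
  - by apply/measurable_EFinP; apply: (mcount (fun k => k%:R)).
  - by move=> w _; rewrite -EFinD lee_fin addr_ge0.
  - by apply/measurable_EFinP; apply: (mcount (fun k => (k ^_ 2)%:R + k%:R)).
  - by move=> w _; rewrite lee_fin mulr_ge0.
  by congr (_ + _)%E; rewrite integral_cst// [X in (_ * X)%E](_ : _ = 1%E) ?mule1//; exact: probability_setT.
have G1 : 0 < Gamma (alpha + c^-1).
  have := laplace_moment_gt0 xi0 xiS 1 0.
  rewrite (stacy_moment beta0 c0 xi0 xiS) ?mul1r//.
  by rewrite lte_fin pmulr_lgt0// invr_gt0 mulr_gt0// exprn_gt0.
case: V eV => [v| |]// [ev]; congr EFin.
have -> : v = u ^+ 2 * (Gamma (alpha + 2 / c) / (beta ^+ 2 * Gamma alpha))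
    + m + m * m - 2 * m * m by rewrite -ev; ring.
rewrite /m; have gA := Ga0.
move: (Gamma alpha) gA (Gamma (alpha + c^-1)) G1 (Gamma (alpha + 2 / c)) => g0 g00 g1 g10 g2.
by field; rewrite (gt_eqF beta0) (gt_eqF g00) (gt_eqF g10).
Qed.

Lemma mixed_ffact_moment u k : 0 <= u -> - alpha < k%:R / c ->
  ('E_P[fun w => (\prod_(i < k) ((M u w)%:R - i%:R))%R])%E
    = ((u ^+ k)%R%:E * 'E_P[fun w => (xi w ^+ k)%R])%E /\
  ((u ^+ k)%R%:E * 'E_P[fun w => (xi w ^+ k)%R])%E
    = (u ^+ k * Gamma (alpha + k%:R / c) / (beta ^+ k * Gamma alpha))%:E.
Proof.
move=> u0 kc.
have Ek : ('E_P[fun w => (xi w ^+ k)%R])%E = lap k 0.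
  rewrite unlock; apply: eq_integral => w _.
  by rewrite mul0r oppr0 expR0 mulr1.
rewrite Ek (stacy_moment beta0 c0 xi0 xiS)//; split; last first.
  by rewrite -EFinM mulrA.
rewrite -(stacy_moment beta0 c0 xi0 xiS)// -mixed_ffact_expectation// unlock.
by apply: eq_integral => w _; rewrite natr_ffact.
Qed.

Let mexp a : measurable_fun setT (fun w => expR (a * xi w)).
Proof.
by apply: measurableT_comp; [exact: measurable_expR|exact: measurable_funM].
Qed.

Let poisson_series_sum (m z : R) : 0 <= m ->
  (\sum_(k <oo) ((`|z| ^+ k + z ^+ k) * poisson_weight m k)%R%:E
    = (expR ((`|z| - 1) * m) + expR ((z - 1) * m))%R%:E)%E.
Proof.
move=> m0; apply/cvg_lim => //.
have -> : (fun n => \sum_(0 <= k < n) ((`|z| ^+ k + z ^+ k) * poisson_weight m k)%R%:E)%E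
  = EFin \o (fun n => expR (- m) * (series (exp_coeff (`|z| * m)) n + series (exp_coeff (z * m)) n)).
  apply/funext => n; rewrite /= /series/= -big_split/= big_distrr/= -sumEFin.
  apply: eq_bigr => k _; congr EFin.
  by rewrite /poisson_weight /exp_coeff/= !exprMn; ring.
apply: cvg_EFin; first exact: nearW.
have -> : expR ((`|z| - 1) * m) + expR ((z - 1) * m)
    = expR (- m) * (expR (`|z| * m) + expR (z * m)).
  by rewrite mulrDr -!expRD; congr (expR _ + expR _); ring.
by apply: cvgM; [exact: cvg_cst|apply: cvgD; exact: is_cvg_series_exp_coeff].
Qed.

(** For negative z the series alternates, so it cannot be exchanged with the
    integral directly. Adding |z|^M makes the summands nonnegative; the extra
    term is integrable by hypothesis and is subtracted afterwards. *)
Lemma mixed_pgf u z : 0 <= u -> z < 1 ->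
  (-1 <= z -> P.-integrable setT (fun w => (z ^+ M u w)%:E)) /\
  (P.-integrable setT (fun w => (z ^+ M u w)%:E) ->
   ('E_P[fun w => (z ^+ M u w)%R])%E
     = (`|c| / Gamma alpha
        * kratzel (- c) (- c * alpha) (u / beta * (1 - z)))%:E).
Proof.
move=> u0 z1; split => [z1'|iz].
  apply: (@le_integrable _ _ _ P setT measurableT _ (cst 1%E)).
  - by apply/measurable_EFinP; exact: (mcount (fun k => z ^+ k)).
  - by move=> w _; rewrite /= normrX lee_fin normr1 exprn_ile1// ler_norml z1' ltW.
  - exact: finite_measure_integrable_cst.
have ia : P.-integrable setT (fun w => (`|z| ^+ M u w)%:E).
  apply: le_integrable iz => //.
    by apply/measurable_EFinP; exact: (mcount (fun k => `|z| ^+ k)).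
  by move=> w _; rewrite /= !normrX normr_id.
have b0 k : 0 <= `|z| ^+ k + z ^+ k.
  by rewrite -lerBlDr sub0r -normrX -normrN ler_norm.
have Eb : (\int[P]_w (`|z| ^+ M u w + z ^+ M u w)%R%:E
    = \int[P]_w (`|z| ^+ M u w)%R%:E + lap 0 (u * (1 - z)%R))%E.
  rewrite (count_expectation mxi xi0 M0 mM Mincr u0 b0).
  rewrite (count_pgf_ge0 mxi xi0 M0 mM Mincr u0 (normr_ge0 z)).
  rewrite /laplace_moment -ge0_integralD//; last 3 first.
  - apply/measurable_EFinP.
    by under eq_fun do rewrite (mulrC (xi _)) mulrA; exact: mexp.
  - by move=> w _; rewrite lee_fin mulr_ge0 ?exprn_ge0 ?expR_ge0.
  - apply/measurable_EFinP.
    by under eq_fun do rewrite expr0 mul1r -mulNr; exact: mexp.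
  apply: eq_integral => w _; rewrite poisson_series_sum ?mulr_ge0// -EFinD.
  by rewrite expr0 mul1r; congr (_ + expR _)%:E; ring.
rewrite unlock.
have Eb2 : (\int[P]_w (`|z| ^+ M u w + z ^+ M u w)%R%:E
    = \int[P]_w (`|z| ^+ M u w)%R%:E + \int[P]_w (z ^+ M u w)%:E)%E.
  by under eq_integral do rewrite EFinD; exact: integralD.
have -> : (\int[P]_w (z ^+ M u w)%:E)%E = lap 0 (u * (1 - z)).
  have fa := integrable_fin_num measurableT ia.
  move: Eb; rewrite Eb2 => /(congr1 (fun y => y - \int[P]_w (`|z| ^+ M u w)%R%:E)%E).
  by rewrite ![(\int[P]_w (`|z| ^+ M u w)%R%:E + _)%E]addeC !addeK.
have z0 : 0 <= u * (1 - z) by rewrite mulr_ge0// subr_ge0 ltW.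
rewrite (laplace_moment_kratzel beta0 c0 xi0 xiS); last first.
  by apply: (laplace_moment_ltoo xi0 xiS) => //; left.
by rewrite expr0 mul1r mulr0n subr0 (mulrAC u).
Qed.

Let probability_count_gt0 u n : 0 < u ->
  P [set w | M u w = n] = (u ^+ n / n`!%:R * (`|c| / (beta ^+ n * Gamma alpha) * K n u))%:E.
Proof.
by move=> u0; rewrite (probability_count mxi xi0 M0 Mincr) ?(ltW u0)// lapK.
Qed.

Let pn0 u n : 0 < u ->
  0 < u ^+ n / n`!%:R * (`|c| / (beta ^+ n * Gamma alpha) * K n u).
Proof.
move=> u0; rewrite mulr_gt0//; first by rewrite divr_gt0 ?exprn_gt0// ltr0n fact_gt0.
by rewrite mulr_gt0 ?K0// divr_gt0 ?normr_gt0// mulr_gt0// exprn_gt0.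
Qed.

Let measurable_weight_xi u k : measurable_fun setT (fun x : R => poisson_weight (`|x| * u) k).
Proof.
apply: (measurableT_comp (f := poisson_weight ^~ k)).
  by apply: continuous_measurable_fun; exact: continuous_poisson_weight.
by apply: measurable_funM => //; exact: normr_measurable.
Qed.

(** The absolute value makes the likelihood nonnegative on the whole line, as
    integration against the law of xi requires. *)
Let densityE u n (x : R) : 0 < u -> 0 < x ->
  poisson_weight (`|x| * u) n * stacy_pdf alpha beta c x
  = u ^+ n / n`!%:R * (`|c| / (beta ^+ n * Gamma alpha) * K n u)
    * (if 0 < x then
         beta `^ (c * alpha + n%:R) * x `^ (c * alpha + n%:R - 1)
           / K n u * expR (- u * x - (beta * x) `^ c)
       else 0).
Proof.
move=> u0 x0; rewrite ger0_norm ?ltW// /stacy_pdf x0 (ltW x0) /poisson_weight.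
have -> : c * alpha + n%:R - 1 = n%:R + (c * alpha - 1) by ring.
have := K0 n u0; set Kn := kratzel _ _ _ => Kn0.
rewrite (powRD_gt0 (c * alpha) _ beta0) (powRD_gt0 n%:R _ x0) !powR_mulrn ?(ltW x0) ?(ltW beta0)//.
have -> : - u * x = - (x * u) by ring.
rewrite expRD exprMn; field.
by rewrite !gt_eqF ?exprn_gt0// ltr0n fact_gt0.
Qed.

(** Bayes: the Poisson probability times the prior density, divided by the
    probability of the count, in which the normalizing constants cancel. *)
Lemma mixed_cond_density u n : 0 < u ->
  has_cond_density P xi [set w | M u w = n]
    (fun x => if 0 < x then
       beta `^ (c * alpha + n%:R) * x `^ (c * alpha + n%:R - 1)
         / K n u * expR (- u * x - (beta * x) `^ c)
     else 0).
Proof.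
move=> u0; set f := fun x : R => _; set p := u ^+ n / n`!%:R * (`|c| / (beta ^+ n * Gamma alpha) * K n u).
have PE : P [set w | M u w = n] = p%:E by exact: probability_count_gt0.
have p0 : 0 < p by exact: pn0.
split; first by rewrite PE lte_fin.
move=> A mA; rewrite /cond_prob PE/= setIC.
have [_ cE] := cond_probability_count xi0 M0 Mincr n (ltW u0).
have f0 x : 0 <= f x.
  rewrite /f; case: ifPn => // _.
  by rewrite !mulr_ge0 ?powR_ge0 ?expR_ge0// invr_ge0 ltW// K0.
have mf : measurable_fun setT f.
  apply: measurable_fun_ifT => //; first exact: measurable_fun_ltr.
  apply: measurable_funM.
    by apply: measurable_funM => //; apply: measurable_funM.
  apply: measurableT_comp; first exact: measurable_expR.
  apply: measurable_funB; first exact: measurable_funM.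
  by apply: (measurableT_comp (measurable_powR _)); exact: measurable_funM.
have key : P ([set w | M u w = n] `&` xi @^-1` A)
    = (p%:E * \int[@lebesgue_measure R]_(x in A) (f x)%:E)%E.
  rewrite cE//.
  transitivity (\int[P]_w ((fun x : R => (poisson_weight (`|x| * u) n * \1_A x)%R%:E) (xi w)))%E.
    rewrite integral_mkcond; apply: eq_integral => w _.
    rewrite patchE ger0_norm// indicE.
    have [Aw|Aw] := pselect (A (xi w)); first by rewrite !mem_set// mulr1.
    by rewrite !memNset// mulr0.
  rewrite (@stacy_expectation _ _ _ _ _ _ _ _ xiS
    (fun x : R => (poisson_weight (`|x| * u) n * \1_A x)%R%:E)); last 2 first.
  - apply/measurable_EFinP; apply: measurable_funM; first exact: measurable_weight_xi.
    exact: measurable_indic.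
  - by move=> x; rewrite lee_fin mulr_ge0// poisson_weight_ge0// mulr_ge0// ltW.
  rewrite -ge0_integralZl//; last 3 first.
  - by apply/measurable_EFinP; exact: measurable_funTS.
  - by move=> x _; rewrite lee_fin.
  - by rewrite lee_fin ltW.
  rewrite [LHS]integral_mkcond [RHS]integral_mkcond.
  apply: eq_integral => x _; rewrite !patchE.
  have [x0|x0] := ltP 0 x; last first.
    rewrite memNset; last by rewrite /= in_itv/= andbT; apply/negP; rewrite -leNgt.
    by case: ifP => // _; rewrite /f ltNge x0/= mule0.
  rewrite mem_set; last by rewrite /= in_itv/= andbT.
  rewrite indicE; have [Ax|Ax] := pselect (A x); last first.
    by rewrite memNset// mulr0 mul0e.
  rewrite mem_set// mulr1 -!EFinM; congr EFin.
  exact: densityE.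
rewrite key; have ify : (\int[@lebesgue_measure R]_(x in A) (f x)%:E)%E \is a fin_num.
  rewrite ge0_fin_numE; last by apply: integral_ge0 => x _; rewrite lee_fin.
  rewrite ltNge leye_eq; apply/negP => /eqP iy; move: key; rewrite iy gt0_muley ?lte_fin//.
  move=> Py; have : (P ([set w | M u w = n] `&` xi @^-1` A) <= 1)%E.
    apply: probability_le1; apply: measurableI.
      by have [] := cond_probability_count xi0 M0 Mincr n (ltW u0).
    by rewrite -[_ @^-1` _]setTI; exact: mxi.
  by rewrite Py leye_eq.
by rewrite fineM//= mulrAC divff ?gt_eqF// mul1r fineK.
Qed.

Lemma mixed_cond_mean u n : 0 < u ->
  cond_mean P xi [set w | M u w = n]
    = (kratzel (- c) (- c * alpha - n%:R - 1) (u / beta) / (beta * K n u))%:E.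
Proof.
move=> u0; rewrite /cond_mean probability_count_gt0//.
have -> : (\int[P]_(w in [set w | M u w = n]) (xi w)%:E
    = (u ^+ n / n`!%:R)%:E * lap n.+1 u)%E.
  transitivity (\int[P]_(w in [set w | M u w = n]) (`|xi w|)%:E)%E.
    by apply: eq_integral => w _; rewrite ger0_norm.
  rewrite (@cond_probability_integral _ _ _ P xi mxi xi0 _ _ (fun x => `|x|%:E)
    (cond_probability_count xi0 M0 Mincr n (ltW u0))); last 4 first.
  - apply: (measurableT_comp (f := poisson_weight ^~ n)).
      by apply: continuous_measurable_fun; exact: continuous_poisson_weight.
    exact: measurable_funM.
  - by move=> x x0; rewrite poisson_weight_ge0// mulr_ge0// ltW.
  - by apply/measurable_EFinP; exact: normr_measurable.
  - by move=> x; rewrite lee_fin.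
  rewrite /laplace_moment -ge0_integralZl//; last 3 first.
  - by apply/measurable_EFinP; exact: (measurable_laplace_moment xiS).
  - by move=> w _; rewrite lee_fin mulr_ge0 ?exprn_ge0 ?expR_ge0.
  - by rewrite lee_fin divr_ge0// exprn_ge0// ltW.
  apply: eq_integral => w _; rewrite -!EFinM; congr EFin.
  by rewrite ger0_norm// /poisson_weight exprMn exprS (mulrC u); ring.
rewrite lapK// -!EFinM /=; congr EFin.
have -> : - c * alpha - n.+1%:R = - c * alpha - n%:R - 1 by rewrite -natr1; ring.
set L := kratzel _ _ _; have := K0 n u0; set Kn := kratzel _ _ _ => Kn0.
rewrite exprS; field.
by rewrite !gt_eqF ?normr_gt0 ?exprn_gt0// ltr0n fact_gt0.
Qed.

End mpps_marginals.

(** * Finite-dimensional laws *)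

Section mpps_increments.
Context d (T : measurableType d) (R : realType) (P : probability T R).
Variables (alpha beta c : R) (xi : T -> R) (M : R -> T -> nat).
Hypotheses (beta0 : 0 < beta) (c0 : c != 0).
Hypotheses (xi0 : forall w, 0 <= xi w) (xiS : Stacy P alpha beta c xi).
Hypothesis M0 : forall w, M 0 w = 0%N.
Hypothesis mM : forall s, 0 <= s -> measurable_fun setT (M s).
Hypothesis Mnd : forall w s u, 0 <= s -> s <= u -> (M s w <= M u w)%N.
Hypothesis Mincr : mixed_increments P xi M.
Variables (n : nat) (lam : nat -> R) (N : nat -> T -> nat).
Hypotheses (n0 : (0 < n)%N) (lam0 : 0 <= lam 0%N).
Hypothesis lamnd : forall i, (i.+1 < n)%N -> lam i <= lam i.+1.
Hypothesis NM : forall i w, (i < n)%N -> N i w = M (lam i) w.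

Let lam_ge0 i : (i < n)%N -> 0 <= lam i.
Proof.
elim: i => [//|i IHi] ni.
by rewrite (le_trans (IHi (ltnW ni)))// lamnd.
Qed.

Let lam_le i : (i <= n.-1)%N -> lam i <= lam n.-1.
Proof.
have main j : (j <= n.-1)%N -> lam (n.-1 - j)%N <= lam n.-1.
  elim: j => [|j IHj] jn; first by rewrite subn0.
  rewrite (le_trans _ (IHj (ltnW jn)))// -(subnSK jn) lamnd//.
  by rewrite subnSK// (leq_ltn_trans (leq_subr _ _))// ltn_predL.
by move=> ni; have := main (n.-1 - i)%N (leq_subr _ _); rewrite subKn.
Qed.

Let Nnd i w : (i.+1 < n)%N -> (N i w <= N i.+1 w)%N.
Proof. by move=> ni; rewrite !NM ?(ltnW ni)// Mnd ?lamnd// lam_ge0// ltnW. Qed.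

Let NX i w : (i < n)%N ->
  (N i w)%:R - before 0 (fun j => (N j w)%:R) i = (N i w - before 0 (N ^~ w) i)%N%:R :> R.
Proof.
case: i => [|i] ni /=; first by rewrite subr0 subn0.
by rewrite natrB// Nnd.
Qed.

Let mN i : (i < n)%N -> measurable_fun setT (N i).
Proof.
move=> ni; have -> : N i = M (lam i) by apply/funext => w; exact: NM.
by apply: mM; exact: lam_ge0.
Qed.

Let u i : R := if i is j.+1 then lam (minn j n.-1) else 0.

Let uS i : (i < n)%N -> u i.+1 = lam i.
Proof. by move=> ni; rewrite /u (minn_idPl _)// -ltnS prednK. Qed.

Let uE i : (i < n)%N -> u i = before 0 lam i.
Proof. by case: i => [//|i] ni; rewrite uS// ltnW. Qed.

(** The increments of the counts at the times lam are increments of M along the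
    times u, which start at 0 and stay constant after the last lam, because
    [mixed_increments] asks for nonnegative times at all indices. If the last
    time is 0 and some increment is positive, both sides are 0: the product
    contains a positive power of 0. *)
Let probability_vector (m : nat -> nat) :
  let s := (\sum_(i < n) m i)%N in
  P [set w | forall i, (i < n)%N -> (N i w - before 0 (N ^~ w) i)%N = m i]
  = (`|c| * (\prod_(i < n) (lam i - before 0 lam i) ^+ m i)
     / (beta ^+ s * (\prod_(i < n) (m i)`!%:R) * Gamma alpha)
     * kratzel (- c) (- c * alpha - s%:R) (lam n.-1 / beta))%:E.
Proof.
move=> s; have mxi := stacy_measurable xiS.
have u0 i : 0 <= u i.
  case: i => [//|i]; rewrite /u lam_ge0//.
  by rewrite (leq_ltn_trans (geq_minr _ _))// ltn_predL.
have und i : (i < n)%N -> u i <= u i.+1.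
  by case: i => [|i] ni; rewrite uS ?uS ?lam_ge0// ?lamnd// ltnW.
have un : u n = lam n.-1 by rewrite -[in LHS](prednK n0) uS// ltn_predL.
rewrite (_ : [set w | _] =
    [set w | forall i, (i < n)%N -> (M (u i.+1) w - M (u i) w)%N = m i]); last first.
  have e i w : (i < n)%N ->
      (M (u i.+1) w - M (u i) w)%N = (N i w - before 0 (N ^~ w) i)%N.
    move=> ni; rewrite uS// NM//; case: i ni => [|i] ni; first by rewrite /= M0.
    by rewrite uS ?(ltnW ni)// /= NM// ltnW.
  by apply/seteqP; split => w /= H i ni; rewrite -(H i ni) e.
rewrite (probability_increments mxi xi0 Mincr m (erefl _) u0 und) -/s un.
have -> : \prod_(i < n) (u i.+1 - u i) ^+ m i
    = \prod_(i < n) (lam i - before 0 lam i) ^+ m i.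
  by apply: eq_bigr => i _; rewrite uS// uE.
have l0 : 0 <= lam n.-1 by rewrite lam_ge0// ltn_predL.
(* For s = 0 or a positive last time the Laplace moment is known to be finite;
   otherwise the product vanishes and both sides are 0. *)
have [[s0 ln0]|sl] : (s != 0%N /\ lam n.-1 = 0) \/ (s = 0%N \/ 0 < lam n.-1).
  have [->|s0] := eqVneq s 0%N; first by right; left.
  by move: l0; rewrite le_eqVlt => /predU1P[<-|]; [left|right; right].
  have -> : \prod_(i < n) (lam i - before 0 lam i) ^+ m i = 0.
    have lz i : (i < n)%N -> lam i = 0.
      move=> ni; apply/eqP; rewrite eq_le lam_ge0// andbT -ln0.
      by apply: lam_le; rewrite -ltnS prednK.
    transitivity (\prod_(i < n) (0 : R) ^+ m i).
      apply: eq_bigr => -[[|i] ni] _ /=; first by rewrite lz// subr0.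
      by rewrite !lz ?subr0// ltnW.
    by rewrite prodrXr expr0n -/s (negbTE s0).
  by rewrite mul0r mul0e mulr0 !mul0r.
have F0 : 0 < \prod_(i < n) (m i)`!%:R :> R.
  by apply: prodr_gt0 => i _; rewrite ltr0n fact_gt0.
have G0 := Gamma_gt0 xi0 xiS.
rewrite (laplace_moment_kratzel beta0 c0 xi0 xiS).
  rewrite -EFinM; congr EFin; field.
  by rewrite !gt_eqF// exprn_gt0.
exact: (laplace_moment_ltoo xi0 xiS).
Qed.

Lemma mixed_M_PS : M_PS P n alpha beta c lam
  (fun i w => (N i w)%:R - before 0 (fun j => (N j w)%:R) i).
Proof.
split.
- move=> i ni.
  apply: measurable_funB; first exact: measurableT_comp (mN ni).
  case: i ni => [|i] ni //=.
  by apply: measurableT_comp => //; apply: mN; exact: ltnW.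
- move=> m s; rewrite -probability_vector; congr (P _).
  apply/seteqP; split => w /= H i ni; last by rewrite NX// H.
  by move: (H i ni); rewrite NX// => /eqP; rewrite eqr_nat => /eqP.
- move=> v nv; rewrite (_ : [set w | _] = set0) ?measure0//.
  apply/seteqP; split=> // w /= H; apply: nv.
  by exists (fun i => N i w - before 0 (N ^~ w) i)%N => i ni; rewrite -H// NX.
Qed.

(** Ordered counts and their increments determine each other, so this is the law
    of the increments. *)
Lemma mixed_O_PS : O_PS P n alpha beta c lam (fun i w => (N i w)%:R).
Proof.
split.
- by move=> i ni; exact: measurableT_comp (mN ni).
- move=> k knd.
  have ks : k n.-1 = (\sum_(i < n) (k i - before 0 k i))%N.
    have ksum p : (p < n)%N -> (\sum_(i < p.+1) (k i - before 0 k i))%N = k p.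
      elim: p => [|p IHp] pn; first by rewrite big_ord1 subn0.
      by rewrite big_ord_recr/= IHp ?(ltnW pn)// subnKC// knd.
    by rewrite -[in RHS](prednK n0) ksum// ltn_predL.
  have := probability_vector (fun i => k i - before 0 k i)%N.
  rewrite /= -ks => <-; congr (P _).
  apply/seteqP; split => w /= H i ni.
    have Nk j : (j < n)%N -> N j w = k j.
      by move=> /H /eqP; rewrite eqr_nat => /eqP.
    by rewrite Nk//; case: i ni => [|i] ni//=; rewrite Nk// ltnW.
  congr (_%:R); elim: i ni => [|i IHi] ni; first by have := H _ ni; rewrite /= !subn0.
  rewrite -(subnKC (Nnd w ni)) -(subnKC (knd _ ni)) -IHi ?(ltnW ni)//.
  by congr (_ + _)%N; have := H _ ni; rewrite /= IHi// ltnW.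
- move=> v nv; rewrite (_ : [set w | _] = set0) ?measure0//.
  apply/seteqP; split=> // w /= H; apply: nv.
  exists (N ^~ w); split => [i ni|i ni]; first exact: Nnd.
  by rewrite H.
Qed.

End mpps_increments.

(** * The mixed Erlang law *)

Section poisson_tail.
Context {R : realType}.
Implicit Types (m x t u : R).
Local Notation mu := (@lebesgue_measure R).

(** The probability that a Poisson variable of mean m is less than n. With m = x
    t it is also the probability that the n-th event of a Poisson process of
    rate x occurs after t. *)
Definition poisson_tail n m : R := \sum_(k < n) poisson_weight m k.

Lemma poisson_tail_ge0 n m : 0 <= m -> 0 <= poisson_tail n m.
Proof. by move=> m0; apply: sumr_ge0 => k _; exact: poisson_weight_ge0. Qed.

Lemma poisson_tail0 n : poisson_tail n.+1 (0 : R) = 1.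
Proof.
rewrite /poisson_tail big_ord_recl poisson_weight0/= big1 ?addr0// => i _.
by rewrite poisson_weight0.
Qed.

Lemma poisson_tail1 m : poisson_tail 1 m = expR (- m).
Proof. by rewrite /poisson_tail big_ord1 /poisson_weight expr0 divr1 mul1r. Qed.

Lemma poisson_weight_le m k : 0 < m -> poisson_weight m k <= k.+1%:R / m.
Proof.
move=> m0; rewrite /poisson_weight expRN ler_pdivrMr ?expR_gt0//.
rewrite mulrAC ler_pdivlMr// mulrAC ler_pdivrMr ?ltr0n ?fact_gt0//.
rewrite -exprSr.
have := expR_ge1Dxn k (ltW m0).
have F0 : 0 < k.+1`!%:R :> R by rewrite ltr0n fact_gt0.
rewrite -(ler_pM2l F0) => h.
have -> : k.+1%:R * expR m * k`!%:R = k.+1`!%:R * expR m.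
  by rewrite factS natrM; ring.
rewrite (le_trans _ h)// mulrDr mulrCA divff ?gt_eqF// !mulr1.
by rewrite lerDr ltW.
Qed.

Lemma cvg_poisson_tail n x : 0 < x -> poisson_tail n (x * t) @[t --> +oo] --> (0 : R).
Proof.
move=> x0; elim: n => [|n IHn].
  by under eq_fun do rewrite /poisson_tail big_ord0; exact: cvg_cst.
under eq_fun do rewrite /poisson_tail big_ord_recr/= -/(poisson_tail n _).
have -> : 0 = 0 + 0 :> R by rewrite addr0.
apply: cvgD => //; apply/cvgrPdist_le => e e0; near=> t.
have t0 : 0 < t by near: t; exact: nbhs_pinfty_gt.
have xt0 : 0 < x * t by rewrite mulr_gt0.
rewrite sub0r normrN ger0_norm ?poisson_weight_ge0 ?(ltW xt0)//.
rewrite (le_trans (poisson_weight_le n xt0))// ler_pdivrMr//.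
rewrite -ler_pdivrMl// -ler_pdivrMl//.
Unshelve. all: by end_near. Qed.

Lemma is_derive_poisson_weight k m :
  is_derive m (1 : R) (poisson_weight ^~ k.+1) (poisson_weight m k - poisson_weight m k.+1).
Proof.
have dX : is_derive m (1 : R) ((id : R -> R) ^+ k.+1) (k.+1%:R * m ^+ k).
  by apply: is_derive_eq; rewrite /GRing.scale/= mulr1.
have dE : is_derive m (1 : R) (fun m : R => expR (- m)) (- expR (- m)).
  by apply: is_derive_eq; rewrite /GRing.scale/= ?mulr1 mulrN1.
have dZ := is_deriveZ k.+1`!%:R^-1 (is_deriveM dX dE).
have e : k.+1`!%:R^-1 \*: ((id : R -> R) ^+ k.+1 * (fun m : R => expR (- m)))
    = poisson_weight ^~ k.+1.
  apply/funext => t; rewrite /poisson_weight.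
  transitivity (k.+1`!%:R^-1 * (((id : R -> R) ^+ k.+1) t * expR (- t))) => //.
  by rewrite exprfctE; ring.
rewrite -e; apply: (is_derive_eq dZ).
rewrite exprfctE /GRing.scale/= /poisson_weight factS natrM; field.
by rewrite nat1r !pnatr_eq0 -!lt0n fact_gt0.
Qed.

(** The sum telescopes: up to the factor - x only the last Poisson weight
    survives. *)
Lemma is_derive_poisson_tail n x t :
  is_derive t (1 : R) (fun t => poisson_tail n.+1 (x * t)) (- (x * poisson_weight (x * t) n)).
Proof.
elim: n => [|n IHn].
  rewrite /poisson_weight expr0 divr1 mul1r.
  have -> : (fun t => poisson_tail 1 (x * t)) = (fun t => expR (- (x * t))).
    by apply/funext => s; rewrite poisson_tail1.
  by apply: is_derive_eq; rewrite /GRing.scale/=; ring.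
have -> : (fun t => poisson_tail n.+2 (x * t))
    = (fun t => poisson_tail n.+1 (x * t)) + ((poisson_weight ^~ n.+1) \o (fun t => x * t)).
  by apply/funext => s; rewrite !fctE /poisson_tail big_ord_recr.
have dx : is_derive t (1 : R) (fun t : R => x * t) x.
  by apply: is_derive_eq; rewrite /GRing.scale/= mulr1.
have dw := @is_derive1_comp _ (poisson_weight ^~ n.+1) _ _ _ _ (is_derive_poisson_weight n (x * t)) dx.
by have := is_deriveD IHn dw; congr (is_derive _ _ _ _); ring.
Qed.

(** The Erlang density of rate x is the opposite of the derivative of its tail,
    and the tail vanishes at infinity. *)
Lemma integral_poisson_weight n x u : 0 < x -> 0 <= u ->
  (\int[mu]_(t in `]u, +oo[) (x * poisson_weight (x * t) n)%:E
    = (poisson_tail n.+1 (x * u))%:E)%E.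
Proof.
move=> x0 u0.
have cw : continuous (fun t => x * poisson_weight (x * t) n).
  move=> t; apply: cvgM; first exact: cvg_cst.
  apply: (@continuous_comp _ _ _ (fun t : R => x * t) (poisson_weight ^~ n)).
    by apply: cvgM; [exact: cvg_cst|exact: cvg_id].
  exact: continuous_poisson_weight.
rewrite integral_itv_obnd_cbnd; last first.
  by apply/measurable_EFinP; apply: measurable_funTS; exact: continuous_measurable_fun.
have dF t : is_derive t 1 (fun t => - poisson_tail n.+1 (x * t)) (x * poisson_weight (x * t) n).
  by have := is_deriveN (is_derive_poisson_tail n x t); rewrite opprK.
rewrite (@ge0_continuous_FTC2y R _ (fun t => - poisson_tail n.+1 (x * t)) u 0).
- by rewrite sub0e EFinN oppeK.
- move=> t ut; rewrite mulr_ge0 ?(ltW x0)// poisson_weight_ge0// mulr_ge0 ?(ltW x0)//.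
  exact: le_trans ut.
- exact: continuous_subspaceT.
- by rewrite -oppr0; apply: cvgN; exact: cvg_poisson_tail.
- by move=> t _; have [] := dF t.
- have [du _] := dF u; apply: cvg_at_right_filter.
  exact: (differentiable_continuous (iffLR (derivable1_diffP _ _) du)).
- by move=> t _; rewrite derive1E; apply: (@derive_val _ _ _ _ _ _ _ (dF t)).
Qed.

End poisson_tail.

Section density_measure.
Context {R : realType}.
Variables (f : R -> R) (mf : measurable_fun setT f) (f0 : forall x, 0 <= f x).
Local Notation mu := (@lebesgue_measure R).
Local Open Scope ereal_scope.

(** The proofs about f are arguments so that the measure structure can be
    attached to this constant. *)
Definition density_measure of measurable_fun setT f & (forall x, 0 <= f x)%R :=
  fun A : set (measurableTypeR R) => \int[mu]_(x in A) (f x)%:E.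

Let density0 : density_measure mf f0 set0 = 0.
Proof. exact: integral_set0. Qed.

Let density_ge0 A : 0 <= density_measure mf f0 A.
Proof. by apply: integral_ge0 => x _; rewrite lee_fin. Qed.

Let density_sigma_additive : semi_sigma_additive (density_measure mf f0).
Proof.
move=> A mA tA mUA; rewrite /density_measure ge0_integral_bigcup//.
- apply: is_cvg_ereal_nneg_natsum_cond => n _ _.
  by apply: integral_ge0 => x _; rewrite lee_fin.
- by apply/measurable_EFinP; exact: measurable_funTS.
- by move=> x _; rewrite lee_fin.
Qed.

HB.instance Definition _ := isMeasure.Build _ _ _ (density_measure mf f0)
  density0 density_ge0 density_sigma_additive.
End density_measure.

Section density_from_tail.
Context d (T : measurableType d) (R : realType) (P : probability T R).
Local Notation mu := (@lebesgue_measure R).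
Local Open Scope ereal_scope.

(** Half-lines ]u, +oo[ are stable under intersection and generate the Borel
    sets, so the law of Y, which does not charge the infinite values, and the
    measure of density f agree as soon as they agree on half-lines. *)
Lemma has_density_tail (Y : T -> \bar R) (f : R -> R) :
  measurable_fun setT Y -> measurable_fun setT f -> (forall x, 0 <= f x)%R ->
  P (Y @^-1` [set +oo]) = 0 -> P (Y @^-1` [set -oo]) = 0 ->
  (forall u : R, P [set w | u%:E < Y w] = \int[mu]_(x in `]u, +oo[) (f x)%:E) ->
  has_density P Y f.
Proof.
move=> mY mf f0 Yy YNy Yu; split => // A mA.
have mYpre B : measurable B -> measurable (Y @^-1` B).
  by move=> mB; rewrite -[_ @^-1` _]setTI; exact: mY.
have mfY : measurable_fun setT (fine \o Y) by exact: measurableT_comp.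
have mfYpre (B : set R) : measurable B -> measurable ((fine \o Y) @^-1` B).
  by move=> mB; rewrite -[_ @^-1` _]setTI; exact: mfY.
have mEFin (B : set R) : measurable B -> measurable (EFin @` B).
  exact: measurable_image_EFin.
pose Z := Y @^-1` [set +oo] `|` Y @^-1` [set -oo].
have mZ : measurable Z by apply: measurableU; apply: mYpre; exact: emeasurable_set1.
have Z0 : P Z = 0.
  apply/eqP; rewrite -measure_le0 (le_trans (measureU2 _ _ _))//; last by rewrite [X in X + _]Yy add0e [X in X <= _]YNy.
  - by apply: mYpre; exact: emeasurable_set1.
  - by apply: mYpre; exact: emeasurable_set1.
have nullU B C : measurable B -> measurable C -> B `<=` C `|` Z -> P B <= P C.
  move=> mB mC BC; have h : P B <= P (C `|` Z).
    by rewrite le_measure ?inE//; exact: measurableU.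
  have h2 : P (C `|` Z) <= P C + P Z by exact: measureU2.
  by have := le_trans h h2; rewrite Z0 adde0.
have null_eq B C : measurable B -> measurable C -> B `<=` C `|` Z -> C `<=` B `|` Z -> P B = P C.
  by move=> mB mC BC CB; apply/eqP; rewrite eq_le !nullU.
transitivity (pushforward P (fine \o Y) A).
  apply: null_eq; [exact/mYpre/mEFin|exact: mfYpre| |].
    by move=> w [x Ax /= xY]; left; rewrite /= -xY.
  move=> w /= Aw; case E : (Y w) Aw => [r| |] /= Ar; [left|right; left|right; right] => //=.
  by exists r.
pose g k : set (measurableTypeR R) := `](- k%:R)%R, +oo[%classic.
have tail u : pushforward P (fine \o Y) `]u, +oo[ = P [set w | u%:E < Y w].
  apply: null_eq; first by apply: mfYpre; exact: measurable_itv.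
  - rewrite (_ : [set _ | _] = Y @^-1` `]u%:E, +oo]%classic).
      by apply: mYpre; exact: emeasurable_itv.
    by apply/seteqP; split => w /=; rewrite in_itv/= leey andbT.
  - move=> w /=; rewrite in_itv/= andbT; case E : (Y w) => [r| |] /=; [left|right; left|right; right] => //=.
  - move=> w /=; rewrite in_itv/= andbT; case E : (Y w) => [r| |] /=; [left|right; left|] => //=.
have mfY' : @measurable_fun _ _ T (measurableTypeR R) setT (fine \o Y) := mfY.
pose m1 : {measure set (measurableTypeR R) -> \bar R} :=
  measure_function_pushforward__canonical__measure_function_Measure P mfY'.
pose m2 : {measure set (measurableTypeR R) -> \bar R} := density_measure mf f0.
apply: (@measure_unique _ R (measurableTypeR R) (@RGenOInfty.G R) g _ _ _ _ m1 m2) => //.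
- exact: RGenOInfty.measurableE.
- move=> _ _ [x ->] [y ->]; exists (Num.max x y).
  by apply/seteqP; split => z /=; rewrite !in_itv/= !andbT gt_max => /andP.
- by move=> k; eexists; reflexivity.
- apply/seteqP; split => // x _; exists (Num.bound `|x|%R) => //=.
  have := archi_boundP (normr_ge0 x); rewrite ltr_norml => /andP[+ _].
  by rewrite /g /= in_itv/= andbT.
- by move=> _ [u ->]; exact: (etrans (tail u) (Yu u)).
- move=> k; rewrite [X in X < _](_ : _ = P ((fine \o Y) @^-1` g k))//.
  by rewrite (le_lt_trans (probability_le1 P _)) ?ltry//; apply: mfYpre; exact: measurable_itv.
Qed.

End density_from_tail.

Section erlang_tail.
Context d (T : measurableType d) (R : realType) (P : probability T R).
Variables (alpha beta c : R) (xi : T -> R).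
Hypotheses (beta0 : 0 < beta) (c0 : c != 0).
Hypotheses (xi0 : forall w, 0 <= xi w) (xiS : Stacy P alpha beta c xi).
Local Notation mu := (@lebesgue_measure R).
Local Notation erl n := (erlang_st_pdf n.+1 alpha beta c).

Let mxi : measurable_fun setT xi. Proof. exact: stacy_measurable xiS. Qed.

Let measurable_poisson_tail n : measurable_fun setT (@poisson_tail R n).
Proof.
rewrite /poisson_tail; apply: measurable_sum => k.
by apply: continuous_measurable_fun; exact: continuous_poisson_weight.
Qed.

Lemma erlang_st_pdf_ge0 n t : 0 <= erl n t.
Proof.
rewrite /erlang_st_pdf; case: ifPn => // t0; apply: mulr_ge0.
  rewrite divr_ge0 ?mulr_ge0 ?exprn_ge0 ?(ltW t0) ?(ltW beta0)//.
  exact: ltW (Gamma_gt0 xi0 xiS).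
by apply: Rintegral_ge0 => y _; rewrite mulr_ge0 ?powR_ge0 ?expR_ge0.
Qed.

Lemma exp_st_pdfE : exp_st_pdf alpha beta c = erl 0.
Proof.
apply/funext => t; rewrite /exp_st_pdf /erlang_st_pdf; case: ifP => // _.
by rewrite /= expr0 expr1 mul1r fact0 mul1r.
Qed.

Let measurable_rate n u : measurable_fun setT (fun p : T * R =>
  (\1_(`]u, +oo[%classic : set R) p.2 * (xi p.1 * poisson_weight (xi p.1 * p.2) n))%:E).
Proof.
have mxi1 : measurable_fun setT (fun p : T * R => xi p.1) by exact: measurableT_comp.
apply/measurable_EFinP; apply: measurable_funM.
  by apply: measurableT_comp => //; exact: measurable_indic.
apply: measurable_funM => //.
apply: (measurableT_comp (f := poisson_weight ^~ n)).
  by apply: continuous_measurable_fun; exact: continuous_poisson_weight.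
exact: measurable_funM.
Qed.

Let rate_ge0 n u (p : T * R) : 0 <= u -> (0%:E <=
  (\1_(`]u, +oo[%classic : set R) p.2 * (xi p.1 * poisson_weight (xi p.1 * p.2) n))%R%:E)%E.
Proof.
move=> u0; rewrite lee_fin indicE; have [pu|pu] := pselect (`]u, +oo[%classic p.2).
  rewrite mem_set// mul1r mulr_ge0// poisson_weight_ge0// mulr_ge0//.
  by move: pu; rewrite /= in_itv/= andbT => /ltW; exact: le_trans.
by rewrite memNset// mul0r.
Qed.

(** The factor t^n / n! comes out of the expectation and leaves a Laplace moment
    of order n + 1, that is, a Kratzel function. *)
Lemma erlang_st_pdf_mixture n t : 0 < t ->
  ((erl n t)%:E = \int[P]_w (xi w * poisson_weight (xi w * t) n)%:E)%E.
Proof.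
move=> t0; have := laplace_moment_kratzel beta0 c0 xi0 xiS
  (laplace_moment_ltoo xi0 xiS (ltW t0) (or_intror t0) : (laplace_moment P xi n.+1 t < +oo)%E).
move=> lK.
transitivity ((t ^+ n / n`!%:R)%:E * laplace_moment P xi n.+1 t)%E.
  rewrite lK -EFinM; congr EFin; rewrite /erlang_st_pdf t0 /= !mulrA; congr (_ * _).
  have G0 := Gamma_gt0 xi0 xiS; field.
  by rewrite !gt_eqF ?exprn_gt0// ltr0n fact_gt0.
rewrite /laplace_moment -ge0_integralZl//; last 3 first.
- by apply/measurable_EFinP; exact: (measurable_laplace_moment xiS).
- by move=> w _; rewrite lee_fin mulr_ge0 ?exprn_ge0 ?expR_ge0.
- by rewrite lee_fin divr_ge0// exprn_ge0// ltW.
apply: eq_integral => w _; rewrite -EFinM; congr EFin.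
by rewrite /poisson_weight exprMn exprS (mulrC t); ring.
Qed.

(** Exchange the integrals over t and over xi; the inner one is an Erlang tail,
    except on the null event xi = 0, where the waiting time would be infinite. *)
Lemma erlang_st_pdf_tail n u : 0 <= u ->
  (\int[mu]_(t in `]u, +oo[) (erl n t)%:E = \int[P]_w (poisson_tail n.+1 (xi w * u))%:E)%E.
Proof.
move=> u0; rewrite integral_mkcond.
transitivity (\int[mu]_t \int[P]_w
    (\1_(`]u, +oo[%classic : set R) t * (xi w * poisson_weight (xi w * t) n))%R%:E)%E.
  apply: eq_integral => t _; rewrite patchE.
  have [ut|ut] := pselect (`]u, +oo[%classic t); last first.
    rewrite memNset//; apply/esym/integral0_eq => w _.
    by rewrite indicE memNset// mul0r.
  rewrite mem_set// erlang_st_pdf_mixture; last first.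
    by move: ut; rewrite /= in_itv/= andbT; exact: le_lt_trans.
  by apply: eq_integral => w _; rewrite indicE mem_set// mul1r.
rewrite -(@fubini_tonelli _ _ T (measurableTypeR R) R P mu
  (fun p => (\1_(`]u, +oo[%classic : set R) p.2 * (xi p.1 * poisson_weight (xi p.1 * p.2) n))%R%:E)); last 2 first.
- exact: measurable_rate.
- by move=> p; exact: rate_ge0.
apply: ge0_ae_eq_integral => //.
- exact: (@measurable_fun_fubini_tonelli_F _ _ T (measurableTypeR R) R mu
    (fun p => (\1_(`]u, +oo[%classic : set R) p.2 * (xi p.1 * poisson_weight (xi p.1 * p.2) n))%R%:E)
    (measurable_rate n u) (fun p => rate_ge0 n p u0)).
- by apply/measurable_EFinP; apply: (measurableT_comp (f := poisson_tail n.+1));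
    [exact: measurable_poisson_tail|exact: measurable_funM].
- by move=> w _; apply: integral_ge0 => t _; exact: (rate_ge0 n (w, t)).
- by move=> w _; rewrite lee_fin poisson_tail_ge0// mulr_ge0.
exists (xi @^-1` [set 0%R]); split.
- by rewrite -[_ @^-1` _]setTI; apply: mxi => //; exact: measurable_set1.
- exact: (stacy_null xiS).
move=> w /=; apply: contra_notP => xw _.
have x0 : 0 < xi w by rewrite lt_neqAle xi0 andbT eq_sym; apply/eqP.
rewrite -integral_poisson_weight// [RHS]integral_mkcond; apply: eq_integral => t _.
rewrite patchE indicE; have [ut|ut] := pselect (`]u, +oo[%classic t).
  by rewrite mem_set// mul1r.
by rewrite memNset// mul0r.
Qed.

Lemma measurable_erlang_st_pdf n : measurable_fun setT (erl n).
Proof.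
apply/measurable_EFinP.
have := @measurable_fun_fubini_tonelli_G _ _ T (measurableTypeR R) R P
  (fun p => (\1_(`]0%R, +oo[%classic : set R) p.2 * (xi p.1 * poisson_weight (xi p.1 * p.2) n))%R%:E)
  (measurable_rate n 0) (fun p => rate_ge0 n p (lexx 0)).
congr measurable_fun; apply/funext => t.
rewrite /fubini_G/=.
have [t0|t0] := ltP 0 t.
  rewrite erlang_st_pdf_mixture//; apply: eq_integral => w _.
  by rewrite indicE mem_set ?mul1r//= in_itv/= t0.
rewrite /erlang_st_pdf ltNge t0/=; apply: integral0_eq => w _.
by rewrite indicE memNset ?mul0r//= in_itv/= andbT; apply/negP; rewrite -leNgt.
Qed.

End erlang_tail.

Lemma poisson_tail_le1 (R : realType) n (m : R) : 0 <= m -> poisson_tail n m <= 1.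
Proof.
move=> m0; rewrite -lee_fin -(nneseries_poisson_weight m0).
apply: (le_trans _ (nneseries_lim_ge n (P := xpredT) _)); last first.
  by move=> k _ _; rewrite lee_fin; exact: poisson_weight_ge0.
by rewrite sumEFin lee_fin /poisson_tail big_mkord.
Qed.

Section erlang_law.
Context d (T : measurableType d) (R : realType) (P : probability T R).
Variables (alpha beta c : R) (xi : T -> R).
Hypotheses (beta0 : 0 < beta) (c0 : c != 0).
Hypotheses (xi0 : forall w, 0 <= xi w) (xiS : Stacy P alpha beta c xi).

Let mxi : measurable_fun setT xi. Proof. exact: stacy_measurable xiS. Qed.

Let mtail n u : measurable_fun setT (fun w => poisson_tail n (xi w * u)).
Proof.
apply: (measurableT_comp (f := poisson_tail n)); last exact: measurable_funM.
apply: measurable_sum => k.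
by apply: continuous_measurable_fun; exact: continuous_poisson_weight.
Qed.

(** The tail of Y decreases to the probability that xi = 0, which is 0. *)
Lemma tail_finite n (Y : T -> \bar R) : measurable_fun setT Y ->
  (forall u : R, 0 <= u ->
    P [set w | u%:E < Y w]%E = (\int[P]_w (poisson_tail n.+1 (xi w * u))%:E)%E) ->
  P (Y @^-1` [set +oo%E]) = 0%E.
Proof.
move=> mY Yu.
have mYpre B : measurable B -> measurable (Y @^-1` B).
  by move=> mB; rewrite -[_ @^-1` _]setTI; exact: mY.
have Ylt (u : \bar R) : measurable [set w | (u < Y w)%E].
  rewrite (_ : [set w | _] = Y @^-1` `]u, +oo[%classic); first by apply: mYpre; exact: emeasurable_itv.
  by apply/seteqP; split => w /=; rewrite in_itv/= andbT.
have m0 : measurable (xi @^-1` [set 0]).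
  by rewrite -[_ @^-1` _]setTI; apply: mxi => //; exact: measurable_set1.
(* In the limit only xi = 0 contributes, where the tail is constantly 1. *)
have lim0 : (\int[P]_w (poisson_tail n.+1 (xi w * k%:R))%:E)%E @[k --> \oo] --> 0%E.
  have <- : (\int[P]_w (\1_(xi @^-1` [set 0%R]) w)%:E)%E = 0%E.
    by rewrite integral_indic// setIT; exact: (stacy_null xiS).
  apply: bounded_cvg_integral => //.
  + by move=> k w _; rewrite poisson_tail_ge0 ?poisson_tail_le1// mulr_ge0.
  + move=> w _; have [x0|x0] := eqVneq (xi w) 0.
      rewrite x0 indicE mem_set//; under eq_fun do rewrite mul0r poisson_tail0.
      exact: cvg_cst.
    rewrite indicE memNset; last exact/eqP.
    have xp : 0 < xi w by rewrite lt_neqAle eq_sym x0 xi0.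
    rewrite mulr0n; apply: ((cvg_pinftyP _ _).1 (cvg_poisson_tail n.+1 xp) (fun k => k%:R)).
    exact: cvgr_idn.
apply/eqP; rewrite eq_le measure_ge0 andbT.
apply: (cvge_to_ge lim0); apply: nearW => k; rewrite -Yu//.
apply: le_measure; rewrite ?inE//; first exact: mYpre.
by move=> w /= ->; rewrite ltry.
Qed.

(** Below 0 nothing is left to check, since neither Y nor the density charges
    the negative half-line. *)
Lemma erlang_st_tail n (Y : T -> \bar R) : measurable_fun setT Y ->
  P [set w | Y w < 0]%E = 0%E ->
  (forall u : R, 0 <= u ->
    P [set w | u%:E < Y w]%E = (\int[P]_w (poisson_tail n.+1 (xi w * u))%:E)%E) ->
  Erlang_St P n.+1 alpha beta c Y.
Proof.
move=> mY Y0 Yu.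
have mYpre B : measurable B -> measurable (Y @^-1` B).
  by move=> mB; rewrite -[_ @^-1` _]setTI; exact: mY.
have Ylt (u : \bar R) : measurable [set w | (u < Y w)%E].
  rewrite (_ : [set w | _] = Y @^-1` `]u, +oo[%classic); first by apply: mYpre; exact: emeasurable_itv.
  by apply/seteqP; split => w /=; rewrite in_itv/= andbT.
have Ygt (u : \bar R) : measurable [set w | (Y w < u)%E].
  rewrite (_ : [set w | _] = Y @^-1` `]-oo, u[%classic); first by apply: mYpre; exact: emeasurable_itv.
  by apply/seteqP; split => w /=; rewrite in_itv.
have null (A : set T) B : measurable A -> measurable B -> A `<=` B -> P B = 0%E -> P A = 0%E.
  move=> mA mB AB PB; apply/eqP; rewrite eq_le measure_ge0 andbT -PB.
  by apply: le_measure; rewrite ?inE.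
apply: has_density_tail => //.
- exact: (measurable_erlang_st_pdf beta0 c0 xi0 xiS).
- by move=> x; exact: (erlang_st_pdf_ge0 beta0 xi0 xiS).
- exact: (tail_finite mY Yu).
- apply: (null _ [set w | (Y w < 0)%E]) => //; last by move=> w /= ->; exact: ltNye.
  exact: mYpre.
move=> u; have [u0|u0] := leP 0 u.
  by rewrite Yu// -(erlang_st_pdf_tail beta0 c0 xi0 xiS).
transitivity (1%:E : \bar R).
  rewrite -[X in P X]setCK probability_setC; last by apply: measurableC.
  rewrite (null _ _ _ (Ygt 0%E)) ?sube0//; first by apply: measurableC.
  move=> w /=; move/negP; rewrite -leNgt; move/le_lt_trans; apply.
  by rewrite lte_fin.
transitivity (\int[@lebesgue_measure R]_(t in `]0%R, +oo[) (erlang_st_pdf n.+1 alpha beta c t)%:E)%E.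
  rewrite (erlang_st_pdf_tail beta0 c0 xi0 xiS)//.
  under eq_integral do rewrite mulr0 poisson_tail0.
  rewrite integral_cst// [X in (_ * X)%E](_ : _ = 1%E) ?mule1//; exact: probability_setT.
rewrite [LHS]integral_mkcond [RHS]integral_mkcond; apply: eq_integral => t _.
rewrite !patchE !mem_setE !in_itv/= !andbT; have [t0|t0] := ltP 0 t.
  by rewrite (lt_trans u0 t0).
by rewrite /erlang_st_pdf (ltNge 0 t) t0/=; case: ifP.
Qed.

Lemma exp_st_tail (Y : T -> \bar R) : measurable_fun setT Y ->
  P [set w | Y w < 0]%E = 0%E ->
  (forall u : R, 0 <= u ->
    P [set w | u%:E < Y w]%E = (\int[P]_w (expR (- (xi w * u)))%:E)%E) ->
  Exp_St P alpha beta c Y.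
Proof.
move=> mY Y0 Yu; rewrite /Exp_St exp_st_pdfE; apply: erlang_st_tail => // u u0.
by rewrite Yu//; apply: eq_integral => w _; rewrite poisson_tail1.
Qed.

End erlang_law.

(** * Waiting after a grid time *)

Section past_events.
Context d (T : measurableType d) (R : realType) (P : probability T R).
Variables (xi : T -> R) (M : R -> T -> nat).
Hypotheses (mxi : measurable_fun setT xi) (xi0 : forall w, 0 <= xi w).
Hypothesis M0 : forall w, M 0 w = 0%N.
Hypothesis Mnd : forall w s u, 0 <= s -> s <= u -> (M s w <= M u w)%N.
Hypothesis Mincr : mixed_increments P xi M.

Definition quiet s v := [set w | M (s + v) w = M s w].

Let decay v w : \bar R := (expR (- (v * xi w)))%:E.

(** When E is a part of B, this says that E has conditional probability exp (- v
    xi) given xi and B. *)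
Definition decays v (B E : set T) := [/\ measurable B, measurable E &
  forall A, measurable A ->
    P (E `&` xi @^-1` A) = (\int[P]_(w in B `&` xi @^-1` A) (expR (- (v * xi w)))%:E)%E].

Let mpre A : measurable A -> measurable (xi @^-1` A).
Proof. by move=> mA; rewrite -[_ @^-1` _]setTI; exact: mxi. Qed.

Lemma measurable_quiet s v : 0 <= s -> 0 <= v -> measurable (quiet s v).
Proof.
move=> s0 v0; pose u i : R := if i is 0%N then s else s + v.
have u0 i : 0 <= u i by case: i => //= _; exact: addr_ge0.
have /(_ _)[|+ _] := @Mincr 1 u (fun=> 0%N) u0; first by case=> //= _; rewrite lerDl.
congr measurable; apply/seteqP; split => w /=.
  move=> /(_ 0%N isT)/eqP; rewrite subn_eq0 => h; apply/eqP.
  by rewrite /quiet/= eqn_leq h Mnd// lerDl.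
by rewrite /quiet/= => e [|//] _; rewrite /= e subnn.
Qed.

Let cylinder n (u : nat -> R) (k : nat -> nat) : set T :=
  [set w | forall i, (i < n)%N -> (M (u i.+1) w - M (u i) w)%N = k i].

(** An additional increment equal to 0 multiplies the conditional probability by
    exp (- v xi). *)
Lemma quiet_after_cylinder n (u : nat -> R) (k : nat -> nat) v :
  (forall i, 0 <= u i) -> (forall i, (i < n)%N -> u i <= u i.+1) -> 0 <= v ->
  decays v (cylinder n u k) (cylinder n u k `&` quiet (u n) v).
Proof.
move=> u0 nd v0; have Ck := @Mincr n u k u0 nd; split; first exact: Ck.1.
  by apply: measurableI; [exact: Ck.1|exact: measurable_quiet].
move=> A mA.
pose u' i := if (i <= n)%N then u i else u n + v.
pose k' i := if (i < n)%N then k i else 0%N.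
have u'0 i : 0 <= u' i by rewrite /u'; case: ifP => // _; exact: addr_ge0.
have nd' i : (i < n.+1)%N -> u' i <= u' i.+1.
  rewrite ltnS /u' leq_eqVlt => /orP[/eqP->|iln].
    by rewrite eqxx ltnn lerDl.
  by rewrite iln orbT nd.
have [_ /(_ _ mA)] := @Mincr n.+1 u' k' u'0 nd'.
rewrite (_ : [set w | _] = cylinder n u k `&` quiet (u n) v); last first.
  apply/seteqP; split => w /=.
    move=> h; split.
      by move=> i iln; have := h i (ltnW iln); rewrite /u' /k' iln (ltnW iln).
    have := h n (ltnSn n); rewrite /u' /k' ltnn leqnn => /eqP.
    rewrite subn_eq0 => le; apply/eqP; by rewrite eqn_leq le Mnd// lerDl.
  move=> [h q] i; rewrite ltnS leq_eqVlt => /orP[/eqP->|iln].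
    by rewrite /u' /k' ltnn leqnn q subnn.
  by rewrite /u' /k' iln (ltnW iln) h.
move=> ->.
have mexp : measurable_fun setT (fun x : R => expR (- (v * x))).
  by apply: measurableT_comp => //; apply: measurableT_comp => //; exact: measurable_funM.
pose h (x : R) := ((\1_A x)%:E * (expR (- (v * x)))%:E)%E.
have mh : measurable_fun setT h.
  by apply: emeasurable_funM; apply/measurable_EFinP => //; exact: measurable_indic.
have mw : measurable_fun setT (increment_weight n u k).
  by apply: continuous_measurable_fun; exact: continuous_increment_weight.
have w0 (x : R) : 0 <= x -> 0 <= increment_weight n u k x.
  move=> x0; apply: prodr_ge0 => i _; apply: poisson_weight_ge0.
  by rewrite mulr_ge0// subr_ge0 nd.
have h0 x : (0 <= h x)%E by rewrite mule_ge0// lee_fin ?expR_ge0//.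
have := cond_probability_integral mxi xi0 Ck mw w0 mh h0.
have -> : (\int[P]_(w in cylinder n u k) h (xi w) =
   \int[P]_(w in cylinder n u k `&` xi @^-1` A) decay v w)%E.
  rewrite [RHS]integral_mkcondr; apply: eq_integral => w _.
  rewrite /h /decay patchE indicE; have [Aw|Aw] := pselect (A (xi w)).
    by rewrite !mem_set// mul1e.
  by rewrite !memNset// mul0e.
move=> ->; rewrite [LHS]integral_mkcond; apply: eq_integral => w _.
rewrite patchE /h indicE; have [Aw|Aw] := pselect (A (xi w)).
  rewrite !mem_set// mul1e -EFinM; congr EFin.
  rewrite /increment_weight big_ord_recr/= /u' ltnn leqnn /k' ltnn (addrC (u n)) addrK mulrC.
  congr (_ * _); first by rewrite /poisson_weight expr0 divr1 mul1r mulrC.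
  by apply: eq_bigr => i _; rewrite ltn_ord (ltnW (ltn_ord i)).
by rewrite !memNset// !mul0e.
Qed.

Lemma decays_bigcup v (B E : nat -> set T) :
  (forall n, decays v (B n) (E n)) -> (forall n, E n `<=` B n) -> trivIset setT B ->
  decays v (\bigcup_n B n) (\bigcup_n E n).
Proof.
move=> BE EB tB; split.
- by apply: bigcup_measurable => n _; have [] := BE n.
- by apply: bigcup_measurable => n _; have [] := BE n.
move=> A mA; rewrite !setI_bigcupl measure_bigcup//; last 2 first.
- by move=> n _; apply: measurableI; [have [] := BE n|exact: mpre].
- move=> i j _ _ [w [[Ei _] [Ej _]]]; apply: (tB i j) => //.
  by exists w; split; exact: EB.
rewrite ge0_integral_bigcup//=; last 3 first.
- by move=> n; apply: measurableI; [have [] := BE n|exact: mpre].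
- apply: measurable_funTS; apply/measurable_EFinP; apply: measurableT_comp => //.
  by apply: measurableT_comp => //; exact: measurable_funM.
- by move=> i j _ _ [w [[Bi _] [Bj _]]]; apply: (tB i j) => //; exists w.
rewrite (eq_eseriesl (Q := xpredT)); last by move=> n; rewrite in_setT.
by apply: eq_eseriesr => n _; have [_ _ ->] := BE n.
Qed.

Lemma decays0 v : decays v set0 set0.
Proof. by split => // A mA; rewrite set0I measure0 integral_set0. Qed.

(** The past of the grid time m h is described through paths rather than as a
    sigma-algebra: events defined by cases on the path are then seen at once to
    belong to it. *)
Definition grid_past h m (B : set T) := forall w w',
  (forall l, (l <= m)%N -> M (l%:R * h) w = M (l%:R * h) w') -> B w -> B w'.

(** There are countably many possible vectors of increments, and an event
    decided by them is the disjoint union of the corresponding cylinders. *)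
Lemma decays_past h m B v : 0 <= h -> 0 <= v -> grid_past h m B ->
  decays v B (B `&` quiet (m%:R * h) v).
Proof.
move=> h0 v0 Bpast; pose u i : R := i%:R * h.
have u0 i : 0 <= u i by rewrite mulr_ge0.
have nd i : u i <= u i.+1 by rewrite ler_wpM2r// ler_nat.
(* The whole vector of increments is encoded as one natural number, to have a
   partition indexed by nat. *)
pose q w := pickle [seq (M (u i.+1) w - M (u i) w)%N | i <- iota 0 m].
have qP w w' : q w = q w' <-> forall i, (i < m)%N ->
    (M (u i.+1) w' - M (u i) w')%N = (M (u i.+1) w - M (u i) w)%N.
  split => [/(pcan_inj pickleK)/eq_in_map e i im|e].
    by rewrite e// mem_iota.
  by congr pickle; apply/eq_in_map => i; rewrite mem_iota => /= im; rewrite e.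
have qM w w' : q w = q w' -> forall l, (l <= m)%N -> M (u l) w = M (u l) w'.
  move=> /qP e; elim => [_|l IHl lm]; first by rewrite /u mul0r !M0.
  by rewrite -(subnK (Mnd w (u0 l) (nd l))) -(subnK (Mnd w' (u0 l) (nd l))) e// IHl// ltnW.
have BE : B = \bigcup_n (B `&` [set w | q w = n]).
  by apply/seteqP; split => [w Bw|w [n _ []//]]; exists (q w).
rewrite BE setI_bigcupl; apply: decays_bigcup.
- move=> n; have [[w0 [Bw0 qw0]]|no] := pselect (exists w, B w /\ q w = n); last first.
    have -> : B `&` [set w | q w = n] = set0.
      by apply/seteqP; split => w //= [Bw qw]; apply: no; exists w.
    by rewrite set0I; exact: decays0.
  have -> : B `&` [set w | q w = n] = cylinder m u (fun i => (M (u i.+1) w0 - M (u i) w0)%N).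
    apply/seteqP; split => w /=.
      by move=> [_]; rewrite -qw0 => /esym/qP.
    move=> /qP e; split; last by rewrite -e.
    by apply: Bpast Bw0 => l lm; exact: (qM _ _ e).
  exact: quiet_after_cylinder.
- by move=> n w [].
- by move=> i j _ _ [w [[_ /= <-] [_ /= <-]]].
Qed.

(** A strong Markov property for random times with values in a grid: B m is the
    event that the time is m h. *)
Lemma decays_grid h (B : nat -> set T) v : 0 <= h -> 0 <= v ->
  (forall m, grid_past h m (B m)) -> trivIset setT B ->
  decays v (\bigcup_m B m) (\bigcup_m (B m `&` quiet (m%:R * h) v)).
Proof.
move=> h0 v0 Bp tB; by apply: decays_bigcup => // m; exact: decays_past.
Qed.

End past_events.

Section decay_limit.
Context d (T : measurableType d) (R : realType) (P : probability T R).
Variable xi : T -> R.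
Hypotheses (mxi : measurable_fun setT xi) (xi0 : forall w, 0 <= xi w).

Lemma decays_cvg v (B_ E_ : nat -> set T) (B E : set T) : 0 <= v ->
  (forall k, decays P xi v (B_ k) (E_ k)) ->
  (forall w, \forall k \near \oo, B_ k w <-> B w) ->
  (forall w, \forall k \near \oo, E_ k w <-> E w) -> decays P xi v B E.
Proof.
move=> v0 BE cB cE.
have mB_ k : measurable (B_ k) by have [] := BE k.
have mE_ k : measurable (E_ k) by have [] := BE k.
have mB := eventually_eq_measurable mB_ cB.
have mE := eventually_eq_measurable mE_ cE.
split => // A mA; have mxA : measurable (xi @^-1` A).
  by rewrite -[_ @^-1` _]setTI; exact: mxi.
have c1 : P (E_ k `&` xi @^-1` A) @[k --> \oo] --> P (E `&` xi @^-1` A).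
  apply: eventually_eq_cvg_measure => [k|w]; first exact: measurableI.
  by apply: filterS (cE w) => k [h1 h2]; split=> -[? ?]; split; auto.
have mexp : measurable_fun setT (fun w => expR (- (v * xi w))).
  by apply: measurableT_comp => //; apply: measurableT_comp => //; exact: measurable_funM.
have indE C : (\int[P]_(w in C `&` xi @^-1` A) (expR (- (v * xi w)))%:E =
    \int[P]_(w in xi @^-1` A) (\1_C w * expR (- (v * xi w)))%:E)%E.
  rewrite setIC [LHS]integral_mkcondr; apply: eq_integral => w _.
  rewrite patchE indicE; have [Cw|Cw] := pselect (C w).
    by rewrite !mem_set// mul1r.
  by rewrite !memNset// mul0r.
have c2 : P (E_ k `&` xi @^-1` A) @[k --> \oo] -->
    (\int[P]_(w in B `&` xi @^-1` A) (expR (- (v * xi w)))%:E)%E.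
  rewrite (eq_cvg _ _ (fun k => (let: And3 _ _ h := BE k in h) A mA)).
  rewrite indE; under eq_fun do rewrite indE.
  apply: bounded_cvg_integral => //.
  - move=> k; apply: measurable_funTS; exact: measurable_funM.
  - move=> k w _; rewrite indicE; case: (_ \in _); rewrite ?mul0r ?lexx ?ler01//.
    by rewrite mul1r expR_ge0 expR_le1 oppr_le0 mulr_ge0.
  - move=> w _; apply: cvgMl; apply: cvg_near_cst; apply: filterS (cB w) => k [h1 h2].
    rewrite !indicE; have [Bw|Bw] := pselect (B w); first by rewrite !mem_set//; exact: h2.
    by rewrite !memNset// => /h1.
exact: (cvg_unique _ c1 c2).
Qed.

End decay_limit.

Section grid_arrivals.
Context d (T : measurableType d) (R : realType).
Variables (M : R -> T -> nat) (S : nat -> T -> \bar R).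
Hypothesis Mnd : forall w s u, 0 <= s -> s <= u -> (M s w <= M u w)%N.
Hypothesis S0 : forall n w, (0 <= S n w)%E.
Hypothesis SM : forall n w (u : R), 0 <= u -> (S n w <= u%:E)%E <-> (n <= M u w)%N.

(** Asking for equality at m h discards the case where i is skipped because one
    cell of the grid contains several events. *)
Definition first_grid h i m : set T :=
  [set w | (forall l, (l < m)%N -> (M (l%:R * h) w < i)%N) /\ M (m%:R * h) w = i].

(** The approximation of [wait] that can be observed on the grid of mesh h. *)
Definition grid_wait h i v := \bigcup_m (first_grid h i m `&` quiet M (m%:R * h) v).

(** For v = 0: the i-th event occurs, and the next one is not simultaneous. *)
Definition wait i v := [set w | (S i w < +oo)%E /\ (S i w + v%:E < S i.+1 w)%E].

Lemma first_grid_past h i m : grid_past M h m (first_grid h i m).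
Proof.
move=> w w' ww' [lt eq]; split => [l lm|]; last by rewrite -ww'.
by rewrite -ww' ?lt// ltnW.
Qed.

Lemma trivIset_first_grid h i : trivIset setT (first_grid h i).
Proof.
move=> m m' _ _ [w [[lt eq] [lt' eq']]].
case: (ltngtP m m') => // mm'; first by have := lt' _ mm'; rewrite eq ltnn.
by have := lt _ mm'; rewrite eq' ltnn.
Qed.

Lemma grid_wait0 h i : grid_wait h i 0 = \bigcup_m first_grid h i m.
Proof.
by apply: eq_bigcupr => m _; apply/seteqP; split => [w []//|w fw]; split => //;
  rewrite /quiet/= addr0.
Qed.

Let hk k : R := k.+1%:R^-1.

(** r is the first grid time not before the i-th event. *)
Lemma grid_waitP h i w (s : R) : 0 < h -> S i w = s%:E ->
  exists2 r, s <= r < s + h &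
    forall v, 0 <= v -> grid_wait h i v w <-> ((r + v)%:E < S i.+1 w)%E.
Proof.
move=> h0 Sis; have s0 : 0 <= s by have := S0 i w; rewrite Sis lee_fin.
have iM (m : nat) : (i <= M (m%:R * h) w)%N <-> s <= m%:R * h.
  by rewrite -SM ?mulr_ge0 ?(ltW h0)// Sis lee_fin.
have ex : exists m, (i <= M (m%:R * h) w)%N.
  exists (Num.truncn (s / h)).+1; apply/iM.
  by rewrite -ler_pdivrMr// ltW// truncnS_gt.
case: (ex_minnP ex) => m im mmin; exists (m%:R * h).
  apply/andP; split; first exact/iM.
  case: m im mmin => [|m] im mmin; first by rewrite mul0r ltr_wpDl.
  have : ~ s <= m%:R * h.
    by move/iM => /mmin; rewrite ltnn.
  move/negP; rewrite -ltNge => h1.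
  by rewrite -addn1 natrD mulrDl mul1r ltrD2r.
move=> v v0.
have mh0 : 0 <= m%:R * h by rewrite mulr_ge0// ltW.
have mv0 : 0 <= m%:R * h + v by exact: addr_ge0.
have M1 : (M (m%:R * h) w <= M (m%:R * h + v) w)%N by rewrite Mnd// lerDl.
rewrite ltNge; split => [[m' _ [[lt eq] q]]|/negP].
  have mm' : m = m'.
    apply/eqP; rewrite eqn_leq mmin ?eq//= leqNgt; apply/negP => /lt.
    by rewrite ltnNge im.
  by apply/negP => /(SM _ _ mv0); rewrite mm' q eq ltnn.
move=> nS; have Mi : (M (m%:R * h + v) w <= i)%N.
  by rewrite leqNgt; apply/negP => /(SM _ _ mv0).
exists m => //; split; last first.
  by apply/eqP; rewrite eqn_leq M1 (leq_trans Mi).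
split; last by apply/eqP; rewrite eqn_leq im (leq_trans M1).
move=> l lm; rewrite ltnNge; apply/negP => /mmin; by rewrite leqNgt lm.
Qed.

(** When the (i+1)-st event comes strictly later than v after the i-th one, a
    sufficiently fine grid leaves room for the rounding; otherwise no grid does,
    because rounding is upwards. *)
Lemma near_grid_wait i v w : 0 <= v ->
  \forall k \near \oo, grid_wait (hk k) i v w <-> wait i v w.
Proof.
move=> v0; have [Sy|Sy] := eqVneq (S i w) +oo%E.
  apply: nearW => k; split => [[m _ [[_ eq] _]]|[]]; last by rewrite Sy ltxx.
  have : (i <= M (m%:R * hk k) w)%N by rewrite eq.
  have mk0 : 0 <= m%:R * hk k by rewrite mulr_ge0// invr_ge0.
  by move/(SM _ _ mk0); rewrite Sy leye_eq.
have Sfin : S i w \is a fin_num by rewrite ge0_fin_numE// ltey.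
have h0 k : 0 < hk k by rewrite invr_gt0.
have Si := esym (fineK Sfin); set s := fine _ in Si.
have [Sv|Sv] := ltP (S i w + v%:E)%E (S i.+1 w); last first.
  apply: nearW => k; have [r /andP[sr _] ->//] := grid_waitP (h0 k) Si.
  split => [|[_]]; last by rewrite ltNge Sv.
  rewrite ltNge; move/negP; case; apply: le_trans Sv _.
  by rewrite Si -EFinD lee_fin lerD2r.
have [h hp sh] : exists2 h, 0 < h & ((s + h + v)%:E <= S i.+1 w)%E.
  move: Sv; rewrite Si -EFinD; case: (S i.+1 w) => [x|_|//]; last by exists 1 => //; rewrite leey.
  rewrite lte_fin => lt; exists (x - (s + v)); first by rewrite subr_gt0.
  by rewrite lee_fin; lra.
near=> k; have [r /andP[_ rs] ->//] := grid_waitP (h0 k) Si.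
split => _; first by split => //; rewrite ltey.
apply: lt_le_trans sh; rewrite lte_fin ltrD2r (lt_trans rs)// ltrD2l.
near: k; exact: near_infty_natSinv_lt (PosNum hp).
Unshelve. all: by end_near. Qed.

End grid_arrivals.

(** * Simultaneous events *)

Section double_jumps.
Context d (T : measurableType d) (R : realType) (P : probability T R).
Variables (xi : T -> R) (M : R -> T -> nat).
Hypotheses (mxi : measurable_fun setT xi) (xi0 : forall w, 0 <= xi w).
Hypothesis Mincr : mixed_increments P xi M.

Let mpre A : measurable A -> measurable (xi @^-1` A).
Proof. by move=> mA; rewrite -[_ @^-1` _]setTI; exact: mxi. Qed.

Lemma cond_probability_increment s h k : 0 <= s -> 0 <= h ->
  cond_probability P xi [set w | (M (s + h) w - M s w)%N = k]
    (fun x => poisson_weight (x * h) k).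
Proof.
move=> s0 h0; pose u i : R := if i is 0%N then s else s + h.
have u0 i : 0 <= u i by case: i => //= _; exact: addr_ge0.
have nd i : (i < 1)%N -> u i <= u i.+1 by case: i => //= _; rewrite lerDl.
apply: (eq_cond_probability xi0 _ _ (Mincr (fun=> k) u0 nd)).
  by apply/seteqP; split => w /=; [move=> /(_ 0%N isT)|move=> e [|]].
by move=> x x0; rewrite /increment_weight big_ord1/= addrC addKr.
Qed.

Lemma poisson_tail2_ge (m : R) : 0 <= m -> 1 - m ^+ 2 <= poisson_tail 2 m.
Proof.
move=> m0; rewrite /poisson_tail !big_ord_recl big_ord0/= /poisson_weight /=.
rewrite expr0 expr1 fact0 /bump/= addn0 !divr1 addr0 -mulrDl.
have := expR_ge1Dx (- m).
rewrite -subr_ge0 => h; rewrite -subr_ge0.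
have -> : (1 + m) * expR (- m) - (1 - m ^+ 2) = (1 + m) * (expR (- m) - (1 - m)) by ring.
by rewrite mulr_ge0// addr_ge0.
Qed.

Let jump2 s h := [set w | (2 <= M (s + h) w - M s w)%N].

(** Two or more events in an interval of length h have conditional probability
    at most (h xi)^2, and xi is bounded by b on the event considered. *)
Lemma double_jump_le s h b : 0 <= s -> 0 <= h -> 0 <= b ->
  measurable (jump2 s h) /\
  (P (jump2 s h `&` xi @^-1` `[0%R, b]) <= ((b * h) ^+ 2)%:E)%E.
Proof.
move=> s0 h0 b0; set E := fun k => [set w | (M (s + h) w - M s w)%N = k].
have CE k : cond_probability P xi (E k) (fun x => poisson_weight (x * h) k).
  exact: cond_probability_increment.
have mE k : measurable (E k) by have [] := CE k.
have jE : jump2 s h = ~` (E 0%N `|` E 1%N).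
  rewrite /jump2 /E; apply/seteqP; split => w /=; case: (_ - _)%N => [|[|n]]//.
  - by move=> _ [].
  - by move=> []; left.
  - by move=> []; right.
have mj : measurable (jump2 s h) by rewrite jE; apply: measurableC; exact: measurableU.
split => //.
set A := xi @^-1` _.
have mA : measurable A by apply: mpre.
have mw k : measurable_fun setT (fun w => poisson_weight (xi w * h) k).
  apply: (measurableT_comp (f := poisson_weight ^~ k)); last exact: measurable_funM.
  by apply: continuous_measurable_fun; exact: continuous_poisson_weight.
have PA : P A = (P (jump2 s h `&` A) + \int[P]_(w in A) (poisson_tail 2 (xi w * h))%:E)%E.
  have -> : (\int[P]_(w in A) (poisson_tail 2 (xi w * h))%:E = P ((E 0%N `|` E 1%N) `&` A))%E.
    rewrite setIUl measureU//; last 3 first.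
    - exact: measurableI.
    - exact: measurableI.
    - by apply/seteqP; split => // w [[]]; rewrite /E/= => -> _ [].
    transitivity (\int[P]_(w in A) (poisson_weight (xi w * h) 0)%:E +
        \int[P]_(w in A) (poisson_weight (xi w * h) 1)%:E)%E; last first.
      by congr (_ + _)%E; apply/esym; [exact: (CE 0%N).2|exact: (CE 1%N).2].
    rewrite -ge0_integralD//; last 4 first.
    - by move=> w _; rewrite lee_fin poisson_weight_ge0// mulr_ge0.
    - by apply: measurable_funTS; apply/measurable_EFinP.
    - by move=> w _; rewrite lee_fin poisson_weight_ge0// mulr_ge0.
    - by apply: measurable_funTS; apply/measurable_EFinP.
    apply: eq_integral => w _; rewrite -EFinD /poisson_tail !big_ord_recl big_ord0.
    by rewrite addr0.
  rewrite jE -measureU; last 3 first.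
  - by apply: measurableI => //; rewrite -jE.
  - by apply: measurableI => //; exact: measurableU.
  - by rewrite setIACA setICl set0I.
  by rewrite -setIUl setUCl setTI.
have le : (P A <= \int[P]_(w in A) (poisson_tail 2 (xi w * h))%:E + ((b * h) ^+ 2)%:E)%E.
  have -> : P A = (\int[P]_(w in A) (cst 1%E w))%E by rewrite integral_cst// mul1e.
  apply: (@le_trans _ _ (\int[P]_(w in A)
      ((poisson_tail 2 (xi w * h))%:E + ((b * h) ^+ 2)%:E))%E).
    apply: ge0_le_integral => //.
    - apply: measurable_funTS; apply/measurable_EFinP; apply: measurable_funD => //.
      by apply: measurable_sum => k; exact: mw.
    - move=> w; rewrite /A/= in_itv/= => /andP[x0 xb]; rewrite -EFinD lee_fin -lerBlDr.
      rewrite (le_trans _ (poisson_tail2_ge _)) ?mulr_ge0//.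
      by rewrite lerB// ler_pXn2r ?nnegrE ?mulr_ge0// ler_wpM2r.
  rewrite ge0_integralD//; last 3 first.
  - by move=> w _; rewrite lee_fin poisson_tail_ge0// mulr_ge0.
  - by apply: measurable_funTS; apply/measurable_EFinP; apply: measurable_sum => k; exact: mw.
  - by move=> w _; rewrite lee_fin sqr_ge0.
  rewrite leeD2l// integral_cst// -[leRHS]mule1 lee_wpmul2l ?lee_fin ?sqr_ge0//.
  exact: probability_le1.
have fin : (\int[P]_(w in A) (poisson_tail 2 (xi w * h))%:E)%E \is a fin_num.
  rewrite ge0_fin_numE; last first.
    by apply: integral_ge0 => w _; rewrite lee_fin poisson_tail_ge0// mulr_ge0.
  apply: (@le_lt_trans _ _ (P A)); first by rewrite [leRHS]PA leeDr// measure_ge0.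
  by rewrite (le_lt_trans (probability_le1 P mA))// ltry.
rewrite -(leeD2rE _ _ fin) [leRHS]addeC; apply: le_trans le; by rewrite [leRHS]PA.
Qed.

End double_jumps.

(** * Laws of the event times and of the waits *)

Section arrival_law.
Context d (T : measurableType d) (R : realType) (P : probability T R).
Variables (alpha beta c : R) (xi : T -> R).
Variables (M : R -> T -> nat) (S : nat -> T -> \bar R).
Hypotheses (beta0 : 0 < beta) (c0 : c != 0).
Hypotheses (xi0 : forall w, 0 <= xi w) (xiS : Stacy P alpha beta c xi).
Hypothesis M0 : forall w, M 0 w = 0%N.
Hypothesis mM : forall s, 0 <= s -> measurable_fun setT (M s).
Hypothesis Mnd : forall w s u, 0 <= s -> s <= u -> (M s w <= M u w)%N.
Hypothesis Mincr : mixed_increments P xi M.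
Hypothesis S0 : forall n w, (0 <= S n w)%E.
Hypothesis SM : forall n w (u : R), 0 <= u -> (S n w <= u%:E)%E <-> (n <= M u w)%N.

Let mxi : measurable_fun setT xi. Proof. exact: stacy_measurable xiS. Qed.

Let mpre A : measurable A -> measurable (xi @^-1` A).
Proof. by move=> mA; rewrite -[_ @^-1` _]setTI; exact: mxi. Qed.

Let Sgt n (u : R) : 0 <= u -> [set w | (u%:E < S n w)%E] = [set w | (M u w < n)%N].
Proof.
move=> u0; apply/seteqP; split => w /=; rewrite !ltNge.
  by move=> h; rewrite ltnNge; apply: contraNN h => /(SM _ _ u0).
by move=> h; apply: contraTN h => /(SM _ _ u0); rewrite -leqNgt.
Qed.

Let mMlt n (u : R) : 0 <= u -> measurable [set w | (M u w < n)%N].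
Proof. by move=> u0; rewrite -[X in measurable X]setTI; exact: (mM u0 _ (Y := [set k | (k < n)%N])). Qed.

Lemma measurable_arrival n : measurable_fun setT (S n).
Proof.
apply: (measurability _ (ErealGenOInfty.measurableE R)) => _ [_ [r ->] <-].
rewrite setTI; have -> : S n @^-1` `]r%:E, +oo[%classic = [set w | (r%:E < S n w)%E].
  by apply/seteqP; split => w /=; rewrite in_itv/= andbT.
have [r0|r0] := leP 0 r; first by rewrite Sgt//; exact: mMlt.
rewrite (_ : [set w | _] = setT)//; apply/seteqP; split => // w _ /=.
by apply: lt_le_trans (S0 n w); rewrite lte_fin.
Qed.

(** The n-th event occurs after u exactly when fewer than n events have occurred
    at time u. *)
Lemma arrival_tail n (u : R) : 0 <= u ->
  P [set w | (u%:E < S n w)%E] = (\int[P]_w (poisson_tail n (xi w * u))%:E)%E.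
Proof.
move=> u0; rewrite Sgt//; elim: n => [|n IHn].
  rewrite (_ : [set w | _] = set0) ?measure0; last by apply/seteqP; split.
  by apply/esym/integral0_eq => w _; rewrite /poisson_tail big_ord0.
have Cn := cond_probability_count xi0 M0 Mincr n u0.
have -> : [set w | (M u w < n.+1)%N] = [set w | (M u w < n)%N] `|` [set w | M u w = n].
  apply/seteqP; split => w /=; rewrite ltnS.
    by rewrite leq_eqVlt => /orP[/eqP|]; [right|left].
  by move=> [/ltnW//|->].
rewrite measureU; last 3 first.
- exact: mMlt.
- exact: Cn.1.
- by apply/seteqP; split => // w [/= + e]; rewrite e ltnn.
have mw k : measurable_fun setT (fun w => poisson_weight (xi w * u) k).
  apply: (measurableT_comp (f := poisson_weight ^~ k)).
    by apply: continuous_measurable_fun; exact: continuous_poisson_weight.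
  exact: measurable_funM.
transitivity (\int[P]_w (poisson_tail n (xi w * u))%:E +
    \int[P]_w (poisson_weight (xi w * u) n)%:E)%E.
  by congr (_ + _)%E; [exact: IHn|exact: (cond_probability_total Cn)].
rewrite -ge0_integralD//; last 4 first.
- by move=> w _; rewrite lee_fin poisson_tail_ge0// mulr_ge0.
- apply/measurable_EFinP; apply: measurable_sum => k; exact: mw.
- by move=> w _; rewrite lee_fin poisson_weight_ge0// mulr_ge0.
- by apply/measurable_EFinP; exact: mw.
by apply: eq_integral => w _; rewrite -EFinD /poisson_tail big_ord_recr.
Qed.

Lemma arrival_Erlang_St n : (0 < n)%N -> Erlang_St P n alpha beta c (S n).
Proof.
case: n => // n _; apply: (erlang_st_tail beta0 c0 xi0 xiS).
- exact: measurable_arrival.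
- rewrite (_ : [set w | _] = set0) ?measure0//; apply/seteqP; split => // w /=.
  by rewrite ltNge S0.
- by move=> u u0; exact: arrival_tail.
Qed.

Let hk k : R := k.+1%:R^-1.
Let hk0 k : 0 <= hk k. Proof. by rewrite invr_ge0. Qed.

Lemma decays_wait i v : 0 <= v -> decays P xi v (wait S i 0) (wait S i v).
Proof.
move=> v0; apply: (@decays_cvg _ _ _ _ _ mxi xi0 v (fun k => grid_wait M (hk k) i 0)
  (fun k => grid_wait M (hk k) i v)) => //.
- move=> k; rewrite grid_wait0; apply: (decays_grid mxi xi0 M0 Mnd Mincr) => //.
    by move=> m; exact: first_grid_past.
  exact: trivIset_first_grid.
- by move=> w; exact: near_grid_wait.
- by move=> w; exact: near_grid_wait.
Qed.

Lemma measurable_wait i v : 0 <= v -> measurable (wait S i v).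
Proof. by move=> v0; have [] := decays_wait i v0. Qed.

Let arrival_ltoo i : P [set w | S i w = +oo%E] = 0%E.
Proof.
case: i => [|i].
  rewrite (_ : [set w | _] = set0) ?measure0//; apply/seteqP; split => // w /= Sy.
  by have /SM := leq0n (M 0 w); rewrite Sy leye_eq => /(_ (lexx 0)).
apply: (tail_finite xi0 xiS (measurable_arrival i.+1)) => u u0.
exact: arrival_tail.
Qed.

(** Times and rates are truncated at b, so that finitely many cells suffice and
    their contributions are uniformly small. *)
Let tie i (b : nat) : set T :=
  ~` wait S i 0 `&` ([set w | (S i w <= b%:R%:E)%E] `&` xi @^-1` `[0%R, b%:R]).

Let measurable_tie i b : measurable (tie i b).
Proof.
apply: measurableI; first by apply: measurableC; exact: measurable_wait.
apply: measurableI; last exact: mpre.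
by rewrite -[X in measurable X]setTI; apply: emeasurable_fun_infty_c => //;
  exact: measurable_arrival.
Qed.

Let jumps (b n l : nat) : set T :=
  [set w | (2 <= M (l%:R * hk n + hk n) w - M (l%:R * hk n) w)%N] `&` xi @^-1` `[0%R, b%:R].

(** Simultaneous events at time s > 0 fall in the same cell of any grid; s = 0
    is excluded since M starts at 0. *)
Let tie_jump i b n : tie i b `<=` \big[setU/set0]_(l < (b * n.+1)%N) jumps b n l.
Proof.
move=> w [nw [Sb xb]].
have Sfin : S i w \is a fin_num by rewrite ge0_fin_numE// (le_lt_trans Sb)// ltry.
have Si := esym (fineK Sfin); set s := fine _ in Si.
have s0 : 0 <= s by have := S0 i w; rewrite Si lee_fin.
have hp : 0 < hk n by rewrite invr_gt0.
have Mi (m : nat) : s <= m%:R * hk n -> (i.+1 <= M (m%:R * hk n) w)%N.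
  move=> sm; apply/SM; first by rewrite mulr_ge0// ltW.
  rewrite leNgt; apply/negP => lt; apply: nw; split; first by rewrite Si ltry.
  by rewrite adde0 Si (le_lt_trans _ lt)// lee_fin.
have ex : exists m : nat, s <= m%:R * hk n.
  exists (Num.truncn (s / hk n)).+1.
  by rewrite -ler_pdivrMr// ltW// truncnS_gt.
case: (ex_minnP ex) => -[|m] sm mmin.
  by have := Mi _ sm; rewrite mul0r M0.
have ms : m%:R * hk n < s.
  by rewrite ltNge; apply/negP => /mmin; rewrite ltnn.
have Mm : (M (m%:R * hk n) w < i)%N.
  have mh0 : 0 <= m%:R * hk n by rewrite mulr_ge0// ltW.
  by rewrite ltnNge; apply/negP => /(SM _ _ mh0); rewrite Si lee_fin leNgt ms.
rewrite -(bigcup_mkord _ (jumps b n)); exists m => /=.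
  rewrite -(ltr_nat R) natrM -ltr_pdivrMr// (lt_le_trans ms)//.
  by move: Sb => /=; rewrite Si lee_fin.
split => //; rewrite /= -[X in _ + X]mul1r -mulrDl natr1.
by rewrite ltn_subRL addn1; exact: leq_ltn_trans Mm (Mi _ sm).
Qed.

(** There are b (n+1) cells of length 1/(n+1), each contributing at most
    (b/(n+1))^2. *)
Let tie_null i b : P (tie i b) = 0%E.
Proof.
apply/eqP; rewrite eq_le measure_ge0 andbT; apply/lee_addgt0Pr => e e0; rewrite add0e.
have [n ne] : exists n, b%:R ^+ 3 * hk n <= e.
  exists (Num.truncn (b%:R ^+ 3 / e)); rewrite /hk ler_pdivrMr// mulrC -ler_pdivrMr//.
  by rewrite ltW// truncnS_gt.
have jm l := double_jump_le mxi xi0 Mincr (mulr_ge0 (ler0n R l) (hk0 n)) (hk0 n) (ler0n R b).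
have mJ (l : nat) : measurable (jumps b n l).
  by apply: measurableI; [exact: (jm l).1|exact: mpre].
apply: le_trans (le_measure _ _ _ (@tie_jump i b n)) _; rewrite ?inE//.
  exact: bigsetU_measurable.
apply: le_trans (Boole_inequality P (A := jumps b n) (n := (b * n.+1)%N) _) _ => //.
apply: (@le_trans _ _ (\sum_(l < (b * n.+1)%N) ((b%:R * hk n) ^+ 2)%:E)%E).
  by apply: lee_sum => l _; exact: (jm l).2.
rewrite sumEFin sumr_const card_ord lee_fin (le_trans _ ne)//.
rewrite -[leLHS]mulr_natr natrM /hk le_eqVlt; apply/orP; left; apply/eqP.
have : n.+1%:R != 0 :> R by rewrite pnatr_eq0.
by move: (n.+1%:R : R) => x x0; field.
Qed.

Lemma wait_almost_surely i : P (~` wait S i 0) = 0%E.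
Proof.
have mW : measurable (~` wait S i 0) by apply: measurableC; exact: measurable_wait.
apply/negligibleP => //.
apply: (@negligibleS _ _ _ _ ([set w | S i w = +oo%E] `|` \bigcup_b tie i b)).
  move=> w nw; have [Sy|Sy] := eqVneq (S i w) +oo%E; [by left|right].
  have Sfin : S i w \is a fin_num by rewrite ge0_fin_numE// ltey.
  exists (Num.truncn (Num.max (fine (S i w)) (xi w))).+1 => //; split => //; split => /=.
    by rewrite -(fineK Sfin) lee_fin ltW// (le_lt_trans _ (truncnS_gt _))// le_max lexx.
  by rewrite in_itv/= xi0/= ltW// (le_lt_trans _ (truncnS_gt _))// le_max lexx orbT.
apply: negligibleU; last first.
  by apply: negligible_bigcup => b; apply/negligibleP => //; exact: tie_null.
apply/negligibleP; last exact: arrival_ltoo.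
by have := measurable_arrival i; move/(_ measurableT [set +oo%E]); rewrite setTI; apply.
Qed.

Let mexp v : measurable_fun setT (fun w => expR (- (v * xi w))).
Proof.
by apply: measurableT_comp => //; apply: measurableT_comp => //; exact: measurable_funM.
Qed.

Let integral_wait i v (A : set T) : measurable A ->
  (\int[P]_(w in A `&` wait S i 0) (expR (- (v * xi w)))%:E =
   \int[P]_(w in A) (expR (- (v * xi w)))%:E)%E.
Proof.
move=> mA; rewrite [RHS](@ge0_negligible_integral _ _ _ P A (~` wait S i 0)).
- by rewrite setDE setCK.
- by apply: measurableC; exact: measurable_wait.
- by [].
- by apply: measurable_funTS; exact/measurable_EFinP.
- by move=> w _; rewrite lee_fin expR_ge0.
- exact: wait_almost_surely.
Qed.

Lemma cond_probability_wait i v : 0 <= v ->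
  cond_probability P xi (wait S i v) (fun x => expR (- (v * x))).
Proof.
move=> v0; have [_ mW Wv] := decays_wait i v0; split => // A mA.
by rewrite Wv// setIC integral_wait//; exact: mpre.
Qed.

(** At grid time m h the count j is reached for the first time, and the wait
    after the earlier count i is already known to exceed a h = 1. The latter
    belongs to the past of m h, which is why two waits can be handled. *)
Let both_waits h i j m : set T :=
  first_grid M h j m `&` [set w | exists2 l, first_grid M h i l w &
    exists2 a, a%:R * h = 1 & (l + a <= m)%N /\ M ((l + a)%:R * h) w = i].

(** If the wait after i exceeds 1 and j > i is reached at m h, then m h lies
    after the end of that period, for M still equals i there. *)
Let both_waitsE k i j v : (i < j)%N ->
  \bigcup_m (both_waits (hk k) i j m `&` quiet M (m%:R * hk k) v) =
  grid_wait M (hk k) i 1 `&` grid_wait M (hk k) j v.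
Proof.
move=> ij; have kk : k.+1%:R * hk k = 1 by rewrite mulfV// pnatr_eq0.
apply/seteqP; split => w.
  move=> [m _ [[jm [l il [a ah [lm Mi]]]] q]]; split; last by exists m.
  exists l => //; split => //; have la : l%:R * hk k + 1 = (l + a)%:R * hk k by rewrite natrD mulrDl ah.
  by rewrite /quiet/= la Mi; case: il.
move=> [[l _ [il ql]] [m _ [jm qm]]]; exists m => //; split => //; split => //.
have Ml : M ((l + k.+1)%:R * hk k) w = i.
  by rewrite natrD mulrDl kk; move: ql; rewrite /quiet/= => ->; case: il.
exists l => //; exists k.+1 => //; split => //.
rewrite leqNgt; apply/negP => ml.
have : (M (m%:R * hk k) w <= M ((l + k.+1)%:R * hk k) w)%N.
  by apply: Mnd; rewrite ?mulr_ge0// ler_wpM2r// ler_nat ltnW.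
by case: jm => _ ->; rewrite Ml leqNgt ij.
Qed.

Lemma decays_wait_pair i j v : (i < j)%N -> 0 <= v ->
  decays P xi v (wait S i 1 `&` wait S j 0) (wait S i 1 `&` wait S j v).
Proof.
move=> ij v0.
have conv u : 0 <= u -> forall w, \forall k \near \oo,
    (grid_wait M (hk k) i 1 `&` grid_wait M (hk k) j u) w <-> (wait S i 1 `&` wait S j u) w.
  move=> u0 w; have h1 := near_grid_wait Mnd S0 SM i w (ler01 : 0 <= 1 :> R).
  have h2 := near_grid_wait Mnd S0 SM j w u0.
  by apply: filterS2 h1 h2 => k [a1 a2] [b1 b2]; split=> -[]; split; auto.
apply: (@decays_cvg _ _ _ _ _ mxi xi0 v (fun k => grid_wait M (hk k) i 1 `&` grid_wait M (hk k) j 0)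
  (fun k => grid_wait M (hk k) i 1 `&` grid_wait M (hk k) j v)) => //.
- move=> k; rewrite -!both_waitsE//.
  have := decays_grid mxi xi0 M0 Mnd Mincr (hk0 k) v0 (B := both_waits (hk k) i j).
  rewrite (_ : \bigcup_m (both_waits (hk k) i j m `&` quiet M (m%:R * hk k) 0) =
     \bigcup_m both_waits (hk k) i j m); last first.
    apply: eq_bigcupr => m _; apply/seteqP; split => [w []//|w fw]; split => //.
    by rewrite /quiet/= addr0.
  apply.
    move=> m w w' ww' [jm [l il [a ah [lm Mi]]]]; split; first exact: first_grid_past jm.
    exists l; first by apply: first_grid_past il => l' l'l; apply: ww'; rewrite (leq_trans l'l)// (leq_trans _ lm)// leq_addr.
    by exists a => //; split => //; rewrite -ww'.
  by move=> m m' _ _ [w [[jm _] [jm' _]]]; apply: (@trivIset_first_grid _ _ _ M (hk k) j m m') => //; exists w.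
- exact: conv.
- exact: conv.
Qed.

(** Condition first at the later event, which gives one factor exp (- xi), then
    at the earlier one. *)
Lemma probability_wait_pair i j : (i < j)%N ->
  P (wait S i 1 `&` wait S j 1) = (\int[P]_w (expR (- xi w) ^+ 2)%:E)%E.
Proof.
move=> ij; have [_ _ /(_ _ measurableT)] := decays_wait_pair ij (ler01 : 0 <= 1 :> R).
rewrite preimage_setT !setIT integral_wait; last exact: measurable_wait.
have m1 : measurable_fun setT (fun x : R => expR (- (1 * x))).
  by apply: measurableT_comp => //; apply: measurableT_comp => //; exact: measurable_funM.
move=> ->; rewrite (cond_probability_integral (h := fun x => (expR (- (1 * x)))%:E)
  mxi xi0 (cond_probability_wait i ler01) m1).
- by apply: eq_integral => w _; rewrite -EFinM mul1r expr2.
- by move=> x _; exact: expR_ge0.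
- exact/measurable_EFinP.
- by move=> x; rewrite lee_fin expR_ge0.
Qed.

End arrival_law.

Lemma null_set_eq d (T : measurableType d) (R : realType) (P : probability T R) (N A B : set T) :
  measurable N -> P N = 0%E -> measurable A -> measurable B ->
  (forall w, ~ N w -> A w <-> B w) -> P A = P B.
Proof.
move=> mN PN.
suff le A' B' : measurable A' -> measurable B' -> (forall w, ~ N w -> A' w <-> B' w) -> (P A' <= P B')%E.
  by move=> mA mB AB; apply/eqP; rewrite eq_le !le// => w /AB [].
move=> mA mB AB; apply: (@le_trans _ _ (P (B' `|` N))).
  apply: le_measure; rewrite ?inE//; first exact: measurableU.
  by move=> w Aw; have [Nw|/AB [+ _]] := pselect (N w); [right|left; auto].
by rewrite (le_trans (measureU2 _ _ _))// [X in (_ + X)%E]PN adde0.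
Qed.

Lemma independentC d (T : measurableType d) (R : realType) (P : probability T R) (F G : set (set T)) :
  independent P F G -> independent P G F.
Proof. by move=> FG A B GA FB; rewrite setIC FG// muleC. Qed.

Section interarrival_law.
Context d (T : measurableType d) (R : realType) (P : probability T R).
Variables (alpha beta c : R) (xi : T -> R).
Variables (M : R -> T -> nat) (S X : nat -> T -> \bar R).
Hypotheses (beta0 : 0 < beta) (c0 : c != 0).
Hypotheses (xi0 : forall w, 0 <= xi w) (xiS : Stacy P alpha beta c xi).
Hypothesis M0 : forall w, M 0 w = 0%N.
Hypothesis mM : forall s, 0 <= s -> measurable_fun setT (M s).
Hypothesis Mnd : forall w s u, 0 <= s -> s <= u -> (M s w <= M u w)%N.
Hypothesis Mincr : mixed_increments P xi M.
Hypothesis S0 : forall n w, (0 <= S n w)%E.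
Hypothesis SM : forall n w (u : R), 0 <= u -> (S n w <= u%:E)%E <-> (n <= M u w)%N.
Hypothesis mX : forall i, measurable_fun setT (X i).
Hypothesis XS : forall i w, (S i w < +oo)%E -> X i w = (S i.+1 w - S i w)%E.

Let mxi : measurable_fun setT xi. Proof. exact: stacy_measurable xiS. Qed.

Let Wcond i v (v0 : 0 <= v) := cond_probability_wait xi0 xiS M0 mM Mnd Mincr S0 SM i v0.
Let W1 i := wait_almost_surely xi0 xiS M0 mM Mnd Mincr S0 SM i.

Let Xgt i (v : R) w : wait S i 0 w -> (v%:E < X i w)%E <-> wait S i v w.
Proof.
move=> [Sfin _]; rewrite XS//; have Sf : S i w \is a fin_num by rewrite ge0_fin_numE.
rewrite lteBrDr// addeC.
by split => [h|[]//]; split.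
Qed.

Let mXgt i (v : R) : measurable [set w | (v%:E < X i w)%E].
Proof. by rewrite -[X in measurable X]setTI; apply: emeasurable_fun_o_infty. Qed.

Let PXgt i v (v0 : 0 <= v) : P [set w | (v%:E < X i w)%E] = (\int[P]_w (expR (- (v * xi w)))%:E)%E.
Proof.
rewrite -(cond_probability_total (Wcond i v0)).
apply: (null_set_eq (N := ~` wait S i 0)) => //.
- by apply: measurableC; exact: (Wcond i (lexx 0)).1.
- exact: (Wcond i v0).1.
- by move=> w /contrapT Ww; exact: Xgt.
Qed.

Lemma interarrival_Exp_St i : Exp_St P alpha beta c (X i).
Proof.
apply: (exp_st_tail beta0 c0 xi0 xiS) => // [|u u0]; last first.
  by rewrite PXgt//; apply: eq_integral => w _; rewrite mulrC.
rewrite -[RHS](measure0 P); apply: (null_set_eq (N := ~` wait S i 0)) => //.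
- by apply: measurableC; exact: (Wcond i (lexx 0)).1.
- by rewrite -[X in measurable X]setTI; apply: emeasurable_fun_infty_o.
- move=> w /contrapT Ww; split => //= X0.
  by have /(Xgt 0 Ww) := Ww; rewrite ltNge ltW.
Qed.

Let E1 := (\int[P]_w (expR (- xi w))%:E)%E.

(** A null integral would make xi almost surely equal to - ln q. *)
Let no_constant (q : R) : (\int[P]_w ((expR (- xi w) - q) ^+ 2)%:E)%E <> 0%E.
Proof.
move=> I0.
have me : measurable_fun setT (fun w => (expR (- xi w) - q) ^+ 2).
  apply: measurable_funX; apply: measurable_funB => //.
  by apply: measurableT_comp => //; exact: measurableT_comp.
have : ae_eq P setT (fun w => ((expR (- xi w) - q) ^+ 2)%:E) (cst 0%E).
  apply/ae_eq_integral_abs => //; first exact/measurable_EFinP.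
  by rewrite -I0; apply: eq_integral => w _; rewrite gee0_abs// lee_fin sqr_ge0.
move=> [N [mN PN sub]].
have : P [set: T] = 0%E.
  have m1 : measurable (xi @^-1` [set - ln q]).
    by rewrite -[_ @^-1` _]setTI; apply: mxi => //; exact: measurable_set1.
  apply/eqP; rewrite eq_le measure_ge0 andbT.
  apply: (@le_trans _ _ (P (N `|` xi @^-1` [set - ln q]))).
    apply: le_measure; rewrite ?inE//; first exact: measurableU.
    move=> w _; have [Nw|nN] := pselect (N w); [by left|right].
    have /= := contra_notP (@sub w) nN.
    move=> /(_ Logic.I)/eqP; rewrite eqe sqrf_eq0 subr_eq0 => /eqP eq.
    by rewrite /= -eq expRK opprK.
  rewrite (le_trans (measureU2 _ _ _))//.
  by rewrite [X in (X + _)%E]PN add0e [leLHS](stacy_null xiS).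
by rewrite probability_setT => /eqP; rewrite onee_eq0.
Qed.

(** Test independence on the events that the waits exceed 1. It would give the
    exponential of - xi a variance equal to 0. *)
Lemma interarrival_dependent i j : i != j ->
  ~ independent P (sigma_rv (X i)) (sigma_rv (X j)).
Proof.
wlog ij : i j / (i < j)%N.
  move=> wlg; rewrite neq_ltn => /orP[ij|ji]; first by apply: wlg => //; rewrite ltn_eqF.
  by move=> /independentC; apply: wlg => //; rewrite ltn_eqF.
move=> _ ind.
have XE k : [set w | (1%:E < X k w)%E] = X k @^-1` `]1%:E, +oo[%classic.
  by apply/seteqP; split => w /=; rewrite in_itv/= andbT.
have sX k : sigma_rv (X k) [set w | (1%:E < X k w)%E].
  by rewrite XE; exists `]1%:E, +oo[%classic => //; exact: emeasurable_itv.
have := ind _ _ (sX i) (sX j).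
have -> : P ([set w | (1%:E < X i w)%E] `&` [set w | (1%:E < X j w)%E]) =
    P (wait S i 1 `&` wait S j 1).
  apply: (null_set_eq (N := ~` wait S i 0 `|` ~` wait S j 0)).
  - by apply: measurableU; apply: measurableC; [exact: (Wcond i (lexx 0)).1|exact: (Wcond j (lexx 0)).1].
  - apply/eqP; rewrite eq_le measure_ge0 andbT (le_trans (measureU2 _ _ _))//.
    + by apply: measurableC; exact: (Wcond i (lexx 0)).1.
    + by apply: measurableC; exact: (Wcond j (lexx 0)).1.
    + by rewrite [X in (X + _)%E]W1 [X in (_ + X)%E]W1 adde0.
  - exact: measurableI.
  - by apply: measurableI; [exact: (Wcond i ler01).1|exact: (Wcond j ler01).1].
  - move=> w /not_orP[/contrapT Wi /contrapT Wj] /=.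
    by rewrite (Xgt 1 Wi) (Xgt 1 Wj).
rewrite (probability_wait_pair xi0 xiS M0 mM Mnd Mincr S0 SM ij) !PXgt//.
have -> : (\int[P]_w (expR (- (1 * xi w)))%:E)%E = E1.
  by apply: eq_integral => w _; rewrite mul1r.
have me : measurable_fun setT (fun w => expR (- xi w)).
  by apply: measurableT_comp => //; exact: measurableT_comp.
have E1fin : E1 \is a fin_num.
  rewrite ge0_fin_numE; last by apply: integral_ge0 => w _; rewrite lee_fin expR_ge0.
  rewrite (@le_lt_trans _ _ (\int[P]_w (cst 1%E w))%E)//.
    apply: ge0_le_integral => //; first by apply/measurable_EFinP.
    by move=> w _; rewrite lee_fin expR_le1 oppr_le0.
  by rewrite integral_cst// mul1e (le_lt_trans (probability_le1 P measurableT))// ltry.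
rewrite -(fineK E1fin); set q := fine E1 => Eq2.
have q0 : 0 <= q by apply: fine_ge0; apply: integral_ge0 => w _; rewrite lee_fin expR_ge0.
apply: (@no_constant q).
have : (\int[P]_w ((expR (- xi w) ^+ 2)%:E + (q ^+ 2)%:E) =
    \int[P]_w (((expR (- xi w) - q) ^+ 2)%:E + (2 * q * expR (- xi w))%:E))%E.
  by apply: eq_integral => w _; rewrite -!EFinD; congr EFin; ring.
rewrite ge0_integralD//; last 2 first.
- by apply/measurable_EFinP; exact: measurable_funX.
- by move=> w _; rewrite lee_fin sqr_ge0.
rewrite ge0_integralD//; last 4 first.
- by move=> w _; rewrite lee_fin sqr_ge0.
- by apply/measurable_EFinP; apply: measurable_funX; exact: measurable_funB.
- by move=> w _; rewrite lee_fin !mulr_ge0 ?expR_ge0.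
- by apply/measurable_EFinP; exact: measurable_funM.
rewrite Eq2 integral_cst// [X in (_ + _ * X = _)%E](_ : _ = 1%E); last exact: probability_setT.
under [X in (_ = _ + X)%E]eq_integral do rewrite EFinM.
rewrite ge0_integralZl//; last 2 first.
- by apply/measurable_EFinP.
- by rewrite lee_fin mulr_ge0.
rewrite -/E1 -(fineK E1fin) -/q mule1 -!EFinM -EFinD.
move: (\int[P]_w _)%E => [r||]//= [] h; congr EFin; lra.
Qed.

End interarrival_law.

(** * Arrival times and time change *)

Section arrival_times.
Context d (T : measurableType d) (R : realType).
Variables (N : R -> T -> nat) (tau : nat -> T -> \bar R).
Hypothesis Ntau : interoccurrence_times N tau.

Let tau0 i w : (0 <= tau i w)%E. Proof. by have [_ + _] := Ntau; apply. Qed.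

Lemma arrivalS n w : arrival tau n.+1 w = (arrival tau n w + tau n w)%E.
Proof. by rewrite /arrival big_ord_recr. Qed.

Lemma arrival_ge0 n w : (0 <= arrival tau n w)%E.
Proof. by apply: sume_ge0 => i _; exact: tau0. Qed.

Lemma arrival_homo w : {homo (fun n => arrival tau n w) : n m / (n <= m)%N >-> (n <= m)%E}.
Proof.
apply: homo_leq => [//|x y z|n]; first exact: le_trans.
by rewrite arrivalS leeDl.
Qed.

(** The set of n with T_n <= t is closed downwards as the interoccurrence times
    are nonnegative, so its supremum N t, being finite, belongs to it. *)
Lemma arrival_le n w t : 0 <= t -> (arrival tau n w <= t%:E)%E <-> (n <= N t w)%N.
Proof.
move=> t0; have [_ _ /(_ _ w t0) Nt] := Ntau; split => [nt|nN].
  rewrite -(ler_nat R) -lee_fin Nt; apply: ereal_sup_ubound.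
  by exists n.
rewrite leNgt; apply/negP => nt.
case: n nN nt => [|n] nN nt.
  by move: nt; rewrite /arrival big_ord0 lte_fin ltNge t0.
have : ((N t w)%:R%:E <= n%:R%:E :> \bar R)%E.
  rewrite Nt; apply: ge_ereal_sup => _ [k kt <-].
  rewrite lee_fin ler_nat -ltnS ltnNge; apply/negP => nk.
  have := le_lt_trans kt nt; by rewrite ltNge (arrival_homo w nk).
by rewrite lee_fin ler_nat leqNgt nN.
Qed.

End arrival_times.

Section time_scales.
Context {R : realType}.
Variable lambda : R -> R.
Hypothesis lam : time_scale lambda.

Lemma time_scale_le s t : 0 <= s -> s <= t -> lambda s <= lambda t.
Proof.
have [_ inc _ _] := lam; move=> s0; rewrite le_eqVlt => /orP[/eqP->//|st].
exact/ltW/inc.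
Qed.

Lemma time_scale_leE s t : 0 <= s -> 0 <= t -> (lambda s <= lambda t) = (s <= t).
Proof.
move=> s0 t0; have [_ inc _ _] := lam.
apply/idP/idP => [|st]; last exact: time_scale_le.
by apply: contraTT; rewrite -!ltNge => /(inc _ _ t0).
Qed.

Lemma time_scale_surj u : lambda t @[t --> +oo] --> +oo -> 0 <= u ->
  exists2 t, 0 <= t & lambda t = u.
Proof.
move=> oo u0; have [_ inc cont l0] := lam.
have [b b0 ub] : exists2 b, 0 <= b & u <= lambda b.
  have : \forall t \near +oo, u <= lambda t by move/cvgryPge : oo; exact.
  move=> near_u; have : \forall t \near +oo, 0 <= t /\ u <= lambda t.
    by near=> t; split; near: t => //; exact: nbhs_pinfty_ge.
  by move=> /filter_ex[t []]; exists t.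
have cb : {within `[0, b], continuous lambda}.
  apply: continuous_subspaceW cont => x /=; rewrite !in_itv/= andbT.
  by case/andP.
have [|t] := IVT b0 cb (v := u).
  by rewrite l0 min_l ?max_r ?u0// (le_trans u0 ub).
by rewrite in_itv/= => /andP[t0 _] <-; exists t.
Unshelve. all: by end_near. Qed.

End time_scales.

Theorem theorem3 (d : measure_display) (T : measurableType d) (R : realType)
    (P : probability T R) (alpha beta c : R) (lambda : R -> R)
    (xi : T -> R) (N : R -> T -> nat)
    (alpha_gt0 : 0 < alpha) (beta_gt0 : 0 < beta) (c_neq0 : c != 0)
    (HN : MPPS P alpha beta c lambda xi N) :
  (* (a) *)
  (forall t : R, 0 < t -> MPStacy P alpha (beta / lambda t) c (N t)) /\
  (* (b) *)
  (forall t : R, 0 <= t -> - c^-1 < alpha ->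
    ('E_P[fun w => ((N t w)%:R)%R])%E
      = (Gamma (alpha + c^-1) / (beta * Gamma alpha) * lambda t)%:E) /\
  (forall t : R, 0 <= t -> - Num.min c^-1 (2 / c) < alpha ->
    ('V_P[fun w => ((N t w)%:R)%R])%E
      = (lambda t * (Gamma (alpha + c^-1) / (beta * Gamma alpha))
         * (1 + lambda t * (Gamma (alpha + 2 / c) / (beta * Gamma (alpha + c^-1))
                            - Gamma (alpha + c^-1) / (beta * Gamma alpha))))%:E) /\
  (* (c) *)
  (forall t z : R, 0 <= t -> z < 1 ->
    (-1 <= z -> P.-integrable setT (fun w => (z ^+ N t w)%:E)) /\
    (P.-integrable setT (fun w => (z ^+ N t w)%:E) ->
     ('E_P[fun w => (z ^+ N t w)%R])%E
       = (`|c| / Gamma alpha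
          * kratzel (- c) (- c * alpha) (lambda t / beta * (1 - z)))%:E)) /\
  (* (d) *)
  (forall (t : R) (n : nat), 0 < t ->
    has_cond_density P xi [set w | N t w = n]
      (fun x => if 0 < x then
         beta `^ (c * alpha + n%:R) * x `^ (c * alpha + n%:R - 1)
           / kratzel (- c) (- c * alpha - n%:R) (lambda t / beta)
           * expR (- lambda t * x - (beta * x) `^ c)
       else 0)) /\
  (* (e) *)
  (forall (t : R) (n : nat), 0 < t ->
    cond_mean P xi [set w | N t w = n]
      = (kratzel (- c) (- c * alpha - n%:R - 1) (lambda t / beta)
         / (beta * kratzel (- c) (- c * alpha - n%:R) (lambda t / beta)))%:E) /\
  (* (f) *)
  (forall (t : R) (k : nat), 0 <= t -> - alpha < k%:R / c ->
    ('E_P[fun w => (\prod_(i < k) ((N t w)%:R - i%:R))%R])%E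
      = ((lambda t ^+ k)%R%:E * 'E_P[fun w => (xi w ^+ k)%R])%E /\
    ((lambda t ^+ k)%R%:E * 'E_P[fun w => (xi w ^+ k)%R])%E
      = (lambda t ^+ k * Gamma (alpha + k%:R / c)
         / (beta ^+ k * Gamma alpha))%:E) /\
  (* (g), (h) *)
  (forall (n : nat) (t : nat -> R), (0 < n)%N -> 0 <= t 0%N ->
    (forall i, (i.+1 < n)%N -> t i <= t i.+1) ->
    O_PS P n alpha beta c (fun i => lambda (t i))
      (fun i w => (N (t i) w)%:R) /\
    M_PS P n alpha beta c (fun i => lambda (t i))
      (fun i w => (N (t i) w)%:R - before 0 (fun j => (N (t j) w)%:R) i)) /\
  (* (i), (j) *)
  (forall tau : nat -> T -> \bar R, interoccurrence_times N tau ->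
    ((forall t : R, 0 <= t -> lambda t = t) ->
      (forall i j, i != j ->
         ~ independent P (sigma_rv (tau i)) (sigma_rv (tau j))) /\
      (forall i, Exp_St P alpha beta c (tau i)) /\
      (forall n, (0 < n)%N -> Erlang_St P n alpha beta c (arrival tau n))) /\
    (lambda t @[t --> +oo] --> +oo ->
      let S n w := er_map lambda (arrival tau n w) in
      let sigma i w := (S i.+1 w - S i w)%E in
      (forall i j, i != j ->
         ~ independent P (sigma_rv (sigma i)) (sigma_rv (sigma j))) /\
      (forall i, Exp_St P alpha beta c (sigma i)) /\
      (forall n, (0 < n)%N -> Erlang_St P n alpha beta c (S n)))).
Proof.
have [lam xiS xi0 [N1 [N1P ind NE]]] := HN.
have mxi := stacy_measurable xiS.
have [lam_ge0 lam_lt _ lam0] := lam.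
pose M := mixed xi N1.
have NM t : 0 <= t -> N t = M (lambda t) by move=> t0; apply/funext => w; exact: NE.
have lamt t : 0 < t -> 0 < lambda t by move=> t0; rewrite -lam0 lam_lt.
have M0 : forall w, M 0 w = 0%N := mixed0 xi N1P.
have mM : forall s, 0 <= s -> measurable_fun setT (M s).
  by move=> s; exact: (measurable_mixed mxi xi0 N1P ind).
have Mnd : forall w s u, 0 <= s -> s <= u -> (M s w <= M u w)%N.
  by move=> w s u; exact: (mixed_nd xi0 N1P).
have Mincr := mixed_increments_mixed mxi xi0 N1P ind.
split; [|split; [|split; [|split; [|split; [|split; [|split; [|split]]]]]]].
- move=> t t0; rewrite (NM _ (ltW t0)).
  exact: (mixed_MPStacy beta_gt0 c_neq0 xi0 xiS M0 mM Mincr (lamt t t0)).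
- move=> t t0 ha; rewrite (NM _ t0).
  exact: (mixed_mean beta_gt0 c_neq0 xi0 xiS M0 mM Mincr (lam_ge0 t t0)).
- move=> t t0 ha; rewrite (NM _ t0).
  exact: (mixed_variance beta_gt0 c_neq0 xi0 xiS M0 mM Mincr (lam_ge0 t t0)).
- move=> t z t0 z1; rewrite (NM _ t0).
  exact: (mixed_pgf beta_gt0 c_neq0 xi0 xiS M0 mM Mincr (lam_ge0 t t0)).
- move=> t n t0; rewrite (NM _ (ltW t0)).
  exact: (mixed_cond_density beta_gt0 c_neq0 xi0 xiS M0 Mincr n (lamt t t0)).
- move=> t n t0; rewrite (NM _ (ltW t0)).
  exact: (mixed_cond_mean beta_gt0 c_neq0 xi0 xiS M0 Mincr n (lamt t t0)).
- move=> t k t0 ha; rewrite (NM _ t0).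
  exact: (mixed_ffact_moment beta_gt0 c_neq0 xi0 xiS M0 mM Mincr (lam_ge0 t t0)).
- move=> n t n0 t00 tnd.
  have tge0 i : (i < n)%N -> 0 <= t i.
    by elim: i => // i IHi lt; rewrite (le_trans (IHi (ltnW lt)))// tnd.
  have NMi i w : (i < n)%N -> N (t i) w = M (lambda (t i)) w by move=> /tge0/NM ->.
  have lnd i : (i.+1 < n)%N -> lambda (t i) <= lambda (t i.+1).
    by move=> lt; rewrite time_scale_le// ?tnd// tge0// ltnW.
  split.
    exact: (mixed_O_PS beta_gt0 c_neq0 xi0 xiS M0 mM Mnd Mincr n0 (lam_ge0 _ t00) lnd NMi).
  exact: (mixed_M_PS beta_gt0 c_neq0 xi0 xiS M0 mM Mnd Mincr n0 (lam_ge0 _ t00) lnd NMi).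
move=> tau Ntau; have [mtau tau0 _] := Ntau; split.
(* In its own time scale the process N is M, and S, X of the previous results
   are the arrival and interoccurrence times. *)
  move=> lamid.
  have SM n w (u : R) : 0 <= u -> (arrival tau n w <= u%:E)%E <-> (n <= M u w)%N.
    by move=> u0; rewrite (arrival_le Ntau)// NM// lamid.
  have XS i w : (arrival tau i w < +oo)%E ->
      tau i w = (arrival tau i.+1 w - arrival tau i w)%E.
    move=> fin; rewrite arrivalS addeAC subee ?add0e//.
    by rewrite ge0_fin_numE// (arrival_ge0 Ntau).
  have S0 := arrival_ge0 Ntau.
  split; [|split].
  - by move=> i j; exact: (interarrival_dependent xi0 xiS M0 mM Mnd Mincr S0 SM mtau XS).
  - by move=> i; exact: (interarrival_Exp_St beta_gt0 c_neq0 xi0 xiS M0 mM Mnd Mincr S0 SM mtau XS).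
  - by move=> n; exact: (arrival_Erlang_St beta_gt0 c_neq0 xi0 xiS M0 mM Mincr S0 SM).
(* S n is the time of the n-th event of M, as lambda is an increasing
   bijection. *)
move=> lamoo S sigma.
have S0 n w : (0 <= S n w)%E.
  rewrite /S; case: (arrival tau n w) (arrival_ge0 Ntau n w) => [r| |]//=.
    by rewrite !lee_fin; exact: lam_ge0.
have SM n w (u : R) : 0 <= u -> (S n w <= u%:E)%E <-> (n <= M u w)%N.
  move=> u0; have [t t0 <-] := time_scale_surj lam lamoo u0.
  rewrite -NM// -(arrival_le Ntau)// /S.
  case: (arrival tau n w) (arrival_ge0 Ntau n w) => [r| |]//=.
  by rewrite !lee_fin => r0; rewrite (time_scale_leE lam).
have mS n : measurable_fun setT (S n) := measurable_arrival mM S0 SM n.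
have msigma i : measurable_fun setT (sigma i) by exact: emeasurable_funB.
have XS i w : (S i w < +oo)%E -> sigma i w = (S i.+1 w - S i w)%E by [].
split; [|split].
- by move=> i j; exact: (interarrival_dependent xi0 xiS M0 mM Mnd Mincr S0 SM msigma XS).
- by move=> i; exact: (interarrival_Exp_St beta_gt0 c_neq0 xi0 xiS M0 mM Mnd Mincr S0 SM msigma XS).
- by move=> n; exact: (arrival_Erlang_St beta_gt0 c_neq0 xi0 xiS M0 mM Mincr S0 SM).
Qed.
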